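(* Let $(M,g)$ be a compact Riemannian manifold, $(N,\omega)$ a symplectic manifold, and $\varphi:M\to N$ a smooth map such that $\varphi^*\omega$ is coclosed, i.e. $\delta\varphi^*\omega=0$. Then $\varphi$ minimizes $F$ in its homotopy class: $F(\varphi)\le F(\psi)$ for every smooth map $\psi:M\to N$ homotopic to $\varphi$.
   Context: All maps are smooth; compact manifolds are without boundary. $\delta$ is the coderivative on differential forms of $(M,g)$, the formal $L^2$-adjoint of the exterior derivative $d$. For a smooth map $\varphi:(M,g)\to(N,\omega)$, $F(\varphi)=\frac12\int_M\|\varphi^*\omega\|^2\,d\mathrm{vol}_g$, where $\|\cdot\|$ is the pointwise norm on $2$-forms induced by $g$ (for an orthonormal coframe $e^1,\dots,e^m$, the forms $e^i\wedge e^j$, $i<j$, are orthonormal). *)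

(* Defs.v *)
From HB Require Import structures.
From mathcomp Require Import all_boot all_order all_algebra.
From mathcomp Require Import all_classical all_reals all_analysis.

Set Implicit Arguments.
Unset Strict Implicit.
Unset Printing Implicit Defensive.

Import Order.TTheory GRing.Theory Num.Theory.
Import numFieldNormedType.Exports.

Local Open Scope classical_set_scope.
Local Open Scope ring_scope.

Section euclidean.
Context {R : realType}.

Definition partial {m : nat} {V : normedModType R} (i : 'I_m)
    (f : 'rV[R]_m -> V) (y : 'rV[R]_m) : V := 'D_(delta_mx 0 i) f y.

(* [U] is meant to be open: (Frechet) differentiability and continuity at the
   points of [U] only involve the values of [f] on [U]. *)
Fixpoint Ck {m : nat} {V : normedModType R} (k : nat) (U : set 'rV[R]_m)
    (f : 'rV[R]_m -> V) : Prop :=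
  match k with
  | 0%N => forall y, U y -> {for y, continuous f}
  | k'.+1 => (forall y, U y -> differentiable f y) /\
             (forall i : 'I_m, Ck k' U (partial i f))
  end.

Definition smooth_on {m : nat} {V : normedModType R} (U : set 'rV[R]_m)
    (f : 'rV[R]_m -> V) : Prop := forall k, Ck k U f.

(* Lebesgue integral on R^m of a nonnegative Borel function, as an iterated
   integral (Tonelli). *)
Fixpoint lebesgue_int {m : nat} : ('rV[R]_m -> \bar R) -> \bar R :=
  match m with
  | 0%N => fun f => f 0
  | m'.+1 => fun f => (\int[@lebesgue_measure R]_t
      lebesgue_int (fun y : 'rV[R]_m' => f (row_mx (t : R)%:M y)))%E
  end.

End euclidean.

(* A smooth m-manifold without boundary, given by a smooth atlas; [param c] is
   the inverse of [chart c], with arbitrary values outside the image.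
   [chart_at p] is a preferred chart around [p]. Carriers are pointed because
   measurable types are. *)
Record manifold (R : realType) (m : nat) := Manifold {
  carrier :> ptopologicalType;
  index : Type;
  dom : index -> set carrier;
  chart : index -> carrier -> 'rV[R]_m;
  param : index -> 'rV[R]_m -> carrier;
  chart_at : carrier -> index;
  manifold_hausdorff : hausdorff_space carrier;
  manifold_second_countable : @second_countable carrier;
  dom_chart_at : forall p, dom (chart_at p) p;
  dom_open : forall c, open (dom c);
  image_open : forall c, open (chart c @` dom c);
  chartK : forall c p, dom c p -> param c (chart c p) = p;
  chart_continuous : forall c p, dom c p -> {for p, continuous (chart c)};
  param_continuous : forall c y, (chart c @` dom c) y ->
    {for y, continuous (param c)};
  transition_smooth : forall c c',
    smooth_on (chart c @` (dom c `&` dom c')) (chart c' \o param c)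
}.

Arguments dom {R m} _ _.
Arguments chart {R m} _ _.
Arguments param {R m} _ _.
Arguments chart_at {R m} _ _.

Definition smooth_map {R : realType} {m n : nat} (M : manifold R m)
    (N : manifold R n) (f : M -> N) : Prop :=
  continuous f /\
  forall c d,
    smooth_on [set y | (chart M c @` dom M c) y /\ dom N d (f (param M c y))]
      (chart N d \o f \o param M c).

(* The homotopy is only required to be continuous, so the homotopy class is the
   usual (largest) one. *)
Definition homotopic {R : realType} {m n : nat} (M : manifold R m)
    (N : manifold R n) (f h : M -> N) : Prop :=
  exists H : M * R -> N,
    [/\ {within [set: M] `*` `[0%R, 1%R]%classic, continuous H},
        (forall p, H (p, 0) = f p) & (forall p, H (p, 1) = h p)].

(* The tangent space at [p] is 'rV[R]_m, a row vector holding the components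
   of a tangent vector in the chart [chart_at M p]. Thus
   - a 1-form is a map eta : M -> 'cV[R]_m, with eta_p(v) = v *m eta p;
   - a bilinear form is a map a : M -> 'M[R]_m, with
     a_p(u, v) = u *m a p *m v^T; it is a 2-form when the matrices are skew. *)
Section tensors.
Context {R : realType} {m : nat} (M : manifold R m).

Definition coord_change (c : index M) (y : 'rV[R]_m) : 'M[R]_m :=
  'J (chart M (chart_at M (param M c y)) \o param M c) y.

Definition coord1 (eta : M -> 'cV[R]_m) (c : index M) (y : 'rV[R]_m)
    : 'cV[R]_m :=
  coord_change c y *m eta (param M c y).

Definition coord2 (a : M -> 'M[R]_m) (c : index M) (y : 'rV[R]_m) : 'M[R]_m :=
  coord_change c y *m a (param M c y) *m (coord_change c y)^T.

Definition smooth1 (eta : M -> 'cV[R]_m) : Prop :=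
  forall c, smooth_on (chart M c @` dom M c) (coord1 eta c).

Definition smooth2 (a : M -> 'M[R]_m) : Prop :=
  forall c, smooth_on (chart M c @` dom M c) (coord2 a c).

Definition is_form2 (a : M -> 'M[R]_m) : Prop :=
  (forall p, (a p)^T = - a p) /\ smooth2 a.

(* (d eta)_ij = d_i eta_j - d_j eta_i *)
Definition d1 (eta : M -> 'cV[R]_m) (p : M) : 'M[R]_m :=
  let c := chart_at M p in
  \matrix_(i, j) (partial i (coord1 eta c) (chart M c p) j 0
                  - partial j (coord1 eta c) (chart M c p) i 0).

(* (d a)_ijk = d_i a_jk + d_j a_ki + d_k a_ij *)
Definition d2 (a : M -> 'M[R]_m) (p : M) (i j k : 'I_m) : R :=
  let c := chart_at M p in
  partial i (coord2 a c) (chart M c p) j k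
  + partial j (coord2 a c) (chart M c p) k i
  + partial k (coord2 a c) (chart M c p) i j.

Record riemannian_metric := RiemannianMetric {
  metric :> M -> 'M[R]_m;
  metric_sym : forall p, (metric p)^T = metric p;
  metric_pos : forall p (v : 'rV[R]_m), v != 0 ->
    0 < (v *m metric p *m v^T) 0 0;
  metric_smooth : smooth2 metric
}.

Record symplectic_form := SymplecticForm {
  sform :> M -> 'M[R]_m;
  sform_form2 : is_form2 sform;
  sform_closed : forall p i j k, d2 sform p i j k = 0;
  sform_nondegenerate : forall p (u : 'rV[R]_m),
    (forall v : 'rV[R]_m, (u *m sform p *m v^T) 0 0 = 0) -> u = 0
}.

Definition borel := g_sigma_algebraType (@open M).

End tensors.

Section pullback.
Context {R : realType} {m n : nat} (M : manifold R m) (N : manifold R n).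

Definition tangent_map (f : M -> N) (p : M) : 'M[R]_(m, n) :=
  'J (chart N (chart_at N (f p)) \o f \o param M (chart_at M p))
     (chart M (chart_at M p) p).

Definition pullback (f : M -> N) (a : N -> 'M[R]_n) (p : M) : 'M[R]_m :=
  tangent_map f p *m a (f p) *m (tangent_map f p)^T.

End pullback.

Section riemannian.
Context {R : realType} {m : nat} (M : manifold R m) (g : riemannian_metric M).

(* The Riemannian volume measure: the Borel measure that is
   sqrt (det g_ij) dx in each chart. *)
Definition riemannian_volume (vol : {measure set (borel M) -> \bar R}) : Prop :=
  forall (c : index M) (A : set (borel M)), measurable A -> A `<=` dom M c ->
    vol A = lebesgue_int (fun y : 'rV[R]_m =>
      (\1_(chart M c @` A) y * Num.sqrt (\det (coord2 g c y)))%:E).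

Definition inner1 (p : M) (eta theta : 'cV[R]_m) : R :=
  (eta^T *m invmx (g p) *m theta) 0 0.

(* <a, b> = 1/2 g^ik g^jl a_ij b_kl *)
Definition inner2 (p : M) (a b : 'M[R]_m) : R :=
  2^-1 * \tr (invmx (g p) *m a *m invmx (g p) *m b^T).

Definition norm2 (p : M) (a : 'M[R]_m) : R := Num.sqrt (inner2 p a a).

Lemma inner2_orthonormal (p : M) (E a b : 'M[R]_m) :
  E *m g p *m E^T = 1%:M -> a^T = - a -> b^T = - b ->
  inner2 p a b =
    \sum_(i < m) \sum_(j < m | (i < j)%N) (E *m a *m E^T) i j * (E *m b *m E^T) i j.
Proof.
move=> EgE aN bN.
have ginv : invmx (g p) = E^T *m E.
  have EtEg : E^T *m E *m g p = 1%:M.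
    by rewrite -mulmxA; apply: mulmx1C; rewrite EgE.
  have [_ ug] := mulmx1_unit EtEg.
  by rewrite -[LHS]mul1mx -EtEg mulmxK.
set u := E *m a *m E^T; set v := E *m b *m E^T.
have uN i j : u j i = - u i j.
  have : u^T = - u by rewrite /u !trmx_mul trmxK aN mulmxA mulmxN mulNmx.
  by move/matrixP/(_ i j); rewrite !mxE.
have vN i j : v j i = - v i j.
  have : v^T = - v by rewrite /v !trmx_mul trmxK bN mulmxA mulmxN mulNmx.
  by move/matrixP/(_ i j); rewrite !mxE.
have -> : inner2 p a b = 2^-1 * \tr (u *m v^T).
  rewrite /inner2 ginv -!mulmxA [in LHS]mxtrace_mulC /u /v !trmx_mul trmxK.
  by rewrite !mulmxA.
have tr_sum : \tr (u *m v^T) = \sum_(i < m) \sum_(j < m) u i j * v i j.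
  apply: eq_bigr => i _; rewrite mxE; apply: eq_bigr => j _.
  by rewrite [v^T _ _]mxE.
set S := RHS.
suff -> : \tr (u *m v^T) = S + S by rewrite -mulr2n -[S *+ 2]mulr_natl mulKf ?pnatr_eq0.
have Sgt : S = \sum_(i < m) \sum_(j < m | (j < i)%N) u i j * v i j.
  rewrite /S (exchange_big_dep xpredT)//=; apply: eq_bigr => i _.
  by apply: eq_bigr => j _; rewrite uN vN mulrNN.
rewrite tr_sum {2}Sgt /S -big_split/=; apply: eq_bigr => i _.
rewrite (bigID (fun j : 'I_m => (i < j)%N))/=; congr (_ + _).
rewrite (bigD1 i) ?ltnn//=.
have -> : u i i = 0 by apply/eqP; rewrite -eqNr -uN.
rewrite mul0r add0r; apply: eq_bigl => j.
by rewrite -leqNgt ltn_neqAle andbC.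
Qed.

Variable vol : {measure set (borel M) -> \bar R}.

(* [beta] is the coderivative of [a]: the 1-form with
   << a, d eta >> = << beta, eta >> for the L^2 inner products. *)
Definition is_coderivative (a : M -> 'M[R]_m) (beta : M -> 'cV[R]_m) : Prop :=
  smooth1 beta /\
  forall eta : M -> 'cV[R]_m, smooth1 eta ->
    compact (closure [set p | eta p != 0]) ->
    (\int[vol]_p (inner2 p (a p) (d1 eta p))%:E
     = \int[vol]_p (inner1 p (beta p) (eta p))%:E)%E.

Definition coclosed (a : M -> 'M[R]_m) : Prop :=
  is_coderivative a (fun=> 0).

Definition energy {n : nat} (N : manifold R n) (omega : symplectic_form N)
    (f : M -> N) : \bar R :=
  ((2^-1)%:E * \int[vol]_p (norm2 p (pullback f omega p) ^+ 2)%:E)%E.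

End riemannian.

(* Main.v *)
(** The class of [f^* omega] in de Rham cohomology only depends on the homotopy
    class of [f]: [psi^* omega - phi^* omega = d eta]. Coclosedness makes
    [phi^* omega] orthogonal to [d eta] in L^2, and
    [|psi^* omega|^2 >= |phi^* omega|^2 + 2 <phi^* omega, d eta>] pointwise.

    The homotopy is only continuous, so the form [eta] is produced by moving maps
    one coordinate ball at a time. If two smooth maps agree off a closed set which
    both send into a coordinate ball, where [omega = d alpha], the difference of
    their pullbacks of [alpha] extends by zero to a global primitive. Interpolating
    linearly in the charts, patch after patch, shows that two smooth maps which are
    close enough to a given continuous map are related in this way, and also that
    smooth maps are dense; connectedness of [0, 1] then carries [phi] to [psi]. *)

From HB Require Import structures.
Require Import Defs.
From mathcomp Require Import all_boot all_order all_algebra.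
From mathcomp Require Import all_classical all_reals all_analysis.
From mathcomp Require finmap measurable_realfun.
From mathcomp Require Import ring lra.

Set Implicit Arguments.
Unset Strict Implicit.
Unset Printing Implicit Defensive.

Import Order.TTheory GRing.Theory Num.Theory.
Import numFieldNormedType.Exports.

Local Open Scope classical_set_scope.
Local Open Scope ring_scope.

(** * Calculus of C^k maps *)

(** The intermediate maps of a homotopy are only continuous and pull nothing back, so connectedness
    is applied to the set of times [t] for which every neighbourhood of the graph of [h t] contains
    a smooth map cohomologous to [phi]; this property is locally constant in [t]. [N] carries no
    metric: closeness means an open neighbourhood of the graph in [M * N], and compactness turns it
    into uniform bounds inside charts. Coordinate balls are the right patches because they are
    convex: interpolation stays inside, and the radial Poincare formula applies. Tangent spaces are
    read in a preferred chart that jumps from point to point, so tensors are differentiated only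
    after transport to a fixed chart; naturality of [d] under chart changes makes closedness of
    [omega] usable away from the centre of a preferred chart. Finally, comparing the integrals needs
    integrability, hence a finite volume, which is extracted from the chart formula for [vol] by
    bounding the density on small boxes. *)

Section differentiability.
Context {R : realType}.

Lemma near_eq_differentiable (V W : normedModType R) (f g : V -> W) (x : V) :
  (\forall z \near x, f z = g z) -> differentiable f x -> differentiable g x.
Proof.
move=> fg /diff_locallyP[dfc df].
have E : g \o shift x = cst (g x) + 'd f x +o_ (0 : V) id.
  apply/eqaddoP => e e0; move/eqaddoP : df => /(_ _ e0).
  have fg0 : \forall h \near (0 : V), f (h + x) = g (h + x).
    by move: (fg); rewrite (near_shift 0) subr0.
  apply: filter_app; near=> h.
  rewrite /= !fctE /=.
  by rewrite (nbhs_singleton fg) (near fg0 h).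
have dgE := diff_unique dfc E.
by apply/diff_locallyP; rewrite dgE.
Unshelve. all: by end_near. Qed.

Lemma differentiable_mx (V : normedModType R) p q (f : V -> 'M[R]_(p, q)) (x : V) :
  (forall i j, differentiable (fun z => f z i j) x) -> differentiable f x.
Proof.
move=> df.
have -> : f = \sum_(i < p) \sum_(j < q) (fun z => f z i j *: delta_mx i j).
  apply/funext => z; rewrite fct_sumE [LHS]matrix_sum_delta.
  by apply: eq_bigr => i _; rewrite fct_sumE.
by do 2 apply: differentiable_sum => ?; exact: differentiableZl.
Qed.

Lemma diff_mx (V : normedModType R) p q (f : V -> 'M[R]_(p, q)) (x v : V) i j :
  differentiable f x -> 'D_v f x i j = 'D_v (fun z => f z i j) x.
Proof. by move=> df; rewrite derive_mx ?mxE//; exact: diff_derivable. Qed.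

Lemma differentiable_mxE (V : normedModType R) p q (f : V -> 'M[R]_(p, q)) (x : V) i j :
  differentiable f x -> differentiable (fun z => f z i j) x.
Proof.
move=> df; apply: (@differentiable_comp _ _ _ _ f (fun M => M i j)) => //.
exact: differentiable_coord.
Qed.

End differentiability.

Section partial_derivatives.
Context {R : realType} {m : nat}.
Implicit Types (U : set 'rV[R]_m) (y : 'rV[R]_m).

Lemma partial_near (V : normedModType R) i (f g : 'rV[R]_m -> V) y :
  (\forall z \near y, f z = g z) -> partial i f y = partial i g y.
Proof. exact: near_eq_derive. Qed.

Lemma partial_mx p q i (f : 'rV[R]_m -> 'M[R]_(p, q)) y j k :
  differentiable f y -> partial i f y j k = partial i (fun z => f z j k) y.
Proof. exact: diff_mx. Qed.

Lemma partialD i (f g : 'rV[R]_m -> R) y :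
  differentiable f y -> differentiable g y ->
  partial i (fun z => f z + g z) y = partial i f y + partial i g y.
Proof. by move=> df dg; apply: deriveD; exact: diff_derivable. Qed.

Lemma partialB i (f g : 'rV[R]_m -> R) y :
  differentiable f y -> differentiable g y ->
  partial i (fun z => f z - g z) y = partial i f y - partial i g y.
Proof. by move=> df dg; apply: deriveB; exact: diff_derivable. Qed.

Lemma partialM i (f g : 'rV[R]_m -> R) y :
  differentiable f y -> differentiable g y ->
  partial i (fun z => f z * g z) y = f y * partial i g y + partial i f y * g y.
Proof.
move=> df dg; rewrite /partial deriveM; [|exact: diff_derivable..].
by congr (_ + _); rewrite -[LHS]/(_ * _) mulrC.
Qed.

Lemma partial_cst i (c : R) y : partial i (fun=> c) y = 0.
Proof. exact: derive_cst. Qed.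

Lemma partial_sum n i (f : 'I_n -> 'rV[R]_m -> R) y :
  (forall j, differentiable (f j) y) ->
  partial i (fun z => \sum_j f j z) y = \sum_j partial i (f j) y.
Proof.
move=> df; rewrite /partial -derive_sum; last by move=> j; exact: diff_derivable.
by congr (derive _ _ _); apply/funext => z; rewrite fct_sumE.
Qed.

Lemma partial_coord i j y : partial i (fun z : 'rV[R]_m => z 0 j) y = (i == j)%:R.
Proof.
rewrite /partial -(@diff_mx _ _ _ _ id)//; rewrite derive_id mxE eqxx/=.
by rewrite eq_sym.
Qed.

Lemma diffE_partial (V : normedModType R) (f : 'rV[R]_m -> V) y (v : 'rV[R]_m) :
  differentiable f y -> 'd f y v = \sum_i v 0 i *: partial i f y.
Proof.
move=> df; rewrite {1}(row_sum_delta v) linear_sum/=; apply: (@eq_bigr V) => i _.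
by rewrite linearZ /partial/= deriveE.
Qed.

Lemma differentiable_sumr n (f : 'I_n -> 'rV[R]_m -> R) y :
  (forall j, differentiable (f j) y) -> differentiable (fun z => \sum_j f j z) y.
Proof.
move=> df.
have -> : (fun z => \sum_j f j z) = \sum_j f j.
  by apply/funext => z; rewrite fct_sumE.
exact: differentiable_sum.
Qed.

End partial_derivatives.

Lemma partial_comp {R : realType} {m n : nat} i (f : 'rV[R]_m -> 'rV[R]_n)
    (g : 'rV[R]_n -> R) y :
  differentiable f y -> differentiable g (f y) ->
  partial i (g \o f) y =
  \sum_j partial j g (f y) * partial i (fun z => f z 0 j) y.
Proof.
move=> df dg; rewrite {1}/partial deriveE; last exact: differentiable_comp.
rewrite diff_comp//= (diffE_partial _ dg); apply: eq_bigr => j _.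
by rewrite -deriveE// diff_mx// -[LHS]/(_ * _) mulrC.
Qed.

Section Ck_calculus.
Context {R : realType} {m : nat}.
Implicit Types (U : set 'rV[R]_m) (y : 'rV[R]_m) (k : nat).

(** Openness of [U] upgrades agreement on [U] to agreement near each of its points, which is all
    that derivatives see. *)
Lemma Ck_ext (V : normedModType R) k U (f g : 'rV[R]_m -> V) :
  open U -> (forall y, U y -> f y = g y) -> Ck k U f -> Ck k U g.
Proof.
move=> oU; elim: k f g => [|k IH] f g fg /=.
  move=> cf y Uy; have nfg : \forall z \near y, f z = g z.
    by apply: filterS (open_nbhs_nbhs (conj oU Uy)) => z; exact: fg.
  rewrite /prop_for /continuous_at -fg//; apply: cvg_trans (cf _ Uy).
  exact: (near_eq_cvg nfg).
move=> [df pf].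
have nfg y : U y -> \forall z \near y, f z = g z.
  by move=> Uy; apply: filterS (open_nbhs_nbhs (conj oU Uy)) => z; exact: fg.
split=> [y Uy|i]; first exact: near_eq_differentiable (nfg y Uy) (df y Uy).
by apply: IH (pf i) => y Uy; apply: partial_near; exact: nfg.
Qed.

Lemma Ck_sub (V : normedModType R) k U U' (f : 'rV[R]_m -> V) :
  U' `<=` U -> Ck k U f -> Ck k U' f.
Proof.
move=> U'U; elim: k f => [|k IH] f /=; first by move=> cf y /U'U; exact: cf.
by move=> [df pf]; split=> [y /U'U|i]; [exact: df|exact: IH].
Qed.

(** [Ck k [set y] f] still involves full neighbourhoods of [y], since partial derivatives are those
    of the total function [f]. Smoothness can thus be checked with a different formula for [f] near
    each point. *)
Lemma Ck_pointwise (V : normedModType R) k U (f : 'rV[R]_m -> V) :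
  (forall y, U y -> Ck k [set y] f) -> Ck k U f.
Proof.
elim: k f => [|k IH] f /= h; first by move=> y Uy; exact: (h y Uy y erefl).
split=> [y Uy|i]; first exact: (h y Uy).1 y erefl.
by apply: IH => y Uy; exact: (h y Uy).2 i.
Qed.

Lemma CkW (V : normedModType R) k U (f : 'rV[R]_m -> V) :
  Ck k.+1 U f -> Ck k U f.
Proof.
elim: k f => [|k IH] f /=.
  by move=> [df _] y Uy; exact: differentiable_continuous (df y Uy).
by move=> [df pf]; split=> // i; apply: IH; exact: pf.
Qed.

Lemma Ck_cst (V : normedModType R) k U (c : V) : open U -> Ck k U (fun=> c).
Proof.
move=> oU; elim: k c => [|k IH] c /=; first by move=> y _; exact: cst_continuous.
split=> [y _|i]; first exact: differentiable_cst.
by apply: Ck_ext (IH 0) => // y _; rewrite /partial derive_cst.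
Qed.

Lemma Ck_cstr k U (c : R) : open U -> Ck k U (fun=> c).
Proof. exact: Ck_cst. Qed.

Lemma CkD k U (f g : 'rV[R]_m -> R) : open U ->
  Ck k U f -> Ck k U g -> Ck k U (fun y => f y + g y).
Proof.
move=> oU; elim: k f g => [|k IH] f g /=.
  by move=> cf cg y Uy; exact: cvgD (cf y Uy) (cg y Uy).
move=> [df pf] [dg pg]; split=> [y Uy|i].
  by apply: differentiableD; [exact: df|exact: dg].
apply: Ck_ext (IH _ _ (pf i) (pg i)) => // y Uy.
by rewrite partialD//; [exact: df|exact: dg].
Qed.

Lemma CkM k U (f g : 'rV[R]_m -> R) : open U ->
  Ck k U f -> Ck k U g -> Ck k U (fun y => f y * g y).
Proof.
move=> oU; elim: k f g => [|k IH] f g.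
  by move=> cf cg y Uy; exact: cvgM (cf y Uy) (cg y Uy).
move=> cf cg; have [/= df pf] := cf; have [/= dg pg] := cg; split=> [y Uy|i].
  by apply: differentiableM; [exact: df|exact: dg].
apply: Ck_ext (CkD oU (IH _ _ (CkW cf) (pg i)) (IH _ _ (pf i) (CkW cg))) => // y Uy.
by rewrite partialM//; [exact: df|exact: dg].
Qed.

Lemma CkN k U (f : 'rV[R]_m -> R) : open U ->
  Ck k U f -> Ck k U (fun y => - f y).
Proof.
move=> oU cf; apply: Ck_ext (CkM oU (Ck_cstr k (-1) oU) cf) => // y _.
by rewrite mulN1r.
Qed.

Lemma CkB k U (f g : 'rV[R]_m -> R) : open U ->
  Ck k U f -> Ck k U g -> Ck k U (fun y => f y - g y).
Proof. by move=> oU cf cg; apply: CkD => //; exact: CkN. Qed.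

Lemma Ck_sum k U (I : finType) (P : pred I) (f : I -> 'rV[R]_m -> R) : open U ->
  (forall i, P i -> Ck k U (f i)) -> Ck k U (fun y => \sum_(i | P i) f i y).
Proof.
move=> oU cf.
suff H (s : seq I) : Ck k U (fun y => \sum_(i <- s | P i) f i y) by exact: H.
elim: s => [|i s IH].
  by apply: Ck_ext (Ck_cstr k 0 oU) => // y _; rewrite big_nil.
have [Pi|nPi] := boolP (P i).
  by apply: Ck_ext (CkD oU (cf i Pi) IH) => // y _; rewrite big_cons Pi.
by apply: Ck_ext IH => // y _; rewrite big_cons (negbTE nPi).
Qed.

Lemma Ck_prod k U (I : finType) (f : I -> 'rV[R]_m -> R) : open U ->
  (forall i, Ck k U (f i)) -> Ck k U (fun y => \prod_i f i y).
Proof.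
move=> oU cf.
suff H (s : seq I) : Ck k U (fun y => \prod_(i <- s) f i y) by exact: H.
elim: s => [|i s IH].
  by apply: Ck_ext (Ck_cstr k 1 oU) => // y _; rewrite big_nil.
by apply: Ck_ext (CkM oU (cf i) IH) => // y _; rewrite big_cons.
Qed.

Lemma Ck_inv k U (f : 'rV[R]_m -> R) : open U ->
  (forall y, U y -> f y != 0) -> Ck k U f -> Ck k U (fun y => (f y)^-1).
Proof.
move=> oU f0; elim: k => [|k IH] cf.
  by move=> y Uy; exact: cvgV (f0 y Uy) (cf y Uy).
have [/= df pf] := cf; split=> [y Uy|i].
  by apply: differentiableV; [exact: df|exact: f0].
have ci := IH (CkW cf).
apply: Ck_ext (CkN oU (CkM oU (CkM oU ci ci) (pf i))) => // y Uy.
rewrite /partial deriveV ?f0//; last exact/diff_derivable/df.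
by rewrite -[RHS]/(_ * _) mulNr expr2 invfM.
Qed.

Lemma continuous_mx (T : topologicalType) p q (f : T -> 'M[R]_(p, q)) (x : T) :
  (forall i j, {for x, continuous (fun z => f z i j)}) -> {for x, continuous f}.
Proof.
move=> cf; apply/cvg_ballP => e e0.
suff: \forall y \near x, forall i j, ball (f x i j) e (f y i j).
  by apply: filterS => y h; split.
apply: filter_forall => i; apply: filter_forall => j.
by move/cvg_ballP : (cf i j); exact.
Qed.

Lemma continuous_mxE (T : topologicalType) p q (f : T -> 'M[R]_(p, q)) (x : T) i j :
  {for x, continuous f} -> {for x, continuous (fun z => f z i j)}.
Proof.
move=> cf; apply: (@continuous_comp _ _ _ f (fun M => M i j)) => //.
exact: coord_continuous.
Qed.

Lemma Ck_mx k U p q (f : 'rV[R]_m -> 'M[R]_(p, q)) : open U ->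
  Ck k U f <-> forall i j, Ck k U (fun y => f y i j).
Proof.
move=> oU; elim: k f => [|k IH] f; split=> cf.
- by move=> i j y Uy; apply: continuous_mxE; exact: cf.
- by move=> y Uy; apply: continuous_mx => i j; exact: cf.
- move=> i j; have [df pf] := cf; split=> [y Uy|l].
    by apply: differentiable_mxE; exact: df.
  have /IH/(_ i j) := pf l; apply: Ck_ext => // y Uy.
  by rewrite partial_mx//; exact: df.
- have df y : U y -> differentiable f y.
    by move=> Uy; apply: differentiable_mx => i j; exact: (cf i j).1.
  split=> // l; apply/IH => i j; move: ((cf i j).2 l).
  by apply: Ck_ext => // y Uy; rewrite partial_mx//; exact: df.
Qed.

Lemma Ck_coord k U i j : open U -> Ck k U (fun y : 'rV[R]_m => y i j).
Proof.
move=> oU; case: k => [|k]; first by move=> y _; exact: coord_continuous.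
split=> [y _|l]; first exact: differentiable_coord.
apply: Ck_ext (Ck_cstr k (l == j)%:R oU) => // y _.
by rewrite ord1 partial_coord.
Qed.

End Ck_calculus.

Lemma Ck_comp {R : realType} {m n : nat} k (U : set 'rV[R]_m) (V : set 'rV[R]_n)
    (f : 'rV[R]_m -> 'rV[R]_n) (g : 'rV[R]_n -> R) :
  open U -> (forall y, U y -> V (f y)) -> Ck k U f -> Ck k V g ->
  Ck k U (g \o f).
Proof.
move=> oU fUV; elim: k g => [|k IH] g.
  by move=> cf cg y Uy; apply: continuous_comp; [exact: cf|exact/cg/fUV].
move=> cf cg; have [df pf] := cf; have [dg pg] := cg; split=> [y Uy|i].
  by apply: differentiable_comp; [exact: df|exact/dg/fUV].
have ck : Ck k U (fun y => \sum_j (partial j g \o f) y * partial i (fun z => f z 0 j) y).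
  apply: Ck_sum => // j _; apply: CkM => //; first exact: IH (CkW cf) (pg j).
  by have [_] := (Ck_mx _ _ oU).1 cf 0 j; exact.
apply: Ck_ext ck => // y Uy; rewrite partial_comp//; [exact: df|exact/dg/fUV].
Qed.

Lemma Ck_comp_mx {R : realType} {m n p q : nat} k (U : set 'rV[R]_m)
    (V : set 'rV[R]_n) (f : 'rV[R]_m -> 'rV[R]_n) (g : 'rV[R]_n -> 'M[R]_(p, q)) :
  open U -> open V -> (forall y, U y -> V (f y)) -> Ck k U f -> Ck k V g ->
  Ck k U (g \o f).
Proof.
move=> oU oV fUV cf cg; apply/Ck_mx => // i j.
by apply: (@Ck_comp _ _ _ _ _ V f (fun z => g z i j)) => //; move/(Ck_mx _ _ oV) : cg.
Qed.

Lemma Ck_mulmx {R : realType} {m p q r : nat} k (U : set 'rV[R]_m)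
    (f : 'rV[R]_m -> 'M[R]_(p, q)) (g : 'rV[R]_m -> 'M[R]_(q, r)) :
  open U -> Ck k U f -> Ck k U g -> Ck k U (fun y => f y *m g y).
Proof.
move=> oU /(Ck_mx _ _ oU) cf /(Ck_mx _ _ oU) cg; apply/Ck_mx => // i j.
apply: (@Ck_ext _ _ _ _ _ (fun y => \sum_l f y i l * g y l j)) => // [y _|].
  by rewrite mxE.
by apply: Ck_sum => // l _; exact: CkM.
Qed.

Lemma Ck_trmx {R : realType} {m p q : nat} k (U : set 'rV[R]_m)
    (f : 'rV[R]_m -> 'M[R]_(p, q)) :
  open U -> Ck k U f -> Ck k U (fun y => (f y)^T).
Proof.
move=> oU /(Ck_mx _ _ oU) cf; apply/Ck_mx => // i j.
by apply: Ck_ext (cf j i) => // y _; rewrite mxE.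
Qed.

(** * Mean values and symmetry of second derivatives *)

Section mean_value.
Context {R : realType} {m : nat}.
Implicit Types (U : set 'rV[R]_m) (y v : 'rV[R]_m).

Lemma is_derive_line (f : 'rV[R]_m -> R) y v (t : R) :
  differentiable f (y + t *: v) ->
  is_derive t 1 (fun s : R => f (y + s *: v)) ('D_v f (y + t *: v)).
Proof.
move=> df; have E : (fun h : R => h^-1 *: (((fun s : R => f (y + s *: v)) \o shift t)
      (h *: (1 : R)) - f (y + t *: v))) =
    (fun h : R => h^-1 *: ((f \o shift (y + t *: v)) (h *: v) - f (y + t *: v))).
  apply/funext => h /=; congr (_ *: (f _ - _)).
  by rewrite -[h *: 1]/(h * 1) mulr1 scalerDl addrCA.
by apply: DeriveDef; rewrite /derivable /derive E//; exact: diff_derivable.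
Qed.

Lemma mean_value_segment (f : 'rV[R]_m -> R) y v :
  (forall t : R, 0 <= t <= 1 -> differentiable f (y + t *: v)) ->
  exists2 c : R, 0 <= c <= 1 & f (y + v) - f y = 'D_v f (y + c *: v).
Proof.
move=> df.
have dg (t : R) : 0 <= t <= 1 -> is_derive t 1 (fun s : R => f (y + s *: v)) ('D_v f (y + t *: v)).
  by move=> /df; exact: is_derive_line.
have [||c c01 E] := @MVT_segment R (fun s : R => f (y + s *: v))
    (fun s => 'D_v f (y + s *: v)) 0 1 ler01.
- by move=> t; rewrite in_itv/= => /andP[t0 t1]; apply: dg; rewrite !ltW.
- apply: continuous_in_subspaceT => t; rewrite inE/= in_itv/= => t01.
  by apply/differentiable_continuous/derivable1_diffP; case: (dg t t01).
exists c; first by move: c01; rewrite in_itv.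
by move: E; rewrite scale1r scale0r addr0 subr0 mulr1.
Qed.

Lemma norm_delta_row (i : 'I_m) : `|delta_mx 0 i : 'rV[R]_m| <= 1.
Proof.
rewrite /Num.Def.normr/= mx_normrE; apply: bigmax_le => // -[a b] _ /=.
by rewrite mxE; case: (_ && _); rewrite ?normr1 ?normr0.
Qed.

Lemma partial_shift (V : normedModType R) i (f : 'rV[R]_m -> V) y v :
  partial i (fun z => f (z + v)) y = partial i f (y + v).
Proof.
have E : (fun h : R => h^-1 *: (((fun z => f (z + v)) \o shift y) (h *: delta_mx 0 i)
      - f (y + v))) =
    (fun h : R => h^-1 *: ((f \o shift (y + v)) (h *: delta_mx 0 i) - f (y + v))).
  by apply/funext => h /=; rewrite addrA.
by rewrite /partial /derive E.
Qed.

Lemma differentiable_shift (V : normedModType R) (f : 'rV[R]_m -> V) y v :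
  differentiable f (y + v) -> differentiable (fun z => f (z + v)) y.
Proof.
by move=> df; apply: (@differentiable_comp _ _ _ _ (fun z => z + v) f).
Qed.

(** Two mean values: along [delta_mx 0 i] for the increment of [f] in direction [j], then along
    [delta_mx 0 j] for [partial i f]; each contributes a factor [h]. *)
Lemma second_difference i j (f : 'rV[R]_m -> R) U y (h : R) :
  0 < h -> Ck 2 U f ->
  (forall a b : R, 0 <= a <= h -> 0 <= b <= h ->
     U (y + a *: delta_mx 0 i + b *: delta_mx 0 j)) ->
  exists a b : R, [/\ 0 <= a <= h, 0 <= b <= h &
    f (y + h *: delta_mx 0 i + h *: delta_mx 0 j) - f (y + h *: delta_mx 0 i)
    - (f (y + h *: delta_mx 0 j) - f y)
    = h ^+ 2 * partial j (partial i f) (y + a *: delta_mx 0 i + b *: delta_mx 0 j)].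
Proof.
move=> h0 [df pf] Uy; set ei := delta_mx 0 i; set ej := delta_mx 0 j.
have DZ (V : normedModType R) (g : 'rV[R]_m -> V) z (v : 'rV[R]_m) : differentiable g z ->
    'D_(h *: v) g z = h *: 'D_v g z.
  by move=> dg; rewrite !deriveE// linearZ.
have rg (t : R) : 0 <= t <= 1 -> 0 <= t * h <= h.
  move=> /andP[t0 t1]; rewrite mulr_ge0 ?(ltW h0)//=.
  by rewrite -[leRHS]mul1r ler_wpM2r// ltW.
pose phi z := f (z + h *: ej) - f z.
have dphi (t : R) : 0 <= t <= 1 -> differentiable phi (y + t *: (h *: ei)).
  move=> t01; apply: differentiableB.
    apply: differentiable_shift; apply: df; rewrite scalerA; apply: Uy; first exact: rg.
    by rewrite lexx ltW.
  apply: df; rewrite scalerA -[X in U X]addr0 -(scale0r ej); apply: Uy; first exact: rg.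
  by rewrite lexx ltW.
have [c c01 E1] := mean_value_segment dphi.
have dp (t : R) : 0 <= t <= 1 -> differentiable (partial i f) (y + c *: (h *: ei) + t *: (h *: ej)).
  move=> t01; have [+ _] := pf i; apply; rewrite !scalerA; apply: Uy; exact: rg.
have [d d01 E2] := mean_value_segment dp.
exists (c * h), (d * h); split; [exact: rg|exact: rg|].
transitivity (phi (y + h *: ei) - phi y); first by rewrite /phi.
have dU (b : R) : 0 <= b <= h -> differentiable f (y + c *: (h *: ei) + b *: ej).
  by move=> b0; apply: df; rewrite scalerA; apply: Uy => //; exact: rg.
have h00 : 0 <= (0 : R) <= h by rewrite lexx ltW.
have hh0 : 0 <= h <= h by rewrite lexx ltW.
rewrite E1 DZ; last exact: dphi.
have -> : 'D_ei phi (y + c *: (h *: ei)) =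
    partial i f (y + c *: (h *: ei) + h *: ej) - partial i f (y + c *: (h *: ei)).
  have d0 : differentiable f (y + c *: (h *: ei)).
    by have := dU 0 h00; rewrite scale0r addr0.
  rewrite -(partial_shift i f) -[LHS]/(partial i phi _) -partialB//.
  by apply: differentiable_shift; exact: dU.
rewrite E2 DZ; last exact: dp.
rewrite (scalerA c h ei) (scalerA d h ej) -/(partial j (partial i f) _).
by move: (partial j _ _) => D; rewrite -[LHS]/(h * (h * D)) mulrA expr2.
Qed.

(** The double difference over a small square is symmetric in [i] and [j], so [second_difference] in
    both orders gives equal mixed derivatives at two nearby points; continuity brings both points to
    [y]. *)
Lemma schwarz i j U (f : 'rV[R]_m -> R) y : open U -> Ck 2 U f -> U y ->
  partial i (partial j f) y = partial j (partial i f) y.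
Proof.
move=> oU cf Uy; have [df pf] := cf.
apply/eqP; rewrite -subr_eq0 -normr_le0; apply/ler_addgt0Pl => e e0; rewrite addr0.
have ck (k l : 'I_m) : {for y, continuous (partial k (partial l f))}.
  have [_ pl] := pf l; exact: pl.
have nij : \forall z \near y, [/\ U z,
    `|partial i (partial j f) y - partial i (partial j f) z| < e / 2 &
    `|partial j (partial i f) y - partial j (partial i f) z| < e / 2].
  have e20 : 0 < e / 2 by rewrite divr_gt0.
  have n1 := open_nbhs_nbhs (conj oU Uy).
  have n2 (k l : 'I_m) : \forall z \near y,
      `|partial k (partial l f) y - partial k (partial l f) z| < e / 2.
    by move/cvgrPdist_lt : (ck k l) => /(_ _ e20).
  apply: filterS3 n1 (n2 i j) (n2 j i); move=> z; split => //.
have /nbhs_ballP[r /= r0 Br] := nij.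
(* Points of the square are at distance at most [2 * h] from [y], which is less than [r]. *)
pose h := r / 3; have h0 : 0 < h by rewrite divr_gt0.
have Bh k l (a b : R) : 0 <= a <= h -> 0 <= b <= h ->
    ball y r (y + a *: delta_mx 0 k + b *: delta_mx 0 l).
  move=> /andP[a0 ah] /andP[b0 bh]; rewrite -ball_normE/= -addrA opprD addNKr normrN.
  rewrite (le_lt_trans (ler_normD _ _))// !normrZ !ger0_norm//.
  have ka := ler_wpM2l a0 (norm_delta_row k); have lb := ler_wpM2l b0 (norm_delta_row l).
  have := lerD ka lb; rewrite !mulr1 => /le_lt_trans; apply.
  have r3 : r = h * 3 by rewrite /h divfK.
  by rewrite r3; lra.
have Uh k l (a b : R) : 0 <= a <= h -> 0 <= b <= h ->
    U (y + a *: delta_mx 0 k + b *: delta_mx 0 l).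
  by move=> ha hb; have [] := Br _ (Bh k l a b ha hb).
have [a [b [ha hb E1]]] := second_difference h0 cf (Uh i j).
have [a' [b' [ha' hb' E2]]] := second_difference h0 cf (Uh j i).
have E : h ^+ 2 * partial j (partial i f) (y + a *: delta_mx 0 i + b *: delta_mx 0 j) =
    h ^+ 2 * partial i (partial j f) (y + a' *: delta_mx 0 j + b' *: delta_mx 0 i).
  apply: eq_trans (esym E1) (eq_trans _ E2); rewrite (addrAC y (h *: delta_mx 0 j)).
  move: (f (y + _ + _)) (f (y + h *: delta_mx 0 i)) (f (y + h *: delta_mx 0 j)) (f y).
  by move=> F1 F2 F3 F4; rewrite !opprB addrACA [RHS]addrACA [- F2 + _]addrC.
have {E} : partial j (partial i f) (y + a *: delta_mx 0 i + b *: delta_mx 0 j) =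
    partial i (partial j f) (y + a' *: delta_mx 0 j + b' *: delta_mx 0 i).
  by move: E; apply: mulfI; rewrite expf_neq0// gt_eqF.
have [_ _ n1] := Br _ (Bh i j a b ha hb).
have [_ n2 _] := Br _ (Bh j i a' b' ha' hb').
move: n1 n2; set A := partial j _ _; set B := partial i _ _.
set C := partial j _ _; set D := partial i _ _ => n1 n2 CD.
move: n1 n2; rewrite CD; move: A B C D {CD} => A B C D.
move=> /ltr_normlP[n1 n1'] /ltr_normlP[n2 n2'].
by clear -n1 n1' n2 n2'; apply/ler_normlP; split; lra.
Qed.

End mean_value.

(** * Radial integrals *)

Lemma cvg_sum_ord {R : realType} {T : Type} (F : set_system T) {FF : Filter F} n
    (f : 'I_n -> T -> R) (a : 'I_n -> R) :
  (forall i, f i x @[x --> F] --> a i) -> \sum_i f i x @[x --> F] --> \sum_i a i.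
Proof.
elim: n f a => [|n IH] f a fa.
  rewrite big_ord0; have -> : (fun x => \sum_(i < 0) f i x) = (fun=> 0).
    by apply/funext => x; rewrite big_ord0.
  exact: cvg_cst.
rewrite big_ord_recl.
have -> : (fun x => \sum_(i < n.+1) f i x) =
    (fun x => f ord0 x + \sum_(i < n) f (lift ord0 i) x).
  by apply/funext => x; rewrite big_ord_recl.
by apply: cvgD => //; exact: IH.
Qed.

Section unit_interval_integral.
Context {R : realType}.
Implicit Types f g : R -> R.

Definition cont01 f := forall t : R, 0 <= t <= 1 -> {for t, continuous f}.

Definition int01 f : R := \int[@lebesgue_measure R]_(t in `[0, 1]) f t.

Lemma cont01_within f : cont01 f -> {within `[0, 1], continuous f}.
Proof.
move=> cf; apply: continuous_in_subspaceT => t; rewrite inE/= in_itv/=.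
exact: cf.
Qed.

Lemma int01_integrable f : cont01 f ->
  (@lebesgue_measure R).-integrable `[0, 1] (EFin \o f).
Proof.
move=> cf; apply: continuous_compact_integrable; first exact: segment_compact.
exact: cont01_within.
Qed.

Lemma eq_int01 f g : (forall t : R, 0 <= t <= 1 -> f t = g t) -> int01 f = int01 g.
Proof.
by move=> fg; apply: eq_Rintegral => t; rewrite inE/= in_itv/=; exact: fg.
Qed.

Lemma int01D f g : cont01 f -> cont01 g ->
  int01 (fun t => f t + g t) = int01 f + int01 g.
Proof. by move=> cf cg; apply: RintegralD => //; exact: int01_integrable. Qed.

Lemma int01B f g : cont01 f -> cont01 g ->
  int01 (fun t => f t - g t) = int01 f - int01 g.
Proof. by move=> cf cg; apply: RintegralB => //; exact: int01_integrable. Qed.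

Lemma int01Z (a : R) f : cont01 f -> int01 (fun t => a * f t) = a * int01 f.
Proof. by move=> cf; apply: RintegralZl => //; exact: int01_integrable. Qed.

Lemma cont01_cst (a : R) : cont01 (fun=> a).
Proof. by move=> t _; exact: cst_continuous. Qed.

Lemma cont01D f g : cont01 f -> cont01 g -> cont01 (fun t => f t + g t).
Proof. by move=> cf cg t t01; exact: cvgD (cf t t01) (cg t t01). Qed.

Lemma cont01M f g : cont01 f -> cont01 g -> cont01 (fun t => f t * g t).
Proof. by move=> cf cg t t01; exact: cvgM (cf t t01) (cg t t01). Qed.

Lemma cont01B f g : cont01 f -> cont01 g -> cont01 (fun t => f t - g t).
Proof. by move=> cf cg t t01; exact: cvgB (cf t t01) (cg t t01). Qed.

Lemma cont01_sum n (f : 'I_n -> R -> R) :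
  (forall i, cont01 (f i)) -> cont01 (fun t => \sum_i f i t).
Proof.
by move=> cf t t01; apply: cvg_sum_ord => i; exact: cf.
Qed.

Lemma int01_sum n (f : 'I_n -> R -> R) : (forall i, cont01 (f i)) ->
  int01 (fun t => \sum_i f i t) = \sum_i int01 (f i).
Proof.
elim: n f => [|n IH] f cf.
  rewrite big_ord0 -[RHS](mul0r (int01 (fun=> 0))) -int01Z; last exact: cont01_cst.
  by apply: eq_int01 => t _; rewrite big_ord0 mul0r.
rewrite big_ord_recl -IH// -int01D//; last exact: cont01_sum.
by apply: eq_int01 => t _; rewrite big_ord_recl.
Qed.

Lemma int01_cst (a : R) : int01 (fun=> a) = a.
Proof.
transitivity (a * fine (@lebesgue_measure R `[0, 1]%classic)).
  exact: Rintegral_cst.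
by rewrite lebesgue_measure_itv/= lte_fin ltr01 sube0 mulr1.
Qed.

Lemma norm_int01_le f (C : R) : cont01 f ->
  (forall t : R, 0 <= t <= 1 -> `|f t| <= C) -> `|int01 f| <= C.
Proof.
move=> cf fC; have ncf : cont01 (fun t => `|f t|).
  by move=> t t01; exact: cvg_norm (cf t t01).
rewrite -[leRHS]int01_cst; apply: le_trans (le_normr_Rintegral _ _) _ => //.
  exact: int01_integrable.
by apply: le_Rintegral => //; apply: int01_integrable => //; exact: cont01_cst.
Qed.

Lemma int01_FTC (F f : R -> R) : cont01 f ->
  (forall t : R, 0 <= t <= 1 -> is_derive t 1 F (f t)) -> int01 f = F 1 - F 0.
Proof.
move=> cf dF; have cF (t : R) : 0 <= t <= 1 -> {for t, continuous F}.
  by move=> /dF [d _]; exact/differentiable_continuous/derivable1_diffP.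
rewrite /int01 /Rintegral (@continuous_FTC2 _ f F)//.
- exact: cont01_within.
- split.
  + by move=> t; rewrite in_itv/= => /andP[t0 t1]; have [|//] := dF t; rewrite !ltW.
  + by apply: cvg_at_right_filter; apply: cF; rewrite lexx ler01.
  + by apply: cvg_at_left_filter; apply: cF; rewrite lexx ler01.
- move=> t; rewrite in_itv/= => /andP[t0 t1]; rewrite derive1E.
  by apply: (@derive_val _ _ _ _ _ _ _ (dF t _)); rewrite !ltW.
Qed.

End unit_interval_integral.

Lemma nbhs_sub (T : topologicalType) (x : T) (P Q : set T) :
  (forall z, P z -> Q z) -> nbhs x P -> nbhs x Q.
Proof. exact: filterS. Qed.

Lemma nbhs_forall (T : topologicalType) (x : T) (I : finType) (P : I -> set T) :
  (forall i, nbhs x (P i)) -> nbhs x (fun z => forall i, P i z).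
Proof. by move=> h; apply: filter_forall. Qed.

Lemma near0_shift {R : realType} (V : normedModType R) (x : V) (P : set V) :
  (\forall h \near 0, P (x + h)) -> \forall z \near x, P z.
Proof.
by rewrite [in X in _ -> X](near_shift 0) subr0; apply: filterS => h /=; rewrite addrC.
Qed.

Section linear_estimate.
Context {R : realType} {m : nat}.

Definition row_form (c : 'I_m -> R) (h : 'rV[R]_m) : R := \sum_i h 0 i * c i.

Fact row_form_is_linear c : linear (row_form c).
Proof.
move=> a h k; rewrite /row_form scaler_sumr -big_split/=; apply: eq_bigr => i _.
by rewrite !mxE mulrDl -[a *: (_ : R)]/(a * _) mulrA.
Qed.

HB.instance Definition _ c :=
  GRing.isLinear.Build R 'rV[R]_m R *:%R (row_form c) (row_form_is_linear c).

Lemma row_form_continuous c : continuous (row_form c).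
Proof.
move=> h; apply: (@cvg_sum_ord _ _ (nbhs (h : 'rV[R]_m)) (nbhs_filter _)) => i.
by apply: cvgM; [exact: coord_continuous|exact: cvg_cst].
Qed.

Lemma row_form_delta c i : row_form c (delta_mx 0 i) = c i.
Proof.
rewrite /row_form (bigD1 i)//= mxE !eqxx mul1r big1 ?addr0// => j ji.
by rewrite mxE eqxx (negbTE ji) mul0r.
Qed.

(** An explicit linear candidate satisfying the o(h) estimate must be the differential, so
    differentiability and the partial derivatives come out together. *)
Lemma differentiable_row_form (F : 'rV[R]_m -> R) (x : 'rV[R]_m) (c : 'I_m -> R) :
  (forall e, 0 < e -> \forall h \near (0 : 'rV[R]_m),
    `|F (x + h) - F x - row_form c h| <= e * `|h|) ->
  differentiable F x /\ forall i, partial i F x = c i.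
Proof.
move=> est.
have E : F \o shift x = cst (F x) + row_form c +o_ (0 : 'rV[R]_m) id.
  apply/eqaddoP => e e0; have := est e e0; apply: filterS => h.
  by rewrite /= !fctE /= opprD addrA (addrC h).
have dE := diff_unique (@row_form_continuous c) E.
have dF : differentiable F x.
  by apply/diff_locallyP; rewrite dE; split=> //; exact: row_form_continuous.
by split=> // i; rewrite /partial deriveE// dE; exact: row_form_delta.
Qed.

End linear_estimate.

Section radial_integral.
Context {R : realType} {m : nat}.
Variable r : R.
Local Notation B := (ball (0 : 'rV[R]_m) r).
Implicit Types (u : 'rV[R]_m -> R) (x : 'rV[R]_m).

Lemma ball0Z x (t : R) : 0 <= t <= 1 -> B x -> B (t *: x).
Proof.
move=> /andP[t0 t1]; rewrite -ball_normE/= !sub0r !normrN normrZ ger0_norm//.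
by apply: le_lt_trans; rewrite -[leRHS]mul1r ler_wpM2r.
Qed.

(** The exponent makes the family stable under differentiation: the chain rule for [u (t *: x)]
    yields a factor [t], so [partial i] turns [j] into [j.+1]. *)
Definition radial_int (j : nat) u x : R := int01 (fun t => t ^+ j * u (t *: x)).

Lemma cont01_radial j u x : Ck 0 B u -> B x -> cont01 (fun t => t ^+ j * u (t *: x)).
Proof.
move=> cu Bx t t01; apply: cvgM; first exact: exprn_continuous.
apply: (@continuous_comp _ _ _ (fun t : R => t *: x) u); first exact: scalel_continuous.
by apply: cu; exact: ball0Z.
Qed.

(** Compactness of the unit interval makes the neighbourhood of 0 in which [h] lives independent of
    [t]. *)
Lemma radial_uniform u x (e : R) : Ck 0 B u -> B x -> 0 < e ->
  \forall h \near (0 : 'rV[R]_m), forall t : R, 0 <= t <= 1 ->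
    `|u (t *: (x + h)) - u (t *: x)| < e.
Proof.
move=> cu Bx e0.
have /compact_near_coveringP/(_ _ (nbhs (0 : 'rV[R]_m))
  (fun h t => `|u (t *: (x + h)) - u (t *: x)| < e)) := @segment_compact R 0 1.
case=> [t0|d d0 dP].
  rewrite /= in_itv/= => t01.
  have e20 : 0 < e / 2 by rewrite divr_gt0.
  have cut := cu _ (ball0Z t01 Bx).
  have c1 : {for (t0, 0 : 'rV[R]_m), continuous (fun p : R * 'rV[R]_m => u (p.1 *: (x + p.2)))}.
    apply: (@continuous_comp _ _ _ (fun p : R * 'rV[R]_m => p.1 *: (x + p.2)) u).
      apply: cvgZ; first exact: cvg_fst.
      by apply: cvgD; [exact: cvg_cst|exact: cvg_snd].
    by rewrite /= addr0; exact: cut.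
  have c2 : {for (t0, 0 : 'rV[R]_m), continuous (fun p : R * 'rV[R]_m => u (p.1 *: x))}.
    apply: (@continuous_comp _ _ _ (fun p : R * 'rV[R]_m => p.1 *: x) u).
      by apply: cvgZ; [exact: cvg_fst|exact: cvg_cst].
    exact: cut.
  have n1 : \forall p \near (t0, 0 : 'rV[R]_m),
      `|u (t0 *: (x + 0)) - u (p.1 *: (x + p.2))| < e / 2.
    by move/cvgrPdist_lt : c1 => /(_ _ e20).
  have n2 : \forall p \near (t0, 0 : 'rV[R]_m), `|u (t0 *: x) - u (p.1 *: x)| < e / 2.
    by move/cvgrPdist_lt : c2 => /(_ _ e20).
  have [[P Q] [/= nP nQ] PQ] := filterI n1 n2.
  exists (P, Q) => //= -[t h] /= [Pt Qh]; have [/= n3 n4] := PQ (t, h) (conj Pt Qh).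
  move: n3; rewrite addr0 => n3; rewrite (splitr e) -(subrKA (u (t0 *: x))).
  by rewrite (le_lt_trans (ler_normD _ _))// ltrD// distrC.
by exists d => // h dh t t01; apply: (dP h dh t); rewrite /= in_itv.
Qed.

Lemma ball_near x : B x -> \forall h \near (0 : 'rV[R]_m), B (x + h).
Proof.
move=> Bx; have : \forall z \near x, B z.
  apply: open_nbhs_nbhs; split; last exact: Bx.
  exact: ball_open.
by rewrite (near_shift 0) subr0; apply: filterS => h /=; rewrite addrC.
Qed.

Lemma radial_int_continuous j u : Ck 0 B u -> Ck 0 B (radial_int j u).
Proof.
move=> cu x Bx; apply/(@cvgrPdist_le _ _ _ (nbhs x) (nbhs_filter x)) => e e0.
apply: (@near0_shift R 'rV[R]_m x _).
apply: nbhs_sub (filterI (ball_near Bx) (radial_uniform cu Bx e0)) => h /= [Bxh hu].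
rewrite distrC -int01B; [|exact: cont01_radial..].
apply: norm_int01_le => [|t t01]; first by apply: cont01B; exact: cont01_radial.
rewrite -mulrBr normrM; have /andP[t0 t1] := t01.
rewrite -[leRHS]mul1r ler_pM//; last exact/ltW/hu.
by rewrite normrX exprn_ile1// ger0_norm.
Qed.

(** Differentiation under the integral sign. For each [t], the mean value theorem between [t *: x]
    and [t *: (x + h)] leaves differences of partial derivatives, which [radial_uniform] bounds for
    all [t] at once. *)
Lemma radial_int_diff j u x : Ck 1 B u -> B x ->
  differentiable (radial_int j u) x /\
  forall i, partial i (radial_int j u) x = radial_int j.+1 (partial i u) x.
Proof.
move=> cu Bx; have [du pu] := cu; have c0u := CkW cu.
apply: differentiable_row_form => e e0.
(* The error is a sum of [m] terms; [m.+1] keeps the divisor nonzero when [m = 0]. *)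
pose e' := e / m.+1%:R.
have e'0 : 0 < e' by rewrite divr_gt0.
have : \forall h \near (0 : 'rV[R]_m), forall i (t : R), 0 <= t <= 1 ->
    `|partial i u (t *: (x + h)) - partial i u (t *: x)| < e'.
  by apply: nbhs_forall => i; apply: radial_uniform => //; exact: pu.
move=> /(filterI (ball_near Bx)) /nbhs_ballP[d /= d0 Bd].
apply/nbhs_ballP; exists d => //= h Bh.
have dh (c : R) : 0 <= c <= 1 -> ball 0 d (c *: h).
  move=> /andP[c0 c1]; move: Bh; rewrite -ball_normE/= !sub0r !normrN normrZ ger0_norm//.
  by apply: le_lt_trans; rewrite -[leRHS]mul1r ler_wpM2r.
have [Bxh _] := Bd _ Bh.
have crad k v : Ck 0 B v -> cont01 (fun t => t ^+ k * v (t *: x)).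
  by move=> cv; exact: cont01_radial.
have cs i : cont01 (fun t => h 0 i * (t ^+ j.+1 * partial i u (t *: x))).
  by apply: cont01M; [exact: cont01_cst|apply: crad; exact: pu].
have -> : row_form (fun i => radial_int j.+1 (partial i u) x) h =
    int01 (fun t => \sum_i h 0 i * (t ^+ j.+1 * partial i u (t *: x))).
  rewrite int01_sum//; apply: eq_bigr => i _.
  by rewrite int01Z//; apply: crad; exact: pu.
rewrite -int01B; [|exact: cont01_radial..].
have cB : cont01 (fun t => t ^+ j * u (t *: (x + h)) - t ^+ j * u (t *: x)).
  by apply: cont01B; exact: cont01_radial.
rewrite -int01B//; last exact: cont01_sum.
apply: norm_int01_le => [|t t01]; first by apply: cont01B => //; exact: cont01_sum.
have [c c01 E] : exists2 c : R, 0 <= c <= 1 & u (t *: x + t *: h) - u (t *: x) =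
    'D_(t *: h) u (t *: x + c *: (t *: h)).
  apply: mean_value_segment => s s01; apply: du.
  rewrite scalerA mulrC -scalerA -scalerDr; apply: ball0Z => //.
  by have [] := Bd _ (dh s s01).
have Bc : B (t *: (x + c *: h)) by apply: ball0Z => //; have [] := Bd _ (dh c c01).
have E' : t *: x + c *: (t *: h) = t *: (x + c *: h).
  by rewrite scalerDr !scalerA mulrC.
have -> : t ^+ j * u (t *: (x + h)) - t ^+ j * u (t *: x)
    - \sum_i h 0 i * (t ^+ j.+1 * partial i u (t *: x)) =
    \sum_i t ^+ j.+1 * h 0 i * (partial i u (t *: (x + c *: h)) - partial i u (t *: x)).
  rewrite -mulrBr scalerDr E E' deriveE; last exact: du.
  rewrite diffE_partial; last exact: du.
  rewrite mulr_sumr -sumrB; apply: eq_bigr => i _; rewrite mxE.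
  rewrite -[_ *: _]/(_ * _) exprSr; ring.
apply: le_trans (ler_norm_sum _ _ _) _.
have /andP[t0 t1] := t01.
have : forall i : 'I_m, true ->
  `|t ^+ j.+1 * h 0 i * (partial i u (t *: (x + c *: h)) - partial i u (t *: x))| <= `|h| * e'.
  move=> i _; rewrite !normrM ler_pM//.
    rewrite -[leRHS]mul1r ler_pM//.
      by rewrite normrX exprn_ile1// ger0_norm.
    rewrite [leRHS]/Num.Def.normr/= mx_normrE.
    exact: (le_bigmax _ (fun ij => `|h ij.1 ij.2|) (0, i)).
  by have [_ /(_ i t t01)/ltW] := Bd _ (dh c c01).
move=> /ler_sum /le_trans; apply.
rewrite sumr_const card_ord -mulr_natr -mulrA [leLHS]mulrC ler_wpM2r//.
by rewrite /e' mulrAC ler_pdivrMr// ler_wpM2l ?(ltW e0)// ler_nat.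
Qed.

Lemma radial_int_Ck k j u : Ck k B u -> Ck k B (radial_int j u).
Proof.
elim: k j u => [|k IH] j u; first exact: radial_int_continuous.
move=> cu; have [du pu] := cu.
have cu1 : Ck 1 B u.
  by split=> // i; elim: k {IH cu} pu => [|k IHk] pu; [exact: pu|apply: IHk => l; exact/CkW/pu].
split=> [x Bx|i]; first exact: (radial_int_diff j cu1 Bx).1.
apply: Ck_ext (IH j.+1 _ (pu i)) => [|x Bx]; first exact: ball_open.
by rewrite (radial_int_diff j cu1 Bx).2.
Qed.

End radial_integral.

(** * The Poincare lemma for 2-forms on a ball *)

Lemma Ck_shift {R : realType} {m : nat} (W : normedModType R) k (U V : set 'rV[R]_m)
    (f : 'rV[R]_m -> W) (v : 'rV[R]_m) :
  (forall z, U z -> V (z + v)) -> Ck k V f -> Ck k U (fun z => f (z + v)).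
Proof.
move=> UV; elim: k f => [|k IH] f.
  move=> cf z Uz; apply: (@continuous_comp _ _ _ (fun z : 'rV[R]_m => z + v) f).
    exact: (@cvgD _ _ _ (nbhs z) (nbhs_filter z) _ _ _ _ cvg_id (cvg_cst v)).
  exact/cf/UV.
move=> [df pf]; split=> [z Uz|i]; first exact/differentiable_shift/df/UV.
have -> : partial i (fun z => f (z + v)) = (fun z => partial i f (z + v)).
  by apply/funext => z; rewrite partial_shift.
exact: IH (pf i).
Qed.

Section poincare.
Context {R : realType} {m : nat}.

Lemma smooth_on_mx p q (U : set 'rV[R]_m) (f : 'rV[R]_m -> 'M[R]_(p, q)) i j :
  open U -> smooth_on U f -> smooth_on U (fun y => f y i j).
Proof. by move=> oU sf k; move/(Ck_mx _ _ oU) : (sf k). Qed.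

Lemma smooth_on_diff (V : normedModType R) (U : set 'rV[R]_m) (f : 'rV[R]_m -> V) y :
  smooth_on U f -> U y -> differentiable f y.
Proof. by move=> sf Uy; exact: (sf 1).1. Qed.

Lemma smooth_on_partial (V : normedModType R) (U : set 'rV[R]_m) (f : 'rV[R]_m -> V) i :
  smooth_on U f -> smooth_on U (partial i f).
Proof. by move=> sf k; exact: (sf k.+1).2. Qed.

Variable r : R.
Local Notation B := (ball (0 : 'rV[R]_m) r).

(** Fundamental theorem of calculus for [t ^+ 2 * u (t *: x)] between 0 and 1; the two sorts of
    terms come from the product rule. *)
Lemma radial_FTC (u : 'rV[R]_m -> R) x : smooth_on B u -> B x ->
  u x = radial_int 1 u x + radial_int 1 u x
        + \sum_i x 0 i * radial_int 2 (partial i u) x.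
Proof.
move=> su Bx.
have c1 : cont01 (fun t => t ^+ 1 * u (t *: x)) by exact: cont01_radial (su 0) Bx.
have c2 i : cont01 (fun t => t ^+ 2 * partial i u (t *: x)).
  exact: cont01_radial (smooth_on_partial i su 0) Bx.
have c3 i : cont01 (fun t => x 0 i * (t ^+ 2 * partial i u (t *: x))).
  by apply: cont01M => //; exact: cont01_cst.
have c4 : cont01 (fun t => \sum_i x 0 i * (t ^+ 2 * partial i u (t *: x))).
  exact: cont01_sum.
have c5 := cont01D c1 c1.
have -> : \sum_i x 0 i * radial_int 2 (partial i u) x =
    int01 (fun t => \sum_i x 0 i * (t ^+ 2 * partial i u (t *: x))).
  by rewrite int01_sum//; apply: eq_bigr => i _; rewrite int01Z.
rewrite /radial_int -!int01D//.
(* The summand [0] gives the line the shape [y + t *: v] of [is_derive_line]. *)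
pose F (t : R) := t ^+ 2 * u (0 + t *: x).
have -> : u x = F 1 - F 0.
  by rewrite /F expr1n expr0n/= mul1r mul0r subr0 add0r scale1r.
apply/esym/int01_FTC; first exact: cont01D.
move=> t t01; have du : differentiable u (0 + t *: x).
  by rewrite add0r; apply: smooth_on_diff su _; exact: ball0Z.
have d1 := is_derive_line du.
have d2 : is_derive t 1 (fun t : R => t ^+ 2) (2 * t).
  apply: is_derive_eq (is_deriveM (is_derive_id t 1) (is_derive_id t 1)) _.
  by rewrite -[LHS]/(t * 1 + t * 1) mulr1; ring.
apply: is_derive_eq (is_deriveM d2 d1) _.
rewrite -[LHS]/(t ^+ 2 * _ + u (0 + t *: x) * (2 * t)) add0r in du *.
rewrite deriveE// diffE_partial// mulr_sumr addrC.
congr (_ + _); first by rewrite expr1; ring.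
by apply: eq_bigr => i _; rewrite -[_ *: _]/(_ * _) mulrCA.
Qed.

(** The homotopy operator of the Poincare lemma in degree two: [w] is contracted with the radial
    field and averaged over dilations, the weight [t] coming from the remaining covector slot. *)
Definition radial_primitive (w : 'rV[R]_m -> 'M[R]_m) (x : 'rV[R]_m) : 'cV[R]_m :=
  \col_k \sum_i x 0 i * radial_int 1 (fun z => w z i k) x.

(** Antisymmetrizing the derivative of the primitive gives twice [radial_int 1] of [w_jk] plus
    integrals of [d_j w_ak - d_k w_aj]; closedness turns the latter into [d_a w_jk], and
    [radial_FTC] sums everything up to [w_jk]. *)
Lemma poincare0 (w : 'rV[R]_m -> 'M[R]_m) :
  smooth_on B w ->
  (forall y, B y -> (w y)^T = - w y) ->
  (forall y i j k, B y ->
     partial i w y j k + partial j w y k i + partial k w y i j = 0) ->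
  smooth_on B (radial_primitive w) /\
  forall y i j, B y ->
    partial i (radial_primitive w) y j 0 - partial j (radial_primitive w) y i 0 = w y i j.
Proof.
move=> sw skw clw.
have oB : open B by exact: ball_open.
have sw' i j : smooth_on B (fun z => w z i j) by exact: smooth_on_mx.
have wN i j z : B z -> w z i j = - w z j i.
  by move=> Bz; move/matrixP/(_ j i) : (skw z Bz); rewrite !mxE.
have sprim : smooth_on B (radial_primitive w).
  move=> k; apply/Ck_mx => // j l.
  apply: (@Ck_ext _ _ _ _ _ (fun x => \sum_i x 0 i * radial_int 1 (fun z => w z i j) x)) => //.
    by move=> y _; rewrite mxE.
  apply: Ck_sum => // i _; apply: CkM => //; first exact: Ck_coord.
  exact/radial_int_Ck/sw'.
split=> // y j k By.
have pE i l : partial i (radial_primitive w) y l 0 =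
    radial_int 1 (fun z => w z i l) y
    + \sum_a y 0 a * radial_int 2 (partial i (fun z => w z a l)) y.
  have dT a := radial_int_diff 1 (sw' a l 1) By.
  rewrite partial_mx; last exact: smooth_on_diff sprim By.
  transitivity (partial i (fun x => \sum_a x 0 a * radial_int 1 (fun z => w z a l) x) y).
    by congr (partial i _ y); apply/funext => x; rewrite mxE.
  rewrite partial_sum; last first.
    by move=> a; apply: differentiableM; [exact: differentiable_coord|exact: (dT a).1].
  transitivity (\sum_a (y 0 a * radial_int 2 (partial i (fun z => w z a l)) y +
      (i == a)%:R * radial_int 1 (fun z => w z a l) y)).
    apply: eq_bigr => a _; rewrite partialM; [|exact: differentiable_coord|exact: (dT a).1].
    by rewrite partial_coord (dT a).2.
  rewrite big_split/= addrC; congr (_ + _).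
  rewrite (bigD1 i)//= eqxx mul1r big1 ?addr0// => a ai.
  by rewrite eq_sym (negbTE ai) mul0r.
have FT : w y j k = _ := radial_FTC (sw' j k) By.
apply: eq_trans (congr2 (fun a b => a - b) (pE j k) (pE k j)) _.
rewrite FT {FT pE}.
have B01 (t : R) : 0 <= t <= 1 -> B (t *: y) by move=> t01; exact: ball0Z.
have -> : radial_int 1 (fun z => w z k j) y = - radial_int 1 (fun z => w z j k) y.
  rewrite -mulN1r -int01Z; last exact: cont01_radial (sw' j k 0) By.
  by apply: eq_int01 => t t01; rewrite (wN k j) ?mulrN ?mulN1r//; exact: B01.
rewrite opprD opprK addrACA; congr (_ + _); rewrite -sumrB; apply: eq_bigr => a _.
rewrite -mulrBr -int01B; [|exact: cont01_radial (smooth_on_partial _ (sw' _ _) 0) By..].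
congr (_ * _); apply: eq_int01 => t t01; rewrite -mulrBr; congr (_ * _).
set z := t *: y; have Bz : B z by exact: B01.
have dw := smooth_on_diff sw Bz.
have := clw z a j k Bz; rewrite !partial_mx//.
have -> : partial j (fun x => w x k a) z = - partial j (fun x => w x a k) z.
  transitivity (partial j (fun x => (-1) * w x a k) z).
    apply: partial_near; apply: nbhs_sub (open_nbhs_nbhs (conj oB Bz)) => x Bx.
    by rewrite mulN1r wN.
  rewrite partialM; [|exact: differentiable_cst|exact: differentiable_mxE].
  by rewrite partial_cst mul0r addr0 mulN1r.
by move=> E; rewrite -[LHS]addr0 -E; ring.
Qed.

End poincare.

Lemma poincare {R : realType} {m : nat} (w : 'rV[R]_m -> 'M[R]_m) (y0 : 'rV[R]_m) (r : R) :
  smooth_on (ball y0 r) w ->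
  (forall y, ball y0 r y -> (w y)^T = - w y) ->
  (forall y i j k, ball y0 r y ->
     partial i w y j k + partial j w y k i + partial k w y i j = 0) ->
  exists a : 'rV[R]_m -> 'cV[R]_m, smooth_on (ball y0 r) a /\
  forall y i j, ball y0 r y -> partial i a y j 0 - partial j a y i 0 = w y i j.
Proof.
move=> sw skw clw; pose w0 z := w (z + y0).
have b0 z : ball 0 r z <-> ball y0 r (z + y0).
  by rewrite -!ball_normE/= sub0r opprD addrCA subrr addr0.
have b1 z : ball y0 r z -> ball 0 r (z + - y0).
  by move=> Bz; apply/b0; rewrite subrK.
have sw0 : smooth_on (ball 0 r) w0.
  by move=> k; apply: Ck_shift (sw k) => z /b0.
have [|y i j k|sa da] := poincare0 sw0; first by move=> y /b0; exact: skw.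
  by rewrite !partial_shift => /b0; exact: clw.
exists (fun y => radial_primitive w0 (y + - y0)); split.
  by move=> k; apply: Ck_shift (sa k) => z; exact: b1.
by move=> y i j /b1 By; rewrite !partial_shift da// /w0 subrK.
Qed.

(** * Bump functions *)

Section flat_functions.
Context {R : realType}.

(** All powers of [x^-1] are kept because the derivative of one member is a combination of the next
    two; smoothness of the member [n = 0], the classical flat function, is then an induction over
    the whole family. *)
Definition flat (n : nat) (x : R) : R :=
  if 0 < x then (x^-1) ^+ n * expR (- x^-1) else 0.

Lemma flat_ge0 n x : 0 <= flat n x.
Proof.
rewrite /flat; case: ifP => // x0.
by rewrite mulr_ge0 ?expR_ge0// exprn_ge0// invr_ge0 ltW.
Qed.

Lemma flat_gt0 n x : 0 < x -> 0 < flat n x.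
Proof. by move=> x0; rewrite /flat x0 mulr_gt0 ?expR_gt0// exprn_gt0// invr_gt0. Qed.

Lemma flat_le0 n x : x <= 0 -> flat n x = 0.
Proof. by rewrite /flat leNgt => /negbTE ->. Qed.

(* From [expR u = expR (u / n.+1) ^+ n.+1 >= (u / n.+1) ^+ n.+1] at [u = x^-1]. *)
Lemma flat_bound n x : 0 < x -> flat n x <= n.+1%:R ^+ n.+1 * x.
Proof.
move=> x0; rewrite /flat x0; set u := x^-1.
have u0 : 0 < u by rewrite invr_gt0.
have N0 : 0 < n.+1%:R :> R by rewrite ltr0n.
have H : (u / n.+1%:R) ^+ n.+1 <= expR u.
  have -> : expR u = expR (u / n.+1%:R) ^+ n.+1.
    by rewrite -expRM_natl mulrC divfK// gt_eqF.
  have v0 : 0 <= u / n.+1%:R by rewrite divr_ge0// ltW.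
  apply: lerXn2r; [by rewrite nnegrE|by rewrite nnegrE expR_ge0|].
  by apply: le_trans _ (expR_ge1Dx _); rewrite lerDr.
rewrite expRN ler_pdivrMr ?expR_gt0//.
apply: le_trans _ (ler_wpM2l _ H); last first.
  by rewrite mulr_ge0 ?exprn_ge0 ?ltW.
set N := n.+1%:R ^+ n.+1; have N1 : N * N^-1 = 1 by rewrite divff// expf_neq0 ?gt_eqF.
have xu : x * u = 1 by rewrite divff// gt_eqF.
rewrite expr_div_n -/N exprSr.
have -> : N * x * (u ^+ n * u / N) = (N * N^-1) * (x * u) * u ^+ n by ring.
by rewrite N1 xu !mul1r.
Qed.

Lemma is_derive_flat n (x : R) :
  is_derive x 1 (flat n) (flat n.+2 x - n%:R * flat n.+1 x).
Proof.
have [x0|x0|->] := ltgtP x 0.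
- rewrite !flat_le0 ?(ltW x0)// mulr0 subr0.
  apply: (@near_eq_is_derive _ _ _ (fun=> 0)).
  have : \forall z \near x, z < 0 by exact: lt_nbhsl.
  by apply: filterS => z z0; rewrite flat_le0// ltW.
- have E k : flat k x = x^-1 ^+ k * expR (- x^-1) by rewrite /flat x0.
  rewrite !E.
  have x0' : x != 0 by rewrite gt_eqF.
  apply: (@near_eq_is_derive _ _ _ (fun z : R => (z^-1) ^+ n * expR (- z^-1))).
    have : \forall z \near x, 0 < z by exact: lt_nbhsr.
    by apply: filterS => z z0; rewrite /flat z0.
  have dV : is_derive x 1 (fun z : R => z^-1) (- x ^- 2).
    apply: DeriveDef; first by apply: derivableV => //; exact: derivable_id.
    by rewrite deriveV// ?derive_id//; rewrite -[LHS]/(_ * _) mulr1.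
  have dX : is_derive x 1 (fun z : R => (z^-1) ^+ n) (n%:R * (x^-1) ^+ n.-1 * (- x ^- 2)).
    case: n => [|n].
      have -> : (fun z : R => z^-1 ^+ 0) = (fun=> 1) by apply/funext => z; rewrite expr0.
      by rewrite !mul0r; exact: (is_derive_cst (1 : R)).
    have -> : (fun z : R => z^-1 ^+ n.+1) = (fun z : R => z^-1) ^+ n.+1.
      by apply/funext => z; rewrite exprfctE.
    exact: is_deriveX.
  have dE : is_derive x 1 (fun z : R => expR (- z^-1)) (expR (- x^-1) * x ^- 2).
    have dN := is_deriveN dV.
    have dc := @is_derive1_comp _ expR (fun z : R => - z^-1) x _ _ (is_derive_expR _) dN.
    apply: is_derive_eq dc _.
    by rewrite opprK.
  apply: is_derive_eq (is_deriveM dX dE) _.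
  rewrite -[LHS]/(x^-1 ^+ n * (expR (- x^-1) * x ^- 2) +
    expR (- x^-1) * (n%:R * (x^-1) ^+ n.-1 * (- x ^- 2))).
  rewrite -!exprVn; case: n {dX} => [|n]; first by rewrite !mul0r; ring.
  by rewrite /= !exprS; ring.
(* At 0 the difference quotient of [flat n] from the right is [flat n.+1], which tends to 0 by
   [flat_bound]; [C] is the constant of that bound for the index [n.+1]. *)
- rewrite !flat_le0// mulr0 subr0.
  have fl : (fun h : R => h^-1 *: ((flat n \o shift (0 : R)) (h *: (1 : R)) - flat n 0))
      @ 0^' --> (0 : R).
    apply/cvgrPdist_le => e e0.
    pose C : R := n.+2%:R ^+ n.+2.
    have C0 : 0 < C by rewrite exprn_gt0.
    have : \forall h \near (0 : R)^', `|h| < e / C.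
      by apply: dnbhs0_lt; rewrite divr_gt0.
    apply: filterS => h he.
    rewrite sub0r normrN /= addr0 (flat_le0 n (lexx 0)) subr0.
    rewrite -[h *: 1]/(h * 1) mulr1 -[_ *: _]/(_ * _).
    have [h0|h0] := leP h 0; first by rewrite flat_le0// mulr0 normr0 ltW.
    have -> : h^-1 * flat n h = flat n.+1 h by rewrite /flat h0 exprS mulrA.
    rewrite ger0_norm ?flat_ge0//; apply: le_trans (flat_bound n.+1 h0) _.
    move: he; rewrite gtr0_norm// ltr_pdivlMr// => /ltW.
    by rewrite mulrC.
  by apply: DeriveDef; [apply/cvg_ex; exists 0|exact/cvg_lim].
Qed.

Definition smooth_step (x : R) : R := flat 0 x / (flat 0 x + flat 0 (1 - x)).

Lemma smooth_step_den_gt0 x : 0 < flat 0 x + flat 0 (1 - x).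
Proof.
have [x0|x0] := ltP 0 x; first by rewrite ltr_pwDl ?flat_gt0// flat_ge0.
by rewrite ltr_wpDl ?flat_ge0// flat_gt0// subr_gt0 (le_lt_trans x0).
Qed.

Lemma smooth_step_ge0 x : 0 <= smooth_step x.
Proof. by rewrite divr_ge0 ?flat_ge0// ltW// smooth_step_den_gt0. Qed.

Lemma smooth_step_le1 x : smooth_step x <= 1.
Proof. by rewrite ler_pdivrMr ?smooth_step_den_gt0// mul1r lerDl flat_ge0. Qed.

Lemma smooth_step0 x : x <= 0 -> smooth_step x = 0.
Proof. by move=> x0; rewrite /smooth_step flat_le0// mul0r. Qed.

Lemma smooth_step1 x : 1 <= x -> smooth_step x = 1.
Proof.
move=> x1; rewrite /smooth_step (@flat_le0 _ (1 - x)) ?subr_le0//.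
by rewrite addr0 divff// gt_eqF// flat_gt0// (lt_le_trans ltr01).
Qed.

End flat_functions.

Section bump_functions.
Context {R : realType} {m : nat}.
Implicit Types U : set 'rV[R]_m.

Lemma partial_comp1 (phi : R -> R) (d : R) (g : 'rV[R]_m -> R) y :
  differentiable g y -> is_derive (g y) 1 phi d ->
  differentiable (phi \o g) y /\ forall i, partial i (phi \o g) y = d * partial i g y.
Proof.
move=> dg [/derivable1_diffP dphi dE]; have dc := differentiable_comp dg dphi.
split=> // i; rewrite /partial !deriveE// diff_comp//=.
rewrite -[X in 'd phi _ X]mulr1 -[X in 'd phi _ X]/(_ *: (1 : R)) linearZ/=.
by rewrite -(deriveE _ dphi) dE -[LHS]/(_ * _) mulrC.
Qed.

Lemma Ck_flat k n U (g : 'rV[R]_m -> R) : open U -> Ck k U g -> Ck k U (flat n \o g).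
Proof.
move=> oU; elim: k n => [|k IH] n cg.
  move=> y Uy; apply: continuous_comp; first exact: cg.
  have [df _] := is_derive_flat n (g y).
  exact/differentiable_continuous/derivable1_diffP.
have [dg pg] := cg; split=> [y Uy|i].
  exact: (partial_comp1 (dg y Uy) (is_derive_flat n _)).1.
have cd : Ck k U (fun y => ((flat n.+2 \o g) y - n%:R * (flat n.+1 \o g) y) * partial i g y).
  have c1 := IH n.+1 (CkW cg); have c2 := IH n.+2 (CkW cg).
  exact: CkM oU (CkB oU c2 (CkM oU (Ck_cstr k n%:R oU) c1)) (pg i).
by apply: Ck_ext cd => // y Uy; rewrite (partial_comp1 (dg y Uy) (is_derive_flat n _)).2.
Qed.

Lemma Ck_smooth_step k U (g : 'rV[R]_m -> R) :
  open U -> Ck k U g -> Ck k U (smooth_step \o g).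
Proof.
move=> oU cg.
have cg' : Ck k U (fun y => 1 - g y) by apply: CkB => //; exact: Ck_cstr.
apply: CkM; [by []|exact: Ck_flat|apply: Ck_inv => //].
  by move=> y _; rewrite gt_eqF// smooth_step_den_gt0.
by apply: CkD => //; [exact: Ck_flat|exact: (Ck_flat 0 oU cg')].
Qed.

(** Balls of ['rV[R]_m] are cubes for the maximum norm, so a product of one-variable steps fits
    them. *)
Lemma bump_exists (y0 : 'rV[R]_m) (r : R) : 0 < r ->
  exists b : 'rV[R]_m -> R, [/\ smooth_on setT b, (forall y, 0 <= b y <= 1),
    (forall y, ball y0 (r / 2) y -> b y = 1) & (forall y, b y != 0 -> ball y0 r y)].
Proof.
move=> r0.
(* The scaling makes [|t i y| < 1] on the half ball, where both steps equal 1, and [2 <= |t i y|]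
   for some [i] off the ball, where one step is 0. *)
pose t (i : 'I_m) (y : 'rV[R]_m) := 2 / r * (y 0 i - y0 0 i).
pose b (y : 'rV[R]_m) := \prod_i (smooth_step (2 - t i y) * smooth_step (2 + t i y)).
have r2 : 0 < 2 / r by rewrite divr_gt0.
have bi (i : 'I_m) y : 0 <= smooth_step (2 - t i y) * smooth_step (2 + t i y) <= 1.
  by rewrite mulr_ge0 ?smooth_step_ge0//= mulr_ile1 ?smooth_step_ge0 ?smooth_step_le1.
exists b; split.
- move=> k; have oT : open [set: 'rV[R]_m] by exact: openT.
  have ct i : Ck k setT (t i).
    apply: CkM => //; first exact: Ck_cstr.
    by apply: CkB => //; [exact: Ck_coord|exact: Ck_cstr].
  apply: Ck_prod => // i; apply: CkM => //.
    by apply: (@Ck_smooth_step _ _ (fun y => 2 - t i y)) => //; apply: CkB => //; exact: Ck_cstr.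
  by apply: (@Ck_smooth_step _ _ (fun y => 2 + t i y)) => //; apply: CkD => //; exact: Ck_cstr.
- move=> y; rewrite prodr_ge0 => [|i _]; last by case/andP: (bi i y).
  by rewrite prodr_ile1// => i _.
- move=> y [_ By]; apply: big1 => i _.
  have : `|t i y| < 1.
    have := By 0 i; rewrite -ball_normE/= distrC => yr.
    rewrite /t normrM (gtr0_norm r2).
    by rewrite -ltr_pdivlMl// mulr1 invf_div.
  move=> /ltr_normlP[t1 t2]; rewrite !smooth_step1 ?mulr1//; clear -t1 t2; lra.
- move=> y; apply: contraNP => nB.
  have [i yi] : exists i, r <= `|y0 0 i - y 0 i|.
    apply: contrapT => /forallNP h; apply: nB; split=> // j i; rewrite ord1.
    by rewrite -ball_normE/= ltNge; apply/negP/h.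
  have t2 : 2 <= `|t i y|.
    rewrite /t normrM (gtr0_norm r2) distrC -ler_pdivrMl//.
    by rewrite invf_div divfK.
  rewrite /b (bigD1 i)//= mulf_eq0; apply/orP; left; rewrite mulf_eq0; apply/orP.
  have [t0|t0] := leP 0 (t i y).
    by left; apply/eqP/smooth_step0; rewrite subr_le0 -(ger0_norm t0).
  by right; apply/eqP/smooth_step0; move: t2; rewrite ltr0_norm// => t2; clear -t2; lra.
Qed.

End bump_functions.

(** * Smooth maps between manifolds *)

Lemma open_preimage_in (T U : topologicalType) (f : T -> U) (D : set T) (O : set U) :
  open D -> (forall x, D x -> {for x, continuous f}) -> open O ->
  open [set x | D x /\ O (f x)].
Proof.
move=> oD cf oO; rewrite openE => x [Dx Ofx].
have n1 : nbhs x D by exact: open_nbhs_nbhs.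
have n2 : nbhs x [set z | O (f z)] by exact: (cf x Dx _ (open_nbhs_nbhs (conj oO Ofx))).
exact: filterI.
Qed.

Section manifold_charts.
Context {R : realType} {m : nat} (M : manifold R m).
Implicit Types (c : Defs.index M) (p : M) (y : 'rV[R]_m) (Om : set M).

Local Notation im c := (chart M c @` dom M c).

Lemma im_chart c p : dom M c p -> im c (chart M c p).
Proof. by move=> dp; exists p. Qed.

Lemma paramK c y : im c y -> chart M c (param M c y) = y.
Proof. by move=> [p dp <-]; rewrite chartK. Qed.

Lemma dom_param c y : im c y -> dom M c (param M c y).
Proof. by move=> [p dp <-]; rewrite chartK. Qed.

Definition chart_set c Om : set 'rV[R]_m := [set y | im c y /\ Om (param M c y)].

Lemma chart_set_open c Om : open Om -> open (chart_set c Om).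
Proof.
move=> oO; apply: open_preimage_in => //; first exact: image_open.
exact: param_continuous.
Qed.

Arguments chart_set_open c {Om} _.

Lemma chart_preimage_open c (O : set 'rV[R]_m) : open O ->
  open [set p | dom M c p /\ O (chart M c p)].
Proof.
by move=> oO; apply: open_preimage_in => //; [exact: dom_open|exact: chart_continuous].
Qed.

Definition sfun (V : normedModType R) Om (u : M -> V) :=
  forall c, smooth_on (chart_set c Om) (u \o param M c).

Lemma sfun_sub (V : normedModType R) Om Om' (u : M -> V) :
  Om' `<=` Om -> sfun Om u -> sfun Om' u.
Proof. by move=> h su c k; apply: Ck_sub (su c k) => y [? /h]. Qed.

Lemma sfun_ext (V : normedModType R) Om (u v : M -> V) : open Om ->
  (forall p, Om p -> u p = v p) -> sfun Om u -> sfun Om v.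
Proof.
move=> oO uv su c k; apply: Ck_ext (su c k); first exact: chart_set_open.
by move=> y [_ /uv].
Qed.

Lemma sfun_local (V : normedModType R) Om (u : M -> V) :
  (forall p, Om p -> exists2 Om', Om' p & sfun Om' u) -> sfun Om u.
Proof.
move=> loc c k; apply: Ck_pointwise => y [cy Oy].
have [Om' Oy' su] := loc _ Oy.
by apply: Ck_sub (su c k) => _ ->.
Qed.

Lemma sfun_continuous (V : normedModType R) Om (u : M -> V) p :
  open Om -> sfun Om u -> Om p -> {for p, continuous u}.
Proof.
move=> oO su Op; set c := chart_at M p; have dp : dom M c p by exact: dom_chart_at.
have cy : chart_set c Om (chart M c p) by split; [exact: im_chart|rewrite chartK].
have cc : {for p, continuous ((u \o param M c) \o chart M c)}.
  apply: continuous_comp; first exact: chart_continuous.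
  exact: su c 0 _ cy.
have nE : \forall q \near p, ((u \o param M c) \o chart M c) q = u q.
  apply: nbhs_sub (open_nbhs_nbhs (conj (dom_open c) dp)) => q dq.
  by rewrite /= chartK.
rewrite /prop_for /continuous_at -(nbhs_singleton nE).
by apply: cvg_trans cc; exact: (near_eq_cvg nE).
Qed.

Lemma sfun_cst (V : normedModType R) Om (a : V) : open Om -> sfun Om (fun=> a).
Proof. by move=> oO c k; apply: Ck_cst; exact: chart_set_open. Qed.

Lemma sfun_mx Om a b (u : M -> 'M[R]_(a, b)) : open Om ->
  sfun Om u <-> forall i j, sfun Om (fun p => u p i j).
Proof.
move=> oO; split=> [su i j c k|su c k].
  by have := (Ck_mx _ _ (chart_set_open c oO)).1 (su c k); apply.
by apply/(Ck_mx _ _ (chart_set_open c oO)) => i j; exact: su.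
Qed.

Lemma sfunD Om (u v : M -> R) : open Om ->
  sfun Om u -> sfun Om v -> sfun Om (fun p => u p + v p).
Proof. by move=> oO su sv c k; apply: CkD (su c k) (sv c k); exact: chart_set_open. Qed.

Lemma sfunM Om (u v : M -> R) : open Om ->
  sfun Om u -> sfun Om v -> sfun Om (fun p => u p * v p).
Proof. by move=> oO su sv c k; apply: CkM (su c k) (sv c k); exact: chart_set_open. Qed.

Lemma sfunB Om (u v : M -> R) : open Om ->
  sfun Om u -> sfun Om v -> sfun Om (fun p => u p - v p).
Proof. by move=> oO su sv c k; apply: CkB (su c k) (sv c k); exact: chart_set_open. Qed.

Lemma sfun_comp n a b Om (V : set 'rV[R]_n) (G : M -> 'rV[R]_n)
    (g : 'rV[R]_n -> 'M[R]_(a, b)) : open Om -> open V ->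
  (forall p, Om p -> V (G p)) -> sfun Om G -> smooth_on V g -> sfun Om (g \o G).
Proof.
move=> oO oV GV sG sg c k; apply: Ck_comp_mx (sG c k) (sg k) => //.
  exact: chart_set_open.
by move=> y [_ /GV].
Qed.

Lemma sfun_chart c : sfun (dom M c) (chart M c).
Proof.
move=> c' k; apply: Ck_sub (transition_smooth c' c k) => y [cy dy].
by exists (param M c' y); [split => //; exact: dom_param|exact: paramK].
Qed.

Lemma sfun_convex n Om (chi : M -> R) (u v : M -> 'rV[R]_n) : open Om ->
  sfun Om chi -> sfun Om u -> sfun Om v ->
  sfun Om (fun p => (1 - chi p) *: u p + chi p *: v p).
Proof.
move=> oO sc /sfun_mx su /sfun_mx sv; apply/sfun_mx => // i j.
apply: (@sfun_ext _ _ (fun p => (1 - chi p) * u p i j + chi p * v p i j)) => //.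
  by move=> p _; rewrite !mxE.
apply: sfunD => //; apply: sfunM => //; [|exact: su|exact: sv].
by apply: sfunB => //; exact: sfun_cst.
Qed.

(** The bump of a chart is extended by zero. It is supported in the image [K] of a closed coordinate
    ball, compact and hence closed in the Hausdorff space [M]; so the extension vanishes on an open
    set containing every point outside the chart. *)
Lemma manifold_bump p0 (U : set M) : open U -> U p0 ->
  exists (chi : M -> R) (K : set M), [/\ sfun setT chi, (forall p, 0 <= chi p <= 1),
    compact K /\ closed K, K `<=` U &
    (forall p, chi p != 0 -> K p) /\
    exists O : set M, [/\ open O, O p0 & forall p, O p -> chi p = 1]].
Proof.
move=> oU Up0; set c := chart_at M p0; have d0 : dom M c p0 by exact: dom_chart_at.
set y0 := chart M c p0.
have cs0 : chart_set c U y0 by split; [exact: im_chart|rewrite chartK].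
have /nbhs_ballP[s /= s0 Bs] := open_nbhs_nbhs (conj (chart_set_open c oU) cs0).
(* Half the radius, so that the closed ball [B] still lies in the open set. *)
pose r := s / 2; have r0 : 0 < r by rewrite divr_gt0.
pose B := [set y : 'rV[R]_m | `|y0 - y| <= r].
have BB : B `<=` chart_set c U.
  move=> y /= yB; apply: Bs; rewrite -ball_normE/=; apply: le_lt_trans yB _.
  by rewrite /r ltr_pdivrMr// ltr_pMr// ltr1n.
have cB : compact B.
  have -> : B = closed_ball y0 r by rewrite closed_ballE.
  apply: bounded_closed_compact; last exact: closed_ball_closed.
  rewrite closed_ballE//; exists (`|y0| + r); split; first exact: num_real.
  move=> x xr y /= yB; apply: le_trans (ltW xr).
  rewrite -[y](subKr y0) (le_trans (ler_normB _ _))//.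
  by rewrite lerD2l.
pose K := param M c @` B.
have cK : compact K.
  apply: continuous_compact => //; apply: continuous_in_subspaceT => y.
  by rewrite inE => /BB[cy _]; exact: param_continuous.
have clK : closed K by apply: compact_closed => //; exact: manifold_hausdorff.
have [b [sb b01 b1 bsupp]] := bump_exists y0 r0.
pose chi p := if `[< dom M c p >] then b (chart M c p) else 0.
have chiK p : chi p != 0 -> K p.
  rewrite /chi; case: asboolP => [dp /bsupp yB|_]; last by rewrite eqxx.
  exists (chart M c p); last exact: chartK.
  by move: yB; rewrite -ball_normE/= => /ltW.
exists chi, K; split => //.
- apply: sfun_local => p _; have [dp|ndp] := pselect (dom M c p).
    exists (dom M c) => //.
    apply: (@sfun_ext _ _ (b \o chart M c)); first exact: dom_open.
      by move=> q dq; rewrite /chi; case: asboolP.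
    move=> c' k; apply: Ck_comp (sfun_chart c c' k) (sb k) => //.
    by apply: chart_set_open; exact: dom_open.
  have oK : open (~` K) by rewrite openC.
  exists (~` K).
    by move=> [y yB E]; apply: ndp; rewrite -E; apply: dom_param; have [] := BB _ yB.
  apply: (@sfun_ext _ _ (fun=> 0)) => //; last exact: sfun_cst.
  by move=> q nKq; have [->//|/chiK/nKq] := eqVneq (chi q) 0.
- by move=> p; rewrite /chi; case: asboolP => // _; rewrite lexx ler01.
- by move=> p [y /BB[_ Uy] <-].
split=> //; exists [set p | dom M c p /\ ball y0 (r / 2) (chart M c p)]; split.
- by apply: chart_preimage_open; exact: ball_open.
- by split=> //; apply: ballxx; rewrite divr_gt0.
- by move=> p [dp pB]; rewrite /chi; case: asboolP => // _; exact: b1.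
Qed.

End manifold_charts.

Arguments chart_set {R m M} c Om.
Arguments chart_set_open {R m M} c {Om} _.

Section smooth_maps.
Context {R : realType} {m n : nat} (M : manifold R m) (N : manifold R n).
Implicit Types (f : M -> N) (Om : set M).

(** Continuity is part of the notion: over an open [Om] it makes the preimages of chart domains
    open, so that smoothness of [chart N d \o f] on them is a local statement. *)
Definition smooth_in Om f :=
  (forall p, Om p -> {for p, continuous f}) /\
  forall d, sfun [set p | Om p /\ dom N d (f p)] (chart N d \o f).

Lemma smooth_in_setT f : smooth_map f <-> smooth_in setT f.
Proof.
split=> [[cf sf]|[cf sf]]; split.
- by move=> p _; exact: cf.
- move=> d c k; apply: Ck_sub (sf c d k) => y [? [_ ?]].
  by split.
- by move=> p; exact: cf.
- move=> c d k; apply: Ck_sub (sf d c k) => y [? ?].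
  by split.
Qed.

Lemma smooth_in_sub Om Om' f : Om' `<=` Om -> smooth_in Om f -> smooth_in Om' f.
Proof.
move=> h [cf sf]; split=> [p /h|d]; first exact: cf.
by apply: sfun_sub (sf d) => p [/h].
Qed.

Lemma smooth_in_local Om f :
  (forall p, Om p -> exists2 Om', Om' p & smooth_in Om' f) -> smooth_in Om f.
Proof.
move=> loc; split=> [p /loc[Om' Op [cf _]]|d]; first exact: cf.
apply: sfun_local => p [/loc[Om' Op [_ sf]] dp].
by exists [set p | Om' p /\ dom N d (f p)].
Qed.

Lemma smooth_in_open Om f d : open Om -> smooth_in Om f ->
  open [set p | Om p /\ dom N d (f p)].
Proof. by move=> oO [cf _]; apply: open_preimage_in => //; exact: dom_open. Qed.

Lemma smooth_in_ext Om f h : open Om -> (forall p, Om p -> f p = h p) ->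
  smooth_in Om f -> smooth_in Om h.
Proof.
move=> oO fh sf; have [cf df] := sf; split=> [p Op|d].
  have nfh : \forall q \near p, f q = h q.
    by apply: nbhs_sub (open_nbhs_nbhs (conj oO Op)) => q; exact: fh.
  rewrite /prop_for /continuous_at -(fh _ Op).
  by apply: cvg_trans (cf p Op); exact: (near_eq_cvg nfh).
have -> : [set p | Om p /\ dom N d (h p)] = [set p | Om p /\ dom N d (f p)].
  by apply/seteqP; split => p /= [Op]; rewrite fh.
apply: sfun_ext (df d); first exact: smooth_in_open.
by move=> p [Op _]; rewrite /= fh.
Qed.

Lemma smooth_in_chart Om f d : (forall p, Om p -> dom N d (f p)) ->
  smooth_in Om f -> sfun Om (chart N d \o f).
Proof. by move=> fd [_ sf]; apply: sfun_sub (sf d) => p Op; split=> //; exact: fd. Qed.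

(** Maps into [N] are produced below by prescribing coordinates [G] in one chart; another chart [d']
    sees them through a transition map. *)
Lemma smooth_in_param Om d (G : M -> 'rV[R]_n) : open Om ->
  (forall p, Om p -> (chart N d @` dom N d) (G p)) -> sfun Om G ->
  smooth_in Om (param N d \o G).
Proof.
move=> oO Gd sG.
have cG p : Om p -> {for p, continuous (param N d \o G)}.
  move=> Op; apply: continuous_comp; first exact: sfun_continuous sG Op.
  by apply: param_continuous; exact: Gd.
split=> // d'; have oV := chart_set_open d (dom_open d').
apply: (@sfun_comp _ _ _ _ _ _ _ (chart_set d (dom N d')) G (chart N d' \o param N d)) => //.
- by apply: open_preimage_in => //; exact: dom_open.
- by move=> p [Op dp]; split=> //; exact: Gd.
- by apply: sfun_sub sG => p [].
- exact: (sfun_chart d' d).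
Qed.

End smooth_maps.

(** * Jacobians and pullbacks in charts *)

Section jacobians.
Context {R : realType}.

Lemma jacobianE {m n : nat} (f : 'rV[R]_m -> 'rV[R]_n) y i a :
  differentiable f y -> 'J f y i a = partial i (fun z => f z 0 a) y.
Proof.
by move=> df; rewrite /jacobian mxE -deriveE// -partial_mx.
Qed.

(** Tangent vectors are rows and Jacobians act on the right, so the inner map comes first. *)
Lemma jacobian_comp {m n l : nat} (f : 'rV[R]_m -> 'rV[R]_n) (g : 'rV[R]_n -> 'rV[R]_l) y :
  differentiable f y -> differentiable g (f y) ->
  'J (g \o f) y = 'J f y *m 'J g (f y).
Proof.
move=> df dg; apply/row_matrixP => i; rewrite !rowE mulmxA.
by rewrite !mul_rV_lin1/= diff_comp.
Qed.

Lemma jacobian_near {m n : nat} (f g : 'rV[R]_m -> 'rV[R]_n) y :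
  (\forall z \near y, f z = g z) -> differentiable f y -> 'J f y = 'J g y.
Proof.
move=> fg df; have dg := near_eq_differentiable fg df.
apply/matrixP => i a.
apply: eq_trans (jacobianE i a df) (eq_trans _ (esym (jacobianE i a dg))).
apply: partial_near; by apply: nbhs_sub fg => z ->.
Qed.

Lemma differentiable_idr {m : nat} (y : 'rV[R]_m) : differentiable (@id 'rV[R]_m) y.
Proof. exact: ex_diff. Qed.

Lemma jacobian_id {m : nat} (y : 'rV[R]_m) : 'J id y = 1%:M.
Proof.
apply/matrixP => i a; rewrite jacobianE; last exact: differentiable_idr.
by rewrite partial_coord mxE.
Qed.

Lemma Ck_jacobian {m n : nat} k (U : set 'rV[R]_m) (f : 'rV[R]_m -> 'rV[R]_n) :
  open U -> Ck k.+1 U f -> Ck k U (fun y => 'J f y).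
Proof.
move=> oU cf; have [df _] := cf; apply/Ck_mx => // i a.
have [_ /(_ i)] := (Ck_mx _ _ oU).1 cf 0 a.
by apply: Ck_ext => // y Uy; rewrite jacobianE//; exact: df.
Qed.

End jacobians.

(* Unification would otherwise unfold these down to limits and diverge. *)
Opaque jacobian partial derive.

Section coordinate_representation.
Context {R : realType}.

Definition rep {m n : nat} {M : manifold R m} {N : manifold R n}
  (c : Defs.index M) (d : Defs.index N) (f : M -> N) (y : 'rV[R]_m) : 'rV[R]_n :=
  chart N d (f (param M c y)).

Context {m n : nat} {M : manifold R m} {N : manifold R n}.
Implicit Types (c : Defs.index M) (d : Defs.index N) (f : M -> N).

Lemma smooth_in_id Om : open Om -> smooth_in Om (@id M).
Proof.
move=> oO; split=> [p _|d]; first exact: cvg_id.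
by apply: sfun_sub (sfun_chart d) => p [].
Qed.

Lemma rep_smooth Om f c d : smooth_in Om f ->
  smooth_on (chart_set c [set p | Om p /\ dom N d (f p)]) (rep c d f).
Proof. by move=> [_ sf]; exact: sf. Qed.

Lemma rep_open Om f c d : open Om -> smooth_in Om f ->
  open (chart_set c [set p | Om p /\ dom N d (f p)]).
Proof. by move=> oO sf; apply: chart_set_open; exact: smooth_in_open. Qed.

Lemma rep_diff Om f c d p : smooth_in Om f -> Om p -> dom M c p -> dom N d (f p) ->
  differentiable (rep c d f) (chart M c p).
Proof.
move=> sf Op cp dp; apply: smooth_on_diff (rep_smooth c d sf) _.
by split; [exact: im_chart|rewrite chartK].
Qed.

End coordinate_representation.

Section composition.
Context {R : realType} {m n l : nat}.
Context {M : manifold R m} {N : manifold R n} {P : manifold R l}.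
Implicit Types (c : Defs.index M) (d : Defs.index N) (e : Defs.index P) (f : M -> N).

(** Passing through the chart [d] is legitimate near the point because [f] stays in its domain
    there. With the identity for [f] or [h] the formula yields all coordinate changes below. *)
Lemma jacobian_rep_comp Om Om' f (h : N -> P) c d e p :
  smooth_in Om f -> smooth_in Om' h -> open Om -> Om p -> Om' (f p) ->
  dom M c p -> dom N d (f p) -> dom P e (h (f p)) ->
  'J (rep c e (h \o f)) (chart M c p) =
  'J (rep c d f) (chart M c p) *m 'J (rep d e h) (chart N d (f p)).
Proof.
move=> sf sh oO Op Op' cp dp ep.
have df := rep_diff sf Op cp dp; have dh := rep_diff sh Op' dp ep.
have E : rep c d f (chart M c p) = chart N d (f p) by rewrite /rep chartK.
move: dh; rewrite -E => dh; rewrite -(jacobian_comp df dh).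
apply/esym/jacobian_near; last exact: differentiable_comp.
have : chart_set c [set p | Om p /\ dom N d (f p)] (chart M c p).
  by split; [exact: im_chart|rewrite chartK].
move/(conj (rep_open oO sf))/open_nbhs_nbhs; apply: nbhs_sub => z [_ [_ dz]].
by rewrite /= /rep chartK.
Qed.

End composition.

Section coordinate_changes.
Context {R : realType} {m : nat} {M : manifold R m}.
Implicit Types (c : Defs.index M) (p : M).

Lemma jacobian_rep_id c p : dom M c p -> 'J (rep c c (@id M)) (chart M c p) = 1%:M.
Proof.
move=> cp; rewrite -(jacobian_id (chart M c p)).
apply/esym/jacobian_near; last exact: differentiable_idr.
apply: nbhs_sub (open_nbhs_nbhs (conj (@image_open _ _ M c) (im_chart cp))) => z cz.
by rewrite /rep/= paramK.
Qed.

Lemma jacobian_transition_inv c c' p : dom M c p -> dom M c' p ->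
  'J (rep c c' (@id M)) (chart M c p) *m 'J (rep c' c (@id M)) (chart M c' p) = 1%:M.
Proof.
move=> cp cp'; have sid := smooth_in_id (@openT M).
rewrite -(jacobian_rep_id cp).
exact: (esym (jacobian_rep_comp sid sid (@openT M) I I cp cp' cp)).
Qed.

(** The target chart in [coord_change] varies with the point. At a given [p] it is frozen to
    [chart_at M p], which makes the matrix the Jacobian of an honest transition map. *)
Lemma coord_changeE c p : dom M c p ->
  coord_change c (chart M c p) = 'J (rep c (chart_at M p) (@id M)) (chart M c p).
Proof. by move=> cp; rewrite /coord_change chartK. Qed.

Lemma coord_change_center p :
  coord_change (chart_at M p) (chart M (chart_at M p) p) = 1%:M.
Proof. by rewrite coord_changeE ?jacobian_rep_id//; exact: dom_chart_at. Qed.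

Lemma coord_change_unit c p : dom M c p -> coord_change c (chart M c p) \in unitmx.
Proof.
move=> cp; rewrite coord_changeE//.
exact: (mulmx1_unit (jacobian_transition_inv cp (dom_chart_at p))).1.
Qed.

Lemma coord_change_transition c c' p : dom M c p -> dom M c' p ->
  coord_change c (chart M c p) =
  'J (rep c c' (@id M)) (chart M c p) *m coord_change c' (chart M c' p).
Proof.
move=> cp cp'; rewrite (coord_changeE cp) (coord_changeE cp'); have sid := smooth_in_id (@openT M).
exact: (jacobian_rep_comp sid sid (@openT M) I I cp cp' (dom_chart_at p)).
Qed.

Lemma coord2_transition (a : M -> 'M[R]_m) c c' p : dom M c p -> dom M c' p ->
  coord2 a c (chart M c p) =
  'J (rep c c' (@id M)) (chart M c p) *m coord2 a c' (chart M c' p)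
  *m ('J (rep c c' (@id M)) (chart M c p))^T.
Proof.
move=> cp cp'; rewrite /coord2 (chartK cp) (chartK cp') (coord_change_transition cp cp').
by rewrite trmx_mul !mulmxA.
Qed.

Lemma coord2_center (a : M -> 'M[R]_m) p :
  coord2 a (chart_at M p) (chart M (chart_at M p) p) = a p.
Proof.
rewrite /coord2 coord_change_center (chartK (dom_chart_at p)).
by rewrite trmx1 mul1mx mulmx1.
Qed.

End coordinate_changes.

Section pullbacks.
Context {R : realType} {m n : nat} {M : manifold R m} {N : manifold R n}.
Implicit Types (c : Defs.index M) (d : Defs.index N) (f : M -> N) (p : M).

(** Both sides are the Jacobian of [f] from the chart [c] to the preferred chart at [f p]. *)
Lemma tangent_mapE Om f c d p : open Om -> smooth_in Om f -> Om p ->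
  dom M c p -> dom N d (f p) ->
  coord_change c (chart M c p) *m tangent_map f p =
  'J (rep c d f) (chart M c p) *m coord_change d (chart N d (f p)).
Proof.
move=> oO sf Op cp dp; rewrite (coord_changeE cp) (coord_changeE dp).
have sidM := smooth_in_id (@openT M); have sidN := smooth_in_id (@openT N).
have d1 := dom_chart_at p; have d2 := dom_chart_at (f p).
rewrite -[RHS](jacobian_rep_comp sf sidN oO Op I cp dp d2).
exact: (esym (jacobian_rep_comp sidM sf (@openT M) I Op cp d1 d2)).
Qed.

(** The preferred charts disappear: in any pair of charts the pullback is the usual matrix formula,
    which can be differentiated. *)
Lemma coord2_pullback Om f (a : N -> 'M[R]_n) c d p : open Om -> smooth_in Om f -> Om p ->
  dom M c p -> dom N d (f p) ->
  coord2 (pullback f a) c (chart M c p) =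
  'J (rep c d f) (chart M c p) *m coord2 a d (chart N d (f p))
  *m ('J (rep c d f) (chart M c p))^T.
Proof.
move=> oO sf Op cp dp; rewrite /coord2 /pullback (chartK cp) (chartK dp).
rewrite !mulmxA (tangent_mapE oO sf Op cp dp) -!mulmxA; congr (_ *m (_ *m (_ *m _))).
by rewrite -!trmx_mul (tangent_mapE oO sf Op cp dp).
Qed.

Lemma pullbackE Om f (a : N -> 'M[R]_n) d p : open Om -> smooth_in Om f -> Om p ->
  dom N d (f p) ->
  let c := chart_at M p in
  pullback f a p = 'J (rep c d f) (chart M c p) *m coord2 a d (chart N d (f p))
  *m ('J (rep c d f) (chart M c p))^T.
Proof.
move=> oO sf Op dp c; rewrite -(coord2_center (pullback f a)).
exact: (coord2_pullback _ oO sf Op (dom_chart_at p) dp).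
Qed.

Lemma pullback_smooth2 f (a : N -> 'M[R]_n) :
  smooth_map f -> smooth2 a -> smooth2 (pullback f a).
Proof.
move=> /smooth_in_setT sf sa c k; apply: Ck_pointwise => y cy.
set d := chart_at N (f (param M c y)).
set U := chart_set c [set p | setT p /\ dom N d (f p)].
have oU : open U by apply: rep_open => //; exact: openT.
have Uy : U y := (conj cy (conj I (dom_chart_at (f (param M c y))))).
suff : Ck k U (coord2 (pullback f a) c) by apply: Ck_sub => _ ->.
apply: (@Ck_ext _ _ _ _ _ (fun z => 'J (rep c d f) z *m (coord2 a d \o rep c d f) z
    *m ('J (rep c d f) z)^T)) => //.
  move=> z [cz [_ dz]].
  have E := coord2_pullback a (@openT M) sf I (dom_param cz) dz.
  by rewrite (paramK cz) in E; exact: esym E.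
have srep := rep_smooth c d sf.
have cJ : Ck k U (fun z => 'J (rep c d f) z) by apply: Ck_jacobian => //; exact: srep.
apply: Ck_mulmx => //; last exact: Ck_trmx.
apply: Ck_mulmx => //.
apply: (Ck_comp_mx oU (@image_open _ _ N d) _ (srep k) (sa d k)).
by move=> z [_ [_ dz]]; exact: im_chart.
Qed.

End pullbacks.

(** * Naturality of the exterior derivative *)

Section index_sums.
Context {R : realType} {m n : nat}.
Variables (H : 'I_m -> 'I_m -> 'I_n -> R) (J : 'I_n -> 'I_m -> R).
Hypothesis H_sym : forall i j a, H i j a = H j i a.

(** In this section [H i j a] stands for the second derivative [d_i d_j F_a] and [J a j] for
    [d_j F_a]. Symmetry of [H] removes the second derivatives from [d] of a pulled back 1-form. *)
Lemma alternate_sum1 (v : 'I_n -> R) (dv : 'I_n -> 'I_n -> R) i j :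
  (\sum_a H i j a * v a + \sum_a \sum_b J a j * (dv b a * J b i))
  - (\sum_a H j i a * v a + \sum_a \sum_b J a i * (dv b a * J b j)) =
  \sum_b \sum_a J b i * (dv b a - dv a b) * J a j.
Proof.
under eq_bigr do rewrite H_sym.
rewrite opprD addrACA subrr add0r [X in X - _]exchange_big/= -sumrB.
apply: eq_bigr => b _; rewrite -sumrB; apply: eq_bigr => a _; ring.
Qed.

(** [X] collects terms in which a second derivative of the map occurs, [Q] those in which [w] is
    differentiated. *)
Let X (w : 'I_n -> 'I_n -> R) i j k := \sum_a \sum_b H i j a * w a b * J b k.
Let Q (dw : 'I_n -> 'I_n -> 'I_n -> R) i j k :=
  \sum_a \sum_b \sum_c J a j * J b k * J c i * dw c a b.

Lemma leibniz_sum (w : 'I_n -> 'I_n -> R) (dw : 'I_n -> 'I_n -> 'I_n -> R) i j k :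
  (forall a b, w a b = - w b a) ->
  \sum_a \sum_b (J a j * w a b * H i k b
    + (J a j * (\sum_c dw c a b * J c i) + H i j a * w a b) * J b k) =
  X w i j k + Q dw i j k - X w i k j.
Proof.
move=> skw; have -> : X w i k j = - \sum_a \sum_b J a j * w a b * H i k b.
  rewrite /X exchange_big/= -sumrN; apply: eq_bigr => a _.
  by rewrite -sumrN; apply: eq_bigr => b _; rewrite (skw b a); ring.
rewrite opprK -!big_split/=; apply: eq_bigr => a _.
rewrite -!big_split/=; apply: eq_bigr => b _.
have -> : \sum_c J a j * J b k * J c i * dw c a b =
    J a j * (\sum_c dw c a b * J c i) * J b k.
  by rewrite mulr_sumr mulr_suml; apply: eq_bigr => c _; ring.
ring.
Qed.

(** The six [X] terms cancel in pairs by symmetry of [H]. After renaming summation indices the three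
    [Q] terms share the product of [J] factors, and the remaining cyclic sum of [dw] is zero. *)
Lemma cyclic_sum0 (w : 'I_n -> 'I_n -> R) (dw : 'I_n -> 'I_n -> 'I_n -> R) i j k :
  (forall a b c, dw a b c + dw b c a + dw c a b = 0) ->
  X w i j k + Q dw i j k - X w i k j + (X w j k i + Q dw j k i - X w j i k)
  + (X w k i j + Q dw k i j - X w k j i) = 0.
Proof.
move=> cl; have Xs p q s : X w p q s = X w q p s.
  by apply: eq_bigr => a _; apply: eq_bigr => b _; rewrite H_sym.
have Q0 : Q dw i j k + Q dw j k i + Q dw k i j = 0.
  have -> : Q dw j k i = \sum_a \sum_b \sum_c J a j * J b k * J c i * dw a b c.
    rewrite /Q; under eq_bigr do rewrite exchange_big/=.
    rewrite exchange_big/=; apply: eq_bigr => a _; apply: eq_bigr => b _.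
    by apply: eq_bigr => c _; ring.
  have -> : Q dw k i j = \sum_a \sum_b \sum_c J a j * J b k * J c i * dw b c a.
    rewrite /Q exchange_big/=; apply: eq_bigr => a _.
    rewrite exchange_big/=; apply: eq_bigr => b _.
    by apply: eq_bigr => c _; ring.
  rewrite /Q -!big_split/=; apply: big1 => a _.
  rewrite -!big_split/=; apply: big1 => b _.
  rewrite -!big_split/=; apply: big1 => c _.
  by rewrite -!mulrDr cl mulr0.
rewrite (Xs j i k) (Xs k j i) (Xs k i j).
move: Q0; move: (X w i j k) (X w i k j) (X w j k i) => x1 x2 x3.
by move: (Q dw i j k) (Q dw j k i) (Q dw k i j) => q1 q2 q3 <-; ring.
Qed.

End index_sums.

Section naturality_of_d.
Context {R : realType} {m n : nat}.
Variables (U : set 'rV[R]_m) (V : set 'rV[R]_n) (F : 'rV[R]_m -> 'rV[R]_n).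
Hypotheses (oU : open U) (oV : open V) (FUV : forall y, U y -> V (F y)).
Hypothesis sF : smooth_on U F.
Implicit Types (al : 'rV[R]_n -> 'cV[R]_n) (w : 'rV[R]_n -> 'M[R]_n) (y : 'rV[R]_m).

Let Fc a z := F z 0 a.

Let sFc a : smooth_on U (Fc a).
Proof. exact: smooth_on_mx oU sF. Qed.

Let D a j : 'rV[R]_m -> R := partial j (Fc a).

Let dD a j y : U y -> differentiable (D a j) y.
Proof. by apply: smooth_on_diff; exact: smooth_on_partial. Qed.

(** Schwarz's theorem supplies the symmetry assumed in the index sums above. *)
Let D_sym a i j y : U y -> partial i (D a j) y = partial j (D a i) y.
Proof. by move=> Uy; apply: schwarz oU (sFc a 2) Uy. Qed.

Let JD y j a : U y -> 'J F y j a = D a j y.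
Proof. by move=> Uy; apply: jacobianE; exact: smooth_on_diff sF Uy. Qed.

Let dcomp (g : 'rV[R]_n -> R) y : smooth_on V g -> U y -> differentiable (g \o F) y.
Proof.
move=> sg Uy; apply: differentiable_comp; first exact: smooth_on_diff sF Uy.
by apply: smooth_on_diff sg _; exact: FUV.
Qed.

Let pcomp (g : 'rV[R]_n -> R) i y : smooth_on V g -> U y ->
  partial i (g \o F) y = \sum_c partial c g (F y) * D c i y.
Proof.
move=> sg Uy; apply: partial_comp; first exact: smooth_on_diff sF Uy.
by apply: smooth_on_diff sg _; exact: FUV.
Qed.

Definition pull1 (al : 'rV[R]_n -> 'cV[R]_n) (z : 'rV[R]_m) : 'cV[R]_m := 'J F z *m al (F z).

Definition pull2 (w : 'rV[R]_n -> 'M[R]_n) (z : 'rV[R]_m) : 'M[R]_m :=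
  'J F z *m w (F z) *m ('J F z)^T.

Lemma pull1_smooth al : smooth_on V al -> smooth_on U (pull1 al).
Proof.
move=> sa k; apply: Ck_mulmx => //; first exact: Ck_jacobian oU (sF k.+1).
exact: Ck_comp_mx oU oV FUV (sF k) (sa k).
Qed.

Lemma pull2_smooth w : smooth_on V w -> smooth_on U (pull2 w).
Proof.
move=> sw k; have cJ := Ck_jacobian oU (sF k.+1).
apply: Ck_mulmx => //; last exact: Ck_trmx.
apply: Ck_mulmx => //; exact: Ck_comp_mx oU oV FUV (sF k) (sw k).
Qed.

Lemma partial_pull1 al i j y : smooth_on V al -> U y ->
  partial i (pull1 al) y j 0 =
  \sum_a partial i (D a j) y * al (F y) a 0
  + \sum_a \sum_b D a j y * (partial b (fun x => al x a 0) (F y) * D b i y).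
Proof.
move=> sa Uy; have sa' a : smooth_on V (fun x => al x a 0) by exact: smooth_on_mx.
have dp : differentiable (pull1 al) y by exact: smooth_on_diff (pull1_smooth sa) Uy.
apply: eq_trans (partial_mx _ _ _ dp) _.
apply: (@eq_trans _ _ (partial i (fun z => \sum_a D a j z * ((fun x => al x a 0) \o F) z) y)).
  apply: partial_near; apply: nbhs_sub (open_nbhs_nbhs (conj oU Uy)) => z Uz.
  by rewrite mxE; apply: eq_bigr => a _; rewrite (JD j a Uz).
rewrite partial_sum; last first.
  by move=> a; apply: differentiableM; [exact: (dD a j Uy)|exact: (dcomp (sa' a) Uy)].
rewrite -big_split/=; apply: eq_bigr => a _.
rewrite partialM; [|exact: (dD a j Uy)|exact: (dcomp (sa' a) Uy)].
by rewrite (pcomp i (sa' a) Uy) mulr_sumr addrC.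
Qed.

Lemma d_pull1 al i j y : smooth_on V al -> U y ->
  partial i (pull1 al) y j 0 - partial j (pull1 al) y i 0 =
  \sum_b \sum_a D b i y * (partial b al (F y) a 0 - partial a al (F y) b 0) * D a j y.
Proof.
move=> sa Uy; have da : differentiable al (F y) by exact: smooth_on_diff sa (FUV Uy).
apply: eq_trans (congr2 (fun s t => s - t) (partial_pull1 i j sa Uy)
  (partial_pull1 j i sa Uy)) _.
apply: eq_trans (@alternate_sum1 _ _ _ (fun i j a => partial i (D a j) y) (fun a j => D a j y)
  _ (fun a => al (F y) a 0) (fun b a => partial b (fun x => al x a 0) (F y)) i j) _.
  by move=> i' j' a; exact: D_sym.
apply: eq_bigr => b _; apply: eq_bigr => a _.
exact: (congr1 (fun t => D b i y * t * D a j y) (congr2 (fun s t => s - t)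
  (esym (partial_mx b a 0 da)) (esym (partial_mx a b 0 da)))).
Qed.

(** Skewness of [w] lets the derivative of the last Jacobian factor be written like the first group
    with [j] and [k] exchanged and a minus sign, the shape needed for the cyclic cancellation. *)
Lemma partial_pull2 w i j k y : smooth_on V w -> U y ->
  (forall x, V x -> (w x)^T = - w x) ->
  partial i (pull2 w) y j k =
  \sum_a \sum_b partial i (D a j) y * w (F y) a b * D b k y
  + \sum_a \sum_b \sum_c D a j y * D b k y * D c i y * partial c (fun x => w x a b) (F y)
  - \sum_a \sum_b partial i (D a k) y * w (F y) a b * D b j y.
Proof.
move=> sw Uy skw; have sw' a b : smooth_on V (fun x => w x a b) by exact: smooth_on_mx.
have dp : differentiable (pull2 w) y by exact: smooth_on_diff (pull2_smooth sw) Uy.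
apply: eq_trans (partial_mx _ _ _ dp) _.
apply: (@eq_trans _ _ (partial i (fun z => \sum_a \sum_b
    (D a j z * ((fun x => w x a b) \o F) z) * D b k z) y)).
  apply: partial_near; apply: nbhs_sub (open_nbhs_nbhs (conj oU Uy)) => z Uz.
  rewrite /pull2 mxE exchange_big/=; apply: eq_bigr => b _.
  have trE p q (A : 'M[R]_(p, q)) s t : A^T s t = A t s by rewrite mxE.
  rewrite trE (JD k b Uz) mxE mulr_suml; apply: eq_bigr => a _.
  by rewrite (JD j a Uz).
have dt a b : differentiable (fun z => D a j z * ((fun x => w x a b) \o F) z) y.
  by apply: differentiableM; [exact: (dD a j Uy)|exact: (dcomp (sw' a b) Uy)].
have dt' a b : differentiable (fun z => D a j z * ((fun x => w x a b) \o F) z * D b k z) y.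
  by apply: differentiableM; [exact: dt|exact: (dD b k Uy)].
rewrite partial_sum; last by move=> a; apply: differentiable_sumr => b.
apply: eq_trans _ (@leibniz_sum _ _ _ (fun i j a => partial i (D a j) y) (fun a j => D a j y)
  (fun a b => w (F y) a b) (fun c a b => partial c (fun x => w x a b) (F y)) i j k _).
  apply: eq_bigr => a _; rewrite partial_sum//; apply: eq_bigr => b _.
  apply: eq_trans (partialM _ (dt a b) (dD b k Uy)) _.
  congr (_ + _ * _).
  apply: eq_trans (partialM _ (dD a j Uy) (dcomp (sw' a b) Uy)) _.
  congr (_ * _ + _); exact: pcomp.
by move=> a b; move/matrixP/(_ b a) : (skw _ (FUV Uy)); rewrite !mxE.
Qed.

Lemma closed_pull2 w i j k y : smooth_on V w -> U y ->
  (forall x, V x -> (w x)^T = - w x) ->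
  (forall a b c, partial a w (F y) b c + partial b w (F y) c a + partial c w (F y) a b = 0) ->
  partial i (pull2 w) y j k + partial j (pull2 w) y k i + partial k (pull2 w) y i j = 0.
Proof.
move=> sw Uy skw clw; have dw : differentiable w (F y) by exact: smooth_on_diff sw (FUV Uy).
apply: eq_trans (congr2 +%R (congr2 +%R (partial_pull2 i j k sw Uy skw)
  (partial_pull2 j k i sw Uy skw)) (partial_pull2 k i j sw Uy skw)) _.
apply: (@cyclic_sum0 _ _ _ (fun i j a => partial i (D a j) y) (fun a j => D a j y)
  _ (fun a b => w (F y) a b) (fun c a b => partial c (fun x => w x a b) (F y)) i j k).
  by move=> i' j' a; exact: D_sym.
move=> a b c; apply: eq_trans _ (clw a b c).
exact: esym (congr2 +%R (congr2 +%R (partial_mx a b c dw) (partial_mx b c a dw))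
    (partial_mx c a b dw)).
Qed.

End naturality_of_d.

(** * Local changes of the pulled back form *)

Lemma subr_interchange {V : zmodType} (a b c d : V) : a - b - (c - d) = a - c - (b - d).
Proof. by rewrite !opprD !opprK addrACA. Qed.

Lemma trmx_entry {T : Type} p q (A : 'M[T]_(p, q)) i j : A^T i j = A j i.
Proof. by rewrite mxE. Qed.

Lemma lin_entry {R : pzRingType} p q (a b : R) (A B : 'M[R]_(p, q)) i j :
  (a *: A + b *: B) i j = a * A i j + b * B i j.
Proof. by rewrite !mxE. Qed.

Lemma sub_entry {V : zmodType} p q (A B : 'M[V]_(p, q)) i j : (A - B) i j = A i j - B i j.
Proof. by rewrite !mxE. Qed.

Section local_cohomology.
Context {R : realType} {m n : nat} {M : manifold R m} {N : manifold R n}.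
Implicit Types (f : M -> N) (p : M).

Lemma d_pull1_pull2 (U : set 'rV[R]_m) (V : set 'rV[R]_n) F
    (al : 'rV[R]_n -> 'cV[R]_n) (w : 'rV[R]_n -> 'M[R]_n) i j y :
  open U -> open V -> (forall z, U z -> V (F z)) -> smooth_on U F -> smooth_on V al ->
  (forall x a b, V x -> partial a al x b 0 - partial b al x a 0 = w x a b) -> U y ->
  partial i (pull1 F al) y j 0 - partial j (pull1 F al) y i 0 = pull2 F w y i j.
Proof.
move=> oU oV FUV sF sa da Uy; apply: eq_trans (d_pull1 oU oV FUV sF i j sa Uy) _.
have dF := smooth_on_diff sF Uy; have Vy := FUV y Uy.
rewrite /pull2 mxE exchange_big/=; apply: eq_bigr => a _.
rewrite trmx_entry (jacobianE j a dF) mxE mulr_suml; apply: eq_bigr => b _.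
by rewrite (jacobianE i b dF) (da _ b a Vy).
Qed.

Lemma coord2_skew (a : N -> 'M[R]_n) d y :
  (forall q, (a q)^T = - a q) -> (coord2 a d y)^T = - coord2 a d y.
Proof.
by move=> sk; rewrite /coord2 !trmx_mul trmxK sk mulNmx mulmxN mulmxA.
Qed.

(** The field [sform_closed] concerns only the preferred chart of a point, at that point. Near [y]
    the form in the chart [d] is the pullback of the form in that preferred chart, and closedness
    survives pullback. *)
Lemma sform_closed_chart (omega : symplectic_form N) d y i j k :
  (chart N d @` dom N d) y ->
  partial i (coord2 omega d) y j k + partial j (coord2 omega d) y k i
  + partial k (coord2 omega d) y i j = 0.
Proof.
move=> dy; set q := param N d y; set c := chart_at N q.
have dq : dom N d q by exact: dom_param.
have cq : dom N c q by exact: dom_chart_at.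
have sid := smooth_in_id (@openT N).
set U := chart_set d [set p | [set: N] p /\ dom N c (@id N p)].
set V := chart N c @` dom N c.
have oU : open U := rep_open (@openT N) sid.
have oV : open V by exact: image_open.
have Uy : U y := conj dy (conj I cq).
have [skw sw] := sform_form2 omega.
have FUV z : U z -> V (rep d c (@id N) z) by move=> [_ [_ cz]]; exact: im_chart.
have E z : U z -> coord2 omega d z = pull2 (rep d c (@id N)) (coord2 omega c) z.
  move=> [dz [_ cz]]; have := coord2_transition omega (dom_param dz) cz.
  by rewrite (paramK dz).
have nE : \forall z \near y, coord2 omega d z = pull2 (rep d c (@id N)) (coord2 omega c) z.
  by apply: nbhs_sub (open_nbhs_nbhs (conj oU Uy)) => z; exact: E.
rewrite (partial_near i nE) (partial_near j nE) (partial_near k nE).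
apply: (closed_pull2 oU oV FUV (rep_smooth d c sid) i j k (sw c) Uy).
  by move=> x _; exact: coord2_skew.
by move=> a b e; exact: (sform_closed omega q a b e).
Qed.

Variable omega : symplectic_form N.

(** One primitive on all of [M] is demanded, as coclosedness is tested against global 1-forms. *)
Definition cohomologous f0 f1 := exists2 eta : M -> 'cV[R]_m, smooth1 eta &
  forall p, pullback f1 omega p - pullback f0 omega p = d1 eta p.

Lemma d1_mx (eta : M -> 'cV[R]_m) p i j : d1 eta p i j =
  partial i (coord1 eta (chart_at M p)) (chart M (chart_at M p) p) j 0
  - partial j (coord1 eta (chart_at M p)) (chart M (chart_at M p) p) i 0.
Proof. by rewrite mxE. Qed.

(** A single statement gives both the zero form, for reflexivity, and sums of primitives, for
    transitivity. *)
Lemma smooth1_lin (a b : R) (eta theta : M -> 'cV[R]_m) : smooth1 eta -> smooth1 theta ->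
  smooth1 (fun p => a *: eta p + b *: theta p) /\
  forall p, d1 (fun p => a *: eta p + b *: theta p) p = a *: d1 eta p + b *: d1 theta p.
Proof.
move=> se st; pose u c i y : R := coord1 eta c y i 0; pose v c i y : R := coord1 theta c y i 0.
have E c : coord1 (fun p => a *: eta p + b *: theta p) c =
    (fun y => a *: coord1 eta c y + b *: coord1 theta c y).
  by apply/funext => y; rewrite /coord1 mulmxDr !scalemxAr.
have oI c : open (chart M c @` dom M c) by exact: image_open.
have su c i : smooth_on (chart M c @` dom M c) (u c i) by exact: smooth_on_mx.
have sv c i : smooth_on (chart M c @` dom M c) (v c i) by exact: smooth_on_mx.
have s : smooth1 (fun p => a *: eta p + b *: theta p).
  move=> c k; rewrite E; apply/Ck_mx => // i j.
  apply: (@Ck_ext _ _ _ _ _ (fun y => a * u c i y + b * v c i y)) => //.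
    by move=> y _; rewrite lin_entry (ord1 j).
  apply: CkD => //; apply: CkM => //; try exact: Ck_cstr; [exact: su|exact: sv].
split=> // p; set c := chart_at M p; set y := chart M c p.
have cy : (chart M c @` dom M c) y by apply: im_chart; exact: dom_chart_at.
have P i j : partial i (coord1 (fun p => a *: eta p + b *: theta p) c) y j 0 =
    a * partial i (coord1 eta c) y j 0 + b * partial i (coord1 theta c) y j 0.
  apply: eq_trans (partial_mx _ _ _ (smooth_on_diff (s c) cy)) _.
  apply: eq_trans _ (congr2 (fun s t => a * s + b * t)
    (esym (partial_mx i j 0 (smooth_on_diff (se c) cy)))
    (esym (partial_mx i j 0 (smooth_on_diff (st c) cy)))).
  apply: (@eq_trans _ _ (partial i (fun y => a * u c j y + b * v c j y) y)).
    by congr (partial i _ y); apply/funext => z; rewrite E lin_entry.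
  have du := smooth_on_diff (su c j) cy; have dv := smooth_on_diff (sv c j) cy.
  rewrite partialD; [|by apply: differentiableM => //; exact: differentiable_cst..].
  rewrite partialM//; rewrite partialM//.
  by rewrite !partial_cst !mul0r !addr0.
apply/matrixP => i j; rewrite d1_mx -/c -/y.
apply: eq_trans (congr2 (fun s t => s - t) (P i j) (P j i)) _.
rewrite lin_entry.
apply: eq_trans _ (congr2 (fun s t => a * s + b * t) (esym (d1_mx eta p i j))
  (esym (d1_mx theta p i j))).
by rewrite !mulrBr opprD addrACA.
Qed.

Lemma cohomologous_refl f : cohomologous f f.
Proof.
pose z := (fun=> 0) : M -> 'cV[R]_m.
have sz : smooth1 z.
  move=> c k; apply: (@Ck_ext _ _ _ _ _ (fun=> 0)); [exact: image_open| |].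
    by move=> y _; rewrite /coord1 mulmx0.
  by apply: Ck_cst; exact: image_open.
have [s0 d0] := smooth1_lin 0 0 sz sz.
exists (fun p => 0 *: z p + 0 *: z p); first exact: s0.
by move=> p; apply: eq_trans _ (esym (d0 p)); rewrite !scale0r addr0 subrr.
Qed.

Lemma cohomologous_trans f0 f1 f2 :
  cohomologous f0 f1 -> cohomologous f1 f2 -> cohomologous f0 f2.
Proof.
move=> [eta se de] [theta st dt]; have [s d] := smooth1_lin 1 1 se st.
exists (fun p => 1 *: eta p + 1 *: theta p); first exact: s.
move=> p.
apply: eq_trans _ (esym (d p)); rewrite !scale1r.
apply: eq_trans _ (congr2 +%R (de p) (dt p)).
move: (pullback f0 _ _) (pullback f1 _ _) (pullback f2 _ _) => A B C.
by rewrite [RHS]addrC subrKA.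
Qed.

(* [alpha] is a primitive of [omega] on a coordinate ball containing the images
   of [K], and [eta = f1^* alpha - f0^* alpha] vanishes off [K]. *)
Lemma cohomologous_local f0 f1 (K : set M) d y0 (r : R) :
  smooth_map f0 -> smooth_map f1 -> closed K ->
  (forall p, ~ K p -> f0 p = f1 p) ->
  ball y0 r `<=` chart N d @` dom N d ->
  (forall p, K p -> dom N d (f0 p) /\ ball y0 r (chart N d (f0 p))) ->
  (forall p, K p -> dom N d (f1 p) /\ ball y0 r (chart N d (f1 p))) ->
  cohomologous f0 f1.
Proof.
move=> /smooth_in_setT sf0 /smooth_in_setT sf1 clK f01 Bd K0 K1.
set V := ball y0 r; have oV : open V by exact: ball_open.
have [skw sw] := sform_form2 omega.
have [al [sal dal]] : exists al : 'rV[R]_n -> 'cV[R]_n, smooth_on V al /\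
    forall x a b, V x -> partial a al x b 0 - partial b al x a 0 = coord2 omega d x a b.
  apply: poincare; first by move=> k; exact: Ck_sub (sw d k).
    by move=> y _; exact: coord2_skew.
  by move=> y i j k /Bd; exact: sform_closed_chart.
pose W : set N := [set q | dom N d q /\ V (chart N d q)].
have oW : open W by exact: chart_preimage_open.
have preW f : smooth_in setT f -> open [set p | W (f p)].
  move=> [cf _]; rewrite (_ : [set p | _] = [set p | setT p /\ W (f p)]).
    by apply: open_preimage_in => //; exact: openT.
  by apply/seteqP; split=> p //= [].
pose Om := [set p | W (f0 p)] `&` [set p | W (f1 p)].
have oO : open Om by apply: openI; exact: preW.
have KO : K `<=` Om by move=> p Kp; split; [exact: K0|exact: K1].
have oK : open (~` K) by rewrite openC.
pose A f c := pull1 (rep c d f) al.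
(* Components at [p] refer to the preferred chart at [p]; by [AE] they become, in any chart [c],
   those of the coordinate pullbacks of [al]. *)
pose eta (p : M) : 'cV[R]_m := if `[< Om p >] then
  A f1 (chart_at M p) (chart M (chart_at M p) p)
  - A f0 (chart_at M p) (chart M (chart_at M p) p) else 0.
have AE f c p : smooth_in setT f -> W (f p) -> dom M c p ->
    coord_change c (chart M c p) *m A f (chart_at M p) (chart M (chart_at M p) p) =
    A f c (chart M c p).
  move=> sf [dp _] cp; have ep := dom_chart_at p.
  rewrite /A /pull1 mulmxA (coord_changeE cp).
  rewrite -(jacobian_rep_comp (smooth_in_id (@openT M)) sf (@openT M) I I cp ep dp).
  congr (_ *m al _); apply: (eq_trans (_ : _ = chart N d (f p))).
    by rewrite /rep (chartK ep).
  by rewrite /rep (chartK cp).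
have coordE c y : chart_set c Om y -> coord1 eta c y = A f1 c y - A f0 c y.
  move=> [cy Oy]; have [W0 W1] := Oy; have cp := dom_param cy.
  rewrite /coord1 /eta; case: asboolP => // _.
  have E0 := AE f0 c _ sf0 W0 cp; have E1 := AE f1 c _ sf1 W1 cp.
  rewrite (paramK cy) in E0 E1.
  by rewrite mulmxBr E0 E1.
have near01 c y : chart_set c (~` K) y -> \forall z \near y, rep c d f0 z = rep c d f1 z.
  move=> Ky; apply: nbhs_sub (open_nbhs_nbhs (conj (chart_set_open c oK) Ky)) => z [cz Kz].
  by rewrite /rep (f01 _ Kz).
(* Off [K] the two maps agree, so [eta] vanishes there even inside [Om]; this makes the extension by
   zero seamless. *)
have coord0 c y : chart_set c (~` K) y -> coord1 eta c y = 0.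
  move=> Ky; have [cy Kp] := Ky; have [Op|nOp] := pselect (Om (param M c y)).
    rewrite coordE; last by split.
    have [[d0 _] [d1 _]] := Op.
    have := @rep_diff _ _ _ _ _ _ _ c d _ sf0 I (dom_param cy) d0.
    rewrite (paramK cy) => dr.
    have EJ := jacobian_near (near01 c y Ky) dr.
    have Er : rep c d f0 y = rep c d f1 y by rewrite /rep (f01 _ Kp).
    have EA : A f1 c y = A f0 c y := esym (congr2 (fun J x => J *m al x) EJ Er).
    by rewrite EA subrr.
  rewrite /coord1 /eta; case: asboolP => // _.
  exact: mulmx0.
have smO c f : smooth_in setT f -> (forall p, Om p -> W (f p)) ->
    [/\ open (chart_set c Om), (forall z, chart_set c Om z -> V (rep c d f z)) &
        smooth_on (chart_set c Om) (rep c d f)].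
  move=> sf OW; split; first exact: chart_set_open.
    by move=> z [_ /OW[]].
  move=> k; apply: Ck_sub (rep_smooth c d sf k) => z [cz /OW[dz _]].
  by split.
have OW0 p : Om p -> W (f0 p) by case.
have OW1 p : Om p -> W (f1 p) by case.
have smA c f : smooth_in setT f -> (forall p, Om p -> W (f p)) ->
    smooth_on (chart_set c Om) (A f c).
  move=> sf OW; have [oU UV sF] := smO c f sf OW. exact (pull1_smooth oU oV UV sF sal).
have smB c i j : smooth_on (chart_set c Om) (fun y => A f1 c y i j - A f0 c y i j).
  move=> k; have oU := chart_set_open c oO.
  by apply: CkB => //; [exact: (smooth_on_mx _ _ oU (smA c f1 sf1 OW1))|
    exact: (smooth_on_mx _ _ oU (smA c f0 sf0 OW0))].
exists eta.
  (* The open set [Om] and the complement of [K] cover [M], with one formula for [eta] on each. *)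
  move=> c k; apply: Ck_pointwise => y cy.
  have [Op|nOp] := pselect (Om (param M c y)).
    have Uy : chart_set c Om y by split.
    have oU := chart_set_open c oO.
    suff : Ck k (chart_set c Om) (coord1 eta c) by apply: Ck_sub => _ ->.
    apply/(Ck_mx _ _ oU) => i j; apply: Ck_ext (smB c i j k) => // z /coordE ->.
    by rewrite sub_entry.
  have Uy : chart_set c (~` K) y by split=> //= /KO.
  have oU := chart_set_open c oK.
  suff : Ck k (chart_set c (~` K)) (coord1 eta c) by apply: Ck_sub => _ ->.
  by apply: Ck_ext (Ck_cst k 0 oU) => // z /coord0 ->.
move=> p; set c := chart_at M p; set y := chart M c p.
have cp : dom M c p by exact: dom_chart_at.
have cy : (chart M c @` dom M c) y by exact: im_chart.
(* On [Om], [d] commutes with pullback and [d al] is [omega]; off [Om], hence off [K], both sides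
   vanish because the maps agree near [p]. *)
have [Op|nOp] := pselect (Om p).
  have [[dp0 _] [dp1 _]] := Op.
  have Uy : chart_set c Om y by split=> //; rewrite /y (chartK cp).
  have oU := chart_set_open c oO.
  rewrite (pullbackE omega (@openT M) sf0 I dp0) (pullbackE omega (@openT M) sf1 I dp1).
  have yE f : rep c d f y = chart N d (f p) by rewrite /rep /y (chartK cp).
  have dA f : smooth_in setT f -> (forall p, Om p -> W (f p)) ->
      forall i j, partial i (A f c) y j 0 - partial j (A f c) y i 0 =
        ('J (rep c d f) y *m coord2 omega d (chart N d (f p)) *m ('J (rep c d f) y)^T) i j.
    move=> sf OW i j; have [_ UV sF] := smO c f sf OW.
    by rewrite -yE; exact: d_pull1_pull2 oU oV UV sF sal dal Uy.
  have pE i j : partial i (coord1 eta c) y j 0 =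
      partial i (A f1 c) y j 0 - partial i (A f0 c) y j 0.
    have nE : \forall z \near y, A f1 c z - A f0 c z = coord1 eta c z.
      by apply: nbhs_sub (open_nbhs_nbhs (conj oU Uy)) => z /coordE ->.
    have dd0 := smooth_on_diff (smA c f0 sf0 OW0) Uy.
    have dd1 := smooth_on_diff (smA c f1 sf1 OW1) Uy.
    have ddB : differentiable (fun z => A f1 c z - A f0 c z) y.
      by apply: differentiableB.
    rewrite -(partial_near i nE).
    apply: eq_trans (partial_mx i j 0 ddB) _.
    apply: eq_trans _ (congr2 (fun s t => s - t) (esym (partial_mx i j 0 dd1))
      (esym (partial_mx i j 0 dd0))).
    rewrite -partialB; [|exact: differentiable_mxE..].
    by congr (partial i _ y); apply/funext => z; rewrite sub_entry.
  apply/matrixP => i j; rewrite d1_mx -/c -/y.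
  apply: eq_trans _ (congr2 (fun s t => s - t) (esym (pE i j)) (esym (pE j i))).
  rewrite sub_entry; apply: eq_trans (congr2 (fun s t => s - t) (esym (dA f1 sf1 OW1 i j))
    (esym (dA f0 sf0 OW0 i j))) _.
  exact: subr_interchange.
have nK : ~ K p by move=> /KO.
have Uy : chart_set c (~` K) y by split=> //=; rewrite /y (chartK cp).
have oU := chart_set_open c oK.
have E01 := f01 p nK.
set d' := chart_at N (f0 p).
have dp0 : dom N d' (f0 p) by exact: dom_chart_at.
have dp1 : dom N d' (f1 p) by rewrite -E01.
rewrite (pullbackE omega (@openT M) sf0 I dp0) (pullbackE omega (@openT M) sf1 I dp1).
have n01 : \forall z \near y, rep c d' f0 z = rep c d' f1 z.
  by apply: nbhs_sub (open_nbhs_nbhs (conj oU Uy)) => z [cz Kz]; rewrite /rep (f01 _ Kz).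
rewrite -(jacobian_near n01 (@rep_diff _ _ _ _ _ _ _ c d' p sf0 I cp dp0)) -E01 subrr.
have nE : \forall z \near y, coord1 eta c z = 0.
  by apply: nbhs_sub (open_nbhs_nbhs (conj oU Uy)) => z /coord0.
have p0 i j : partial i (coord1 eta c) y j 0 = 0.
  have -> : partial i (coord1 eta c) y = partial i (fun=> 0) y by exact: partial_near.
  have d0 : differentiable ((fun=> 0) : 'rV[R]_m -> 'cV[R]_m) y by exact: differentiable_cst.
  apply: eq_trans (partial_mx i j 0 d0) _; rewrite -[RHS](partial_cst i 0 y).
  by congr (partial i _ y); apply/funext => z; rewrite mxE.
apply/matrixP => i j; rewrite d1_mx -/c -/y.
apply: eq_trans _ (congr2 (fun s t => s - t) (esym (p0 i j)) (esym (p0 j i))).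
by rewrite mxE subrr.
Qed.

End local_cohomology.

(** * Homotopy invariance *)

Lemma compact_seq_cover (T : ptopologicalType) (K : set T) (O : T -> set T) :
  compact K -> (forall x, K x -> open (O x) /\ O x x) ->
  exists s : seq T, (forall x, x \in s -> K x) /\
    forall p, K p -> exists2 x, x \in s & O x p.
Proof.
rewrite compact_cover => cK oO.
have [||D DK cov] := cK T K O; first by move=> x /oO[].
  by move=> x Kx; exists x => //; have [] := oO x Kx.
exists (finmap.enum_fset D); split=> [x xD|p /cov[x xD Oxp]]; last by exists x.
by have := DK x xD; rewrite inE.
Qed.

Lemma convex_dist_lt {R : realType} (V : normedModType R) (a b c : V) (t e : R) :
  0 <= t <= 1 -> `|a - b| < e -> `|a - c| < e -> `|a - ((1 - t) *: b + t *: c)| < e.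
Proof.
move=> /andP[t0 t1] ab ac.
have -> : a - ((1 - t) *: b + t *: c) = (1 - t) *: (a - b) + t *: (a - c).
  by rewrite !scalerBr addrACA -scalerDl subrK scale1r opprD.
have s0 : 0 <= 1 - t by rewrite subr_ge0.
rewrite (le_lt_trans (ler_normD _ _))// !normrZ (ger0_norm t0) (ger0_norm s0).
(* Strictness comes from the first term when [t = 0] and from the second otherwise. *)
have [t_eq0|tn0] := eqVneq t 0; first by rewrite t_eq0 mul0r addr0 subr0 mul1r.
have tp : 0 < t by rewrite lt_neqAle eq_sym tn0.
have -> : e = (1 - t) * e + t * e by rewrite -mulrDl subrK mul1r.
by rewrite ler_ltD// ?ltr_pM2l// ler_wpM2l// ltW.
Qed.

(** * Uniform approximation of continuous vector-valued functions *)

Section smooth_approximation.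
Context {R : realType} {m n : nat} (M : manifold R m).

(** Constants [u x] are blended in one at a time, with bumps supported where [u] is within [e] of
    [u x]. The vectors within [e] of [u p] form a convex set, so no step spoils a point already
    treated and [e] never degrades. *)
Lemma sfun_approx (u : M -> 'rV[R]_n) (K G : set M) (e : R) : 0 < e ->
  compact K -> open G -> K `<=` G -> (forall p, G p -> {for p, continuous u}) ->
  exists g : M -> 'rV[R]_n, sfun setT g /\ forall p, K p -> `|u p - g p| < e.
Proof.
move=> e0 cK oG KG cu.
(* The guard [G x0] makes the statement true at all points, as [choice] requires a total
   selection. *)
have data x0 : exists co : (M -> R) * set M, G x0 ->
    [/\ sfun setT co.1, (forall p, 0 <= co.1 p <= 1),
      (forall p, co.1 p != 0 -> `|u p - u x0| < e),
      open co.2 /\ co.2 x0 & forall p, co.2 p -> co.1 p = 1].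
  have [Gx|nGx] := pselect (G x0); last by exists (fun=> 0, setT).
  have oU : open [set p | G p /\ ball (u x0) e (u p)].
    by apply: open_preimage_in => //; exact: ball_open.
  have [|chi [S [sc c01 _ SU [cS [Q [opQ Qx Q1]]]]]] := manifold_bump oU (p0 := x0).
    by split=> //; exact: ballxx.
  exists (chi, Q) => _; split=> // p /cS/SU[_].
  by rewrite -ball_normE/= distrC.
have /choice[D DP] := data.
have [s [sK cov]] : exists s : seq M, (forall x, x \in s -> K x) /\
    forall p, K p -> exists2 x, x \in s & (D x).2 p.
  by apply: compact_seq_cover => // x /KG/DP[].
suff H (s' : seq M) : (forall x, x \in s' -> K x) -> exists g : M -> 'rV[R]_n, sfun setT g /\
    forall p, (exists2 x, x \in s' & (D x).2 p) -> `|u p - g p| < e.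
  by have [g [sg gP]] := H s sK; exists g; split=> // p /cov/gP.
elim: s' => [|x s' IH] sK'.
  exists (fun=> 0); split; first by apply: sfun_cst; exact: openT.
  by move=> p [x].
have [|g [sg gP]] := IH; first by move=> z zs; apply: sK'; rewrite inE zs orbT.
have [sc c01 cu' _ c1] := DP x (KG _ (sK' x (mem_head _ _))).
exists (fun p => (1 - (D x).1 p) *: g p + (D x).1 p *: u x); split.
  by apply: sfun_convex => //; [exact: openT|apply: sfun_cst; exact: openT].
move=> p [z]; rewrite inE => /predU1P[->|zs] Op.
  by rewrite (c1 p Op) subrr scale0r add0r scale1r cu'// c1// oner_neq0.
have gp : `|u p - g p| < e by apply: gP; exists z.
have [c0|cn0] := eqVneq ((D x).1 p) 0; first by rewrite c0 subr0 scale1r scale0r addr0.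
by apply: convex_dist_lt => //; exact: cu'.
Qed.

End smooth_approximation.

(** * Tubes around graphs and modification of maps over coordinate patches *)

Section deformation.
Context {R : realType} {m n : nat} {M : manifold R m} {N : manifold R n}.
Implicit Types (f h : M -> N) (W : set (M * N)).

(** Uniform closeness to [h] without a metric on the target. *)
Definition graph_nbhs W h := open W /\ forall p, W (p, h p).

(* A coordinate ball [ball center radius] of [N] in which a map will be modified
   over [supp] with the cut-off function [cutoff], equal to 1 on [core]. *)
Record patch := Patch {
  cutoff : M -> R;
  supp : set M;
  core : set M;
  patch_chart : Defs.index N;
  center : 'rV[R]_n;
  radius : R
}.

(** Sending [supp] into a ball of the chart serves twice: balls are convex, so interpolations stay
    inside, and [omega] has a primitive on them. *)
Definition adapted h (P : patch) :=
  [/\ sfun setT (cutoff P) /\ (forall p, 0 <= cutoff P p <= 1),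
    compact (supp P) /\ closed (supp P),
    (forall p, cutoff P p != 0 -> supp P p),
    open (core P) /\ (forall p, core P p -> cutoff P p = 1) &
    ball (center P) (radius P) `<=` chart N (patch_chart P) @` dom N (patch_chart P) /\
    forall p, supp P p -> dom N (patch_chart P) (h p) /\
      ball (center P) (radius P) (chart N (patch_chart P) (h p))].

Definition blend (P : patch) f (g : M -> 'rV[R]_n) (p : M) : 'rV[R]_n :=
  (1 - cutoff P p) *: chart N (patch_chart P) (f p) + cutoff P p *: g p.

(** Where the cutoff vanishes and [f p] is in the chart domain both branches give [f p], so no seam
    appears along the boundary of [supp]. *)
Definition modify (P : patch) f (g : M -> 'rV[R]_n) (p : M) : N :=
  if `[< supp P p >] then param N (patch_chart P) (blend P f g p) else f p.

Lemma modify_supp P f g p : supp P p ->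
  modify P f g p = param N (patch_chart P) (blend P f g p).
Proof. by move=> Kp; rewrite /modify; case: asboolP. Qed.

Lemma modify_off P f g p : ~ supp P p -> modify P f g p = f p.
Proof. by move=> Kp; rewrite /modify; case: asboolP. Qed.

(** Near each point of the compact [supp P] some distance in the chart works; compactness, applied
    with the filter of small positive radii, yields a common one. *)
Lemma uniform_tube (P : patch) h W : continuous h -> adapted h P -> graph_nbhs W h ->
  exists2 dl : R, 0 < dl & forall p z, supp P p ->
    `|chart N (patch_chart P) (h p) - z| < dl ->
    ball (center P) (radius P) z /\ W (p, param N (patch_chart P) z).
Proof.
move=> ch [_ [cK clK] _ _ [Bd hB]] [opW Wh]; set d := patch_chart P in Bd hB *.
set B := ball _ _ in Bd hB *; pose u p := chart N d (h p).
have cu p : supp P p -> {for p, continuous u}.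
  move=> /hB[dp _]; apply: (@continuous_comp _ _ _ h (chart N d)); first exact: ch.
  exact: chart_continuous.
have /compact_near_coveringP/(_ _ (0 : R)^'+
  (fun dl p => supp P p -> forall z, `|u p - z| < dl -> B z /\ W (p, param N d z)))
  := cK.
case=> [p0 Kp0|e /= e0 eP]; last first.
  exists (e / 2); first by rewrite divr_gt0.
  move=> p z Kp; apply: (eP (e / 2)) => //=; last by rewrite divr_gt0.
  by rewrite sub0r normrN ger0_norm ?divr_ge0 ?ltW// gtr_pMr// invf_lt1// ltr1n.
have [dp0 Bp0] := hB p0 Kp0.
have oV : open [set pz : M * 'rV[R]_n | B pz.2 /\ W (pz.1, param N d pz.2)].
  apply: (@open_preimage_in _ _ (fun pz : M * 'rV[R]_n => (pz.1, param N d pz.2))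
    [set pz | B pz.2] W) => //.
    apply: open_comp; last exact: ball_open.
    by move=> x _; exact: cvg_snd.
  move=> [p z] /= Bz; apply: cvg_pair; first exact: cvg_fst.
  apply: (@cvg_comp _ _ _ snd (param N d) _ (nbhs z)); first exact: cvg_snd.
  by apply: param_continuous; exact: Bd.
have V0 : [set pz : M * 'rV[R]_n | B pz.2 /\ W (pz.1, param N d pz.2)] (p0, u p0).
  by split=> //=; rewrite /u chartK//; exact: Wh.
have [[Q1 Q2] [/= nQ1 nQ2] QV] := open_nbhs_nbhs (conj oV V0).
move: nQ2 => /nbhs_ballP[e /= e0 eQ].
have e20 : 0 < e / 2 by rewrite divr_gt0.
have nu : \forall p \near p0, `|u p0 - u p| < e / 2.
  by move/cvgrPdist_lt : (cu p0 Kp0) => /(_ _ e20).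
have ne : \forall dl \near (0 : R)^'+, dl < e / 2 by exact: nbhs_right_lt.
exists ([set p | Q1 p /\ `|u p0 - u p| < e / 2], [set dl | dl < e / 2]) => /=.
  by split=> //; exact: filterI.
move=> [p dl] /= [[Q1p up] dle] Kp z zu.
have : ball (u p0) e z.
  rewrite -ball_normE/= (splitr e) -(subrKA (u p)) (le_lt_trans (ler_normD _ _))//.
  by rewrite ltrD// (lt_trans zu).
by move=> /eQ Q2z; exact: (QV (p, z)).
Qed.

(** [W'] adds to [W] the demand of being [dl]-close in the chart, over [supp P] only; it stays open
    because [supp P] is closed. *)
Lemma modify_tube (P : patch) h W : continuous h -> adapted h P -> graph_nbhs W h ->
  exists W' (dl : R), [/\ 0 < dl, graph_nbhs W' h, W' `<=` W,
    (forall p q, W' (p, q) -> supp P p -> dom N (patch_chart P) q /\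
      `|chart N (patch_chart P) (h p) - chart N (patch_chart P) q| < dl) &
    forall p z, supp P p -> `|chart N (patch_chart P) (h p) - z| < dl ->
      ball (center P) (radius P) z /\ W (p, param N (patch_chart P) z)].
Proof.
move=> ch aP nW; have [dl dl0 dlP] := uniform_tube ch aP nW.
have [_ [_ clK] _ _ [Bd hB]] := aP; set d := patch_chart P in Bd hB dlP *.
have [opW Wh] := nW.
pose D : set (M * N) := [set pq | dom N d (h pq.1) /\ dom N d pq.2].
pose F (pq : M * N) := chart N d (h pq.1) - chart N d pq.2.
pose A : set (M * N) := [set pq | D pq /\ ball 0 dl (F pq)].
pose W' := W `&` ([set pq | ~ supp P pq.1] `|` A).
have oD : open D.
  apply: (@open_preimage_in _ _ snd [set pq : M * N | dom N d (h pq.1)]).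
  - apply: (@open_comp _ _ (fun pq : M * N => h pq.1)); last exact: dom_open.
    by move=> x _; apply: (@continuous_comp _ _ _ fst h); [exact: cvg_fst|exact: ch].
  - by move=> x _; exact: cvg_snd.
  - exact: dom_open.
have cF pq : D pq -> {for pq, continuous F}.
  case: pq => p q [/= dp dq]; apply: cvgB.
    apply: (@continuous_comp _ _ _ (fun pq : M * N => h pq.1) (chart N d)).
      by apply: (@continuous_comp _ _ _ fst h); [exact: cvg_fst|exact: ch].
    exact: chart_continuous.
  apply: (@continuous_comp _ _ _ snd (chart N d)); first exact: cvg_snd.
  exact: chart_continuous.
have oA : open A by apply: (open_preimage_in oD cF); exact: ball_open.
exists W', dl; split => //.
- split.
    apply: openI => //; apply: openU => //.
    apply: (@open_comp _ _ fst (~` supp P)); last by rewrite openC.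
    by move=> x _; exact: cvg_fst.
  move=> p; split; first exact: Wh.
  have [Kp|nKp] := pselect (supp P p); last by left.
  have [dp _] := hB p Kp; right; split => //.
  by rewrite /F/= subrr; exact: ballxx.
- by move=> x [].
- move=> p q [_ [//|[[_ dq]]]] + Kp; rewrite -ball_normE/= sub0r normrN.
  by split.
Qed.

Lemma blend_sfun (P : patch) f g Om : sfun setT (cutoff P) -> open Om -> smooth_in Om f ->
  (forall p, Om p -> dom N (patch_chart P) (f p)) -> sfun Om g ->
  sfun Om (blend P f g).
Proof.
move=> sc oO sf fd sg; apply: sfun_convex => //; first exact: sfun_sub sc.
exact: smooth_in_chart.
Qed.

Section modification.
Variables (P : patch) (h f : M -> N) (g : M -> 'rV[R]_n) (G : set M).
Hypotheses (aP : adapted h P) (cf : continuous f) (oG : open G).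
Hypotheses (KG : supp P `<=` G) (sg : sfun G g).
Hypothesis fd : forall p, supp P p -> dom N (patch_chart P) (f p).
Hypothesis bB : forall p, supp P p -> ball (center P) (radius P) (blend P f g p).

Let d := patch_chart P.
Let B := ball (center P) (radius P).
Let Om0 : set M := [set p | G p /\ dom N d (f p)].
Let Om1 : set M := [set p | Om0 p /\ B (blend P f g p)].

Let oOm0 : open Om0.
Proof. by apply: open_preimage_in => //; [move=> p _; exact: cf|exact: dom_open]. Qed.

Let cblend p : Om0 p -> {for p, continuous (blend P f g)}.
Proof.
move=> [Gp dp]; have [[sc _] _ _ _ _] := aP.
have cc : {for p, continuous (cutoff P)} by apply: sfun_continuous sc _ => //; exact: openT.
apply: cvgD; apply: cvgZ.
- by apply: cvgB => //; exact: cvg_cst.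
- by apply: (@continuous_comp _ _ _ f (chart N d)); [exact: cf|exact: chart_continuous].
- exact: cc.
- exact: sfun_continuous sg Gp.
Qed.

Let oOm1 : open Om1.
Proof. by apply: (open_preimage_in oOm0 cblend); exact: ball_open. Qed.

Let KOm1 : supp P `<=` Om1.
Proof. by move=> p Kp; split; [split; [exact: KG|exact: fd]|exact: bB]. Qed.

(** Outside [supp P] the cutoff is zero and the interpolation returns [f] as long as [f] is in the
    chart. Hence one formula holds on the open set [Om1], which together with the complement of
    [supp P] covers [M]. *)
Let modE p : Om1 p -> modify P f g p = param N d (blend P f g p).
Proof.
move=> [[Gp dp] _]; have [Kp|nKp] := pselect (supp P p); first exact: modify_supp.
have [_ _ cK _ _] := aP; rewrite modify_off//.
have c0 : cutoff P p = 0 by apply: contrapT => /eqP/cK.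
by rewrite /blend c0 subr0 scale1r scale0r addr0 chartK.
Qed.

Let Bim p : Om1 p -> (chart N d @` dom N d) (blend P f g p).
Proof. by move=> [_ Bp]; have [_ _ _ _ [Bd _]] := aP; exact: Bd. Qed.

Lemma modify_chart p : supp P p -> dom N d (modify P f g p) /\
  chart N d (modify P f g p) = blend P f g p.
Proof.
move=> Kp; rewrite modify_supp//; have im := Bim (KOm1 Kp).
by split; [exact: dom_param|exact: paramK].
Qed.

Lemma modify_continuous : continuous (modify P f g).
Proof.
move=> p; have [Op|nOp] := pselect (Om1 p).
  have nE : \forall q \near p, param N d (blend P f g q) = modify P f g q.
    by apply: nbhs_sub (open_nbhs_nbhs (conj oOm1 Op)) => q /modE.
  rewrite /continuous_at -(nbhs_singleton nE).
  apply: cvg_trans (near_eq_cvg nE) _.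
  apply: (@continuous_comp _ _ _ (blend P f g) (param N d)).
    by apply: cblend; have [] := Op.
  by apply: param_continuous; exact: Bim.
have [_ [_ clK] _ _ _] := aP.
have oK : open (~` supp P) by rewrite openC.
have nK : (~` supp P) p by move=> /KOm1.
have nE : \forall q \near p, f q = modify P f g q.
  by apply: nbhs_sub (open_nbhs_nbhs (conj oK nK)) => q nKq; rewrite modify_off.
rewrite /continuous_at -(nbhs_singleton nE).
by apply: cvg_trans (near_eq_cvg nE) _; exact: cf.
Qed.

Lemma modify_smooth Om : open Om -> smooth_in Om f -> smooth_in Om (modify P f g).
Proof.
move=> oO sf; have [[sc _] [_ clK] _ _ _] := aP.
have oK : open (~` supp P) by rewrite openC.
apply: smooth_in_local => p Op; have [Op1|nOp] := pselect (Om1 p).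
  exists (Om `&` Om1) => //; have oI := openI oO oOm1.
  apply: (@smooth_in_ext _ _ _ _ _ _ (param N d \o blend P f g)) => //.
    by move=> q [_ /modE].
  apply: smooth_in_param => //; first by move=> q [_ /Bim].
  apply: blend_sfun => //.
  - by apply: smooth_in_sub sf => q [].
  - by move=> q [_ [[]]].
  - by apply: sfun_sub sg => q [_ [[]]].
exists (Om `&` ~` supp P); first by split=> // /KOm1.
apply: (@smooth_in_ext _ _ _ _ _ _ f); first exact: openI.
  by move=> q [_ nKq]; rewrite modify_off.
by apply: smooth_in_sub sf => q [].
Qed.

(** The cutoff is 1 on the core, so the result there is [g] read through the chart, however rough
    [f] is. *)
Lemma modify_smooth_core : smooth_in (core P) (modify P f g).
Proof.
have [_ _ cK [opC C1] _] := aP.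
have CK p : core P p -> supp P p by move=> Cp; apply: cK; rewrite C1// oner_neq0.
have E p : core P p -> blend P f g p = g p.
  by move=> Cp; rewrite /blend C1// subrr scale0r add0r scale1r.
apply: (@smooth_in_ext _ _ _ _ _ _ (param N d \o g)) => //.
  by move=> p Cp; rewrite modify_supp ?E//; exact: CK.
apply: smooth_in_param => //.
  by move=> p Cp; rewrite -E//; apply: Bim; apply: KOm1; exact: CK.
by apply: sfun_sub sg => p /CK/KG.
Qed.

End modification.

(** By convexity, the blend of two values [dl]-close to [h] in the chart is [dl]-close again, and
    [dl] was chosen so that this suffices for [W]. *)
Lemma modify_graph P h f g W W' (dl : R) : adapted h P -> W' `<=` W ->
  (forall p q, W' (p, q) -> supp P p -> dom N (patch_chart P) q /\
      `|chart N (patch_chart P) (h p) - chart N (patch_chart P) q| < dl) ->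
  (forall p z, supp P p -> `|chart N (patch_chart P) (h p) - z| < dl ->
      ball (center P) (radius P) z /\ W (p, param N (patch_chart P) z)) ->
  (forall p, W' (p, f p)) ->
  (forall p, supp P p -> `|chart N (patch_chart P) (h p) - g p| < dl) ->
  (forall p, supp P p -> ball (center P) (radius P) (blend P f g p)) /\
  (forall p, W (p, modify P f g p)).
Proof.
move=> aP W'W nearW' tube fW' gh; have [[_ c01] _ _ _ _] := aP.
have bl p : supp P p -> `|chart N (patch_chart P) (h p) - blend P f g p| < dl.
  move=> Kp; have [_ fh] := nearW' p _ (fW' p) Kp.
  by apply: convex_dist_lt => //; exact: gh.
split=> [p Kp|p]; first exact: (tube p _ Kp (bl p Kp)).1.
have [Kp|nKp] := pselect (supp P p); last by rewrite modify_off//; exact/W'W/fW'.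
by rewrite modify_supp//; exact: (tube p _ Kp (bl p Kp)).2.
Qed.

Fixpoint all_adapted h (l : seq patch) : Prop :=
  if l is P :: l' then adapted h P /\ all_adapted h l' else True.

Fixpoint cores (l : seq patch) : set M :=
  if l is P :: l' then core P `|` cores l' else set0.

Lemma adapted_cover h : compact [set: M] -> continuous h ->
  exists2 l, all_adapted h l & cores l = setT.
Proof.
move=> cM ch.
have data x0 : exists P : patch, adapted h P /\ core P x0.
  set d := chart_at N (h x0); have dx : dom N d (h x0) by exact: dom_chart_at.
  have /nbhs_ballP[r /= r0 Br] := open_nbhs_nbhs (conj (@image_open _ _ N d) (im_chart dx)).
  set B := ball (chart N d (h x0)) r in Br.
  have oV : open [set q | dom N d q /\ B (chart N d q)].
    by apply: chart_preimage_open; exact: ball_open.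
  have oU : open [set p | dom N d (h p) /\ B (chart N d (h p))].
    by apply: (@open_comp _ _ h) oV => p _; exact: ch.
  have [|chi [K [sc c01 cK KU [cS [Q [opQ Qx Q1]]]]]] := manifold_bump oU (p0 := x0).
    by split=> //; exact: ballxx.
  by exists (Patch chi K Q d (chart N d (h x0)) r); split.
have /choice[D DP] := data.
have [s [_ cov]] : exists s : seq M, (forall x, x \in s -> setT x) /\
    forall p, setT p -> exists2 x, x \in s & core (D x) p.
  apply: compact_seq_cover => // x _; have [[_ _ _ [opC _] _] Cx] := DP x.
  by split.
exists (map D s).
  by elim: s {cov} => //= x s IH; split=> //; exact: (DP x).1.
apply/seteqP; split=> // p _; have [x xs Cx] := cov p I.
elim: s xs {cov} => //= y s IH; rewrite inE => /predU1P[<-|/IH]; first by left.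
by right.
Qed.

(** Each patch replaces the coordinates of [f] on its core by a smooth approximation of those of [h]
    and keeps smoothness where it was present, so the domain of smoothness grows by one core per
    patch. *)
Lemma dense_smooth_step h l W : continuous h -> all_adapted h l -> graph_nbhs W h ->
  exists W0, graph_nbhs W0 h /\ forall Om f, open Om -> continuous f -> smooth_in Om f ->
    (forall p, W0 (p, f p)) ->
    exists f', [/\ continuous f', smooth_in (Om `|` cores l) f' & forall p, W (p, f' p)].
Proof.
move=> ch; elim: l W => [|P l IH] W /=.
  move=> _ nW; exists W; split=> // Om f oO cf sf fW; exists f; split=> //.
  by rewrite setU0.
move=> [aP al] nW; have [W1 [nW1 W1P]] := IH W al nW.
have [W' [dl [dl0 nW' W'W nearW' tube]]] := modify_tube ch aP nW1.
exists W'; split=> // Om f oO cf sf fW'.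
have [[sc c01] [cK clK] cs [opC C1] [Bd hB]] := aP.
have [g [sg gP]] : exists g : M -> 'rV[R]_n, sfun setT g /\
    forall p, supp P p -> `|(chart N (patch_chart P) \o h) p - g p| < dl.
  have oD : open [set p | dom N (patch_chart P) (h p)].
    by apply: (@open_comp _ _ h); [move=> p _; exact: ch|exact: dom_open].
  apply: (sfun_approx dl0 cK oD) => [p /hB[]//|p dp].
  by apply: continuous_comp; [exact: ch|exact: chart_continuous].
have [bB mW] := modify_graph aP W'W nearW' tube fW' gP.
have fd p : supp P p -> dom N (patch_chart P) (f p).
  by move=> Kp; have [] := nearW' p _ (fW' p) Kp.
have KT : supp P `<=` setT by [].
have [|||f' [cf' sf' f'W]] := W1P (Om `|` core P) (modify P f g) _ _ _ mW.
- exact: openU.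
- exact: modify_continuous aP cf openT KT sg fd bB.
- apply: smooth_in_local => p [Op|Cp].
    by exists Om => //; exact: (modify_smooth aP cf openT KT sg fd bB oO sf).
  by exists (core P) => //; exact: (modify_smooth_core aP KT sg fd bB).
by exists f'; split=> //; rewrite setUA.
Qed.

Lemma smooth_dense h W : compact [set: M] -> continuous h -> graph_nbhs W h ->
  exists2 f, smooth_map f & forall p, W (p, f p).
Proof.
move=> cM ch nW; have [l al lT] := adapted_cover cM ch.
have [W0 [nW0 W0P]] := dense_smooth_step ch al nW.
have s0 : smooth_in set0 h.
  by apply: smooth_in_local.
have [f [cf sf fW]] := W0P set0 h open0 ch s0 nW0.2.
by exists f => //; apply/smooth_in_setT; move: sf; rewrite lT setUT.
Qed.

(** * Cohomology of nearby maps and of homotopic maps *)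

Variable omega : symplectic_form N.

(* The tubes are chosen from the last patch backwards, so that each intermediate
   map stays in the tube needed for the remaining patches. *)
Lemma near_cohomologous_step h l : continuous h -> all_adapted h l ->
  exists W, graph_nbhs W h /\ forall f0 f1, smooth_map f0 -> smooth_map f1 ->
    (forall p, W (p, f0 p)) -> (forall p, W (p, f1 p)) ->
    exists f, [/\ smooth_map f, cohomologous omega f0 f &
      forall p, f0 p = f1 p \/ cores l p -> f p = f1 p].
Proof.
move=> ch; elim: l => [|P l IH] /=.
  move=> _; exists setT; split; first by split; [exact: openT|].
  move=> f0 f1 sf0 sf1 _ _; exists f0; split=> //; first exact: cohomologous_refl.
  by move=> p [].
move=> [aP al]; have [W1 [nW1 W1P]] := IH al.
have [W' [dl [dl0 nW' W'W nearW' tube]]] := modify_tube ch aP nW1.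
exists W'; split=> // f0 f1 sf0 sf1 f0W f1W.
have [[sc c01] [cK clK] cs [opC C1] [Bd hB]] := aP.
set d := patch_chart P in nearW' tube Bd hB *.
(* [f0] is pulled towards [f1] itself, whose coordinates make sense on [G]. *)
pose g := chart N d \o f1; pose G := [set p | [set: M] p /\ dom N d (f1 p)].
have si0 := (smooth_in_setT f0).1 sf0; have si1 := (smooth_in_setT f1).1 sf1.
have oG : open G by exact: smooth_in_open openT si1.
have sg : sfun G g by exact: (si1.2 d).
have gP p : supp P p -> `|chart N d (h p) - g p| < dl.
  by move=> Kp; have [] := nearW' p _ (f1W p) Kp.
have [bB mW] := modify_graph aP W'W nearW' tube f0W gP.
have fd p : supp P p -> dom N d (f0 p).
  by move=> Kp; have [] := nearW' p _ (f0W p) Kp.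
have fd1 p : supp P p -> dom N d (f1 p).
  by move=> Kp; have [] := nearW' p _ (f1W p) Kp.
have KG : supp P `<=` G by move=> p Kp; split=> //; exact: fd1.
have sm : smooth_map (modify P f0 g).
  apply/smooth_in_setT.
  exact: (modify_smooth aP sf0.1 oG KG sg fd bB openT si0).
have [|f [sf cf fP]] := W1P (modify P f0 g) f1 sm sf1 mW.
  by move=> p; exact/W'W/f1W.
(* Interpolating between equal values changes nothing, so agreement already reached is kept while
   the core of [P] is added. *)
have E p : f0 p = f1 p \/ core P p -> modify P f0 g p = f1 p.
  move=> H; have [Kp|nKp] := pselect (supp P p); last first.
    rewrite modify_off//; case: H => // Cp; exfalso; apply: nKp.
    by apply: cs; rewrite C1// oner_neq0.
  rewrite modify_supp//; have -> : blend P f0 g p = g p.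
    rewrite /blend; case: H => [->|/C1 ->].
      by rewrite -scalerDl subrK scale1r.
    by rewrite subrr scale0r add0r scale1r.
  by rewrite /g/= chartK//; exact: fd1.
exists f; split; first exact: sf.
  apply: cohomologous_trans cf.
  apply: (@cohomologous_local _ _ _ _ _ omega f0 _ (supp P) d (center P) (radius P)) => //.
  - by move=> p nKp; rewrite modify_off.
  - move=> p Kp; split; first exact: fd.
    have [dp fh] := nearW' p _ (f0W p) Kp.
    exact: (tube p _ Kp fh).1.
  - move=> p Kp; have [dm ->] := modify_chart aP KG fd bB Kp.
    by split=> //; exact: bB.
move=> p [H|[Cp|lp]]; apply: fP; [left|left|by right]; apply: E; by [left|right].
Qed.

Lemma near_cohomologous h : compact [set: M] -> continuous h ->
  exists W, graph_nbhs W h /\ forall f0 f1, smooth_map f0 -> smooth_map f1 ->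
    (forall p, W (p, f0 p)) -> (forall p, W (p, f1 p)) -> cohomologous omega f0 f1.
Proof.
move=> cM ch; have [l al lT] := adapted_cover cM ch.
have [W [nW WP]] := near_cohomologous_step ch al; exists W; split=> // f0 f1 s0 s1 w0 w1.
have [f [sf cf fE]] := WP f0 f1 s0 s1 w0 w1.
have -> : f1 = f by apply/funext => p; rewrite fE// lT; right.
exact: cf.
Qed.

Lemma homotopic_cohomologous f0 f1 : compact [set: M] ->
  smooth_map f0 -> smooth_map f1 -> homotopic f0 f1 -> cohomologous omega f0 f1.
Proof.
move=> cM s0 s1 [H [cH H0 H1]].
(* [H] is continuous only within the closed strip; retracting time onto the unit interval makes [h]
   a family over all of [R] and spares one-sided neighbourhoods at the ends. *)
pose clamp (t : R) : R := Num.max 0 (Num.min 1 t).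
have cl01 t : 0 <= clamp t <= 1.
  by rewrite /clamp le_max lexx/= ge_max ler01/= ge_min lexx.
have clE t : 0 <= t <= 1 -> clamp t = t.
  by move=> /andP[t0 t1]; rewrite /clamp min_r// max_r.
have cclamp : continuous clamp.
  move=> t; apply: (@continuous_max _ _ (fun=> 0) (fun s : R => Num.min 1 s)).
    exact: cst_continuous.
  by apply: (@continuous_min _ _ (fun=> 1) id); [exact: cst_continuous|exact: cvg_id].
pose h (t : R) (p : M) := H (p, clamp t).
have chH : continuous (fun x : M * R => H (x.1, clamp x.2)).
  move=> [p t]; move/subspace_continuousP : cH => /(_ (p, clamp t)).
  rewrite /= in_itv/= cl01 => /(_ (conj I isT)) cHt.
  apply: (@cvg_comp _ _ _ (fun x : M * R => (x.1, clamp x.2)) H _ _ _ _ cHt).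
  have c1 : {for (p, t), continuous (fun x : M * R => (x.1, clamp x.2))}.
    have c2 : {for (p, t), continuous (fun x : M * R => clamp x.2)}.
      by apply: (@continuous_comp _ _ _ snd clamp); [exact: cvg_snd|exact: cclamp].
    exact: (@cvg_pair _ _ _ _ _ _ _ _ _ (fun x : M * R => x.1)
      (fun x : M * R => clamp x.2) cvg_fst c2).
  move=> A; rewrite /within/= => nA.
  have nB : nbhs (p, t) [set x : M * R | ([set: M] `*` `[0, 1]%classic) (x.1, clamp x.2) ->
      A (x.1, clamp x.2)] by exact: (c1 _ nA).
  apply: nbhs_sub nB => x; apply; split=> //.
  by have := cl01 x.2; rewrite [X in X -> _]/= [X in _ -> X]/= in_itv.
have ch t : continuous (h t).
  move=> p; apply: (@continuous_comp _ _ _ (fun p : M => (p, t))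
    (fun x : M * R => H (x.1, clamp x.2))); last exact: chH.
  exact: (@cvg_pair _ _ _ _ _ _ _ _ _ (fun p : M => p) (fun=> t) cvg_id (cvg_cst t)).
(* Tube lemma: as [M] is compact, the graph of [h s] stays in [W] for all [s] near [t]. *)
have tube (t : R) W : graph_nbhs W (h t) -> \forall s \near t, forall p, W (p, h s p).
  move=> [opW Wt].
  have nc : near_covering [set: M] by exact/compact_near_coveringP.
  have := nc _ (nbhs t) (fun s p => W (p, h s p)) (nbhs_filter t).
  move=> H'; apply: nbhs_sub (H' _) => [s Ss p|p _]; first exact: Ss.
  have cG : {for (p, t), continuous (fun x : M * R => (x.1, H (x.1, clamp x.2)))}.
    exact: (@cvg_pair _ _ _ _ _ _ _ _ _ (fun x : M * R => x.1)
      (fun x : M * R => H (x.1, clamp x.2)) cvg_fst (chH (p, t))).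
  exact: (cG _ (open_nbhs_nbhs (conj opW (Wt p)))).
(* Smooth maps in arbitrarily thin tubes stand in for [h t], which need not have a pullback. *)
pose S (t : R) := forall W, graph_nbhs W (h t) ->
  exists f, [/\ smooth_map f, forall p, W (p, f p) & cohomologous omega f0 f].
(* A tube [W0] as in [near_cohomologous], containing both graphs, lets a smooth map near [h t] be
   exchanged for one near [h s]. *)
have hn (t s : R) (W0 : set (M * N)) : open W0 ->
    (forall g0 g1, smooth_map g0 -> smooth_map g1 -> (forall p, W0 (p, g0 p)) ->
      (forall p, W0 (p, g1 p)) -> cohomologous omega g0 g1) ->
    (forall p, W0 (p, h t p)) -> (forall p, W0 (p, h s p)) -> S t -> S s.
  move=> oW0 W0P Wt Ws St W [opW Wh].
  have [f [sf fW cf]] := St W0 (conj oW0 Wt).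
  have [|f' sf' f'W] := @smooth_dense (h s) (W `&` W0) cM (ch s).
    by split; [exact: openI|move=> p; split].
  exists f'; split; [exact: sf'|by move=> p; have [] := f'W p|].
  apply: cohomologous_trans cf _; apply: (W0P _ _ sf sf' fW) => p.
  by have [] := f'W p.
have locS (t : R) : \forall s \near t, S s <-> S t.
  have [W0 [nW0 W0P]] := near_cohomologous cM (ch t).
  have [opW0 Wt] := nW0.
  apply: nbhs_sub (tube t W0 nW0) => s Ws.
  by split; [exact: (hn s t W0 opW0 W0P Ws Wt)|exact: (hn t s W0 opW0 W0P Wt Ws)].
have oS : open [set t | S t].
  by rewrite openE => t St; apply: nbhs_sub (locS t) => s [_ ts]; exact: ts.
have clS : closed [set t | S t].
  rewrite -openC openE => t nSt; apply: nbhs_sub (locS t) => s [st _] Ss.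
  exact: nSt (st Ss).
have S0 : S 0.
  move=> W [opW Wh]; exists f0; split; [exact: s0| |exact: cohomologous_refl].
  by move=> p; rewrite -H0 -[0]clE ?lexx ?ler01//; exact: Wh.
have E : `[0, 1]%classic `&` [set t : R | S t] = `[0, 1]%classic.
  apply: (@segment_connected R 0 1).
  - by exists 0; split=> //=; rewrite in_itv/= lexx ler01.
  - by exists [set t | S t].
  - by exists [set t | S t].
have S1 : S 1.
  have : (`[0, 1]%classic : set R) 1 by rewrite /= in_itv/= ler01 lexx.
  by rewrite -E => -[].
(* [f1] lies in every tube around [h 1], so in this one it is cohomologous to the smooth map that
   [S 1] provides. *)
have [W [nW WP]] := near_cohomologous cM (ch 1).
have [f [sf fW cf]] := S1 W nW.
apply: cohomologous_trans cf _; apply: (WP _ _ sf s1 fW) => p.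
by rewrite -H1 -[1]clE ?lexx ?ler01//; exact: nW.2.
Qed.

End deformation.

(** * Positive definite matrices and volumes of boxes *)

Section linear_algebra.
Context {R : rcfType}.

Definition posdef {m : nat} (P : 'M[R]_m) : Prop :=
  P^T = P /\ forall v : 'rV[R]_m, v != 0 -> 0 < (v *m P *m v^T) 0 0.

Lemma posdef_unit {m : nat} (P : 'M[R]_m) : posdef P -> P \in unitmx.
Proof.
move=> [_ pos]; rewrite -row_free_unit -kermx_eq0; apply/rowV0P => v /sub_kermxP vP.
apply/eqP; apply: contraT => /pos.
by rewrite vP mul0mx mxE ltxx.
Qed.

Lemma posdef_inv {m : nat} (P : 'M[R]_m) : posdef P -> posdef (invmx P).
Proof.
move=> pP; have uP := posdef_unit pP; have [symP pos] := pP.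
split=> [|v v0]; first by rewrite trmx_inv symP.
have w0 : v *m invmx P != 0.
  apply: contra v0 => /eqP E; apply/eqP.
  by rewrite -[v](mulmxKV uP) E mul0mx.
have := pos _ w0; rewrite trmx_mul trmx_inv symP.
by rewrite -!mulmxA (mulmxA P) (mulmxV uP) mul1mx !mulmxA.
Qed.

(* Cholesky decomposition, by induction through the Schur complement. *)
Lemma posdef_factor {m : nat} (P : 'M[R]_m) : posdef P -> exists E : 'M[R]_m, E^T *m E = P.
Proof.
elim: m P => [|m IH] P [symP pos].
  by exists 0; apply/matrixP => -[].
pose P' : 'M[R]_(1 + m) := P.
pose a := P' 0 0; pose u : 'rV[R]_m := ursubmx P'; pose Q : 'M[R]_m := drsubmx P'.
have ulE : ulsubmx P' = a%:M.
  by rewrite [LHS]mx11_scalar; congr (_%:M); rewrite !mxE; congr (P' _ _); apply/val_inj.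
have dlE : dlsubmx P' = u^T by rewrite /u trmx_ursub; congr dlsubmx; exact: esym symP.
have QT : Q^T = Q by rewrite /Q trmx_drsub; congr drsubmx; exact: symP.
have PE : P' = block_mx a%:M u u^T Q by rewrite -ulE -dlE submxK.
have a0 : 0 < a.
  have e0 : (delta_mx 0 0 : 'rV[R]_(1 + m)) != 0.
    by apply/eqP => /rowP/(_ 0)/eqP; rewrite !mxE !eqxx oner_eq0.
  have := pos _ e0; rewrite -rowE trmx_delta -colE !mxE.
  by rewrite /a; congr (0 < P' _ _); apply/val_inj.
have an0 : a != 0 by rewrite gt_eqF.
pose S : 'M[R]_m := Q - a^-1 *: (u^T *m u).
have pS : posdef S.
  split; first by rewrite /S linearB/= linearZ/= trmx_mul trmxK QT.
  (* This [x] minimizes the form over the first coordinate; the minimum is the value of [S] at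
     [v]. *)
  move=> v v0; pose x : 'M[R]_1 := - a^-1 *: (v *m u^T).
  pose w : 'rV[R]_(1 + m) := row_mx x v.
  have w0 : w != 0.
    apply: contra v0 => /eqP E; apply/eqP.
    by rewrite -[v](row_mxKr x) -/w E linear0.
  have := pos _ w0; rewrite -[P]/P' PE.
  have -> : w *m block_mx a%:M u u^T Q *m w^T = v *m S *m v^T.
    rewrite /w tr_row_mx mul_row_block mul_row_col.
    have -> : x *m a%:M + v *m u^T = 0.
      rewrite mul_mx_scalar /x scalerA mulrN divff// scaleN1r.
      by rewrite addNr.
    rewrite mul0mx add0r; congr (_ *m _).
    rewrite /S mulmxBr -scalemxAr mulmxA /x -scalemxAl scaleNr addrC.
    by [].
  by [].
have [E' E'P] := IH S pS.
pose b := Num.sqrt a; have b2 : b * b = a by rewrite -expr2 sqr_sqrtr// ltW.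
have b0 : b != 0 by rewrite gt_eqF// sqrtr_gt0.
pose E : 'M[R]_(1 + m) := block_mx b%:M (b^-1 *: u) 0 E'.
suff EE : E^T *m E = P' by exists E; exact: EE.
rewrite PE /E tr_block_mx mulmx_block !trmx0 !mulmx0 !mul0mx !addr0.
have bb : b * b^-1 = 1 by rewrite divff.
have bb' : b^-1 * b = 1 by rewrite mulVf.
have uT : (b^-1 *: u)^T = b^-1 *: u^T by rewrite linearZ.
rewrite tr_scalar_mx -scalar_mxM b2 uT mul_scalar_mx mul_mx_scalar !scalerA.
rewrite ?bb ?bb' !scale1r -scalemxAl -scalemxAr scalerA E'P.
by rewrite -invfM b2 /S addrC subrK.
Qed.

(** With [P = E^T *m E] the trace is the sum of the squared entries of [E *m e *m E^T]. *)
Lemma mxtrace_sandwich_ge0 {m : nat} (P e : 'M[R]_m) : posdef P ->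
  0 <= \tr (P *m e *m P *m e^T).
Proof.
move=> /posdef_factor[E <-].
have -> : \tr (E^T *m E *m e *m (E^T *m E) *m e^T) =
    \tr ((E *m e *m E^T) *m (E *m e *m E^T)^T).
  rewrite -!mulmxA mxtrace_mulC !trmx_mul trmxK !mulmxA.
  by [].
apply: sumr_ge0 => i _; rewrite mxE; apply: sumr_ge0 => j _.
by rewrite [X in _ * X]mxE -expr2 sqr_ge0.
Qed.

End linear_algebra.

Section integration.
Context {R : realType}.

(** The integral of a nonnegative function is a supremum over the simple functions below it. This
    serves the partially integrated functions inside [lebesgue_int], which come without a
    measurability proof. *)
Lemma ge0_integral_mono (f g : R -> \bar R) : (forall t, 0 <= f t)%E ->
  (forall t, f t <= g t)%E ->
  (\int[@lebesgue_measure R]_t f t <= \int[@lebesgue_measure R]_t g t)%E.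
Proof.
move=> f0 fg; have g0 t : (0 <= g t)%E by exact: le_trans (fg t).
rewrite !ge0_integralTE//; apply: ereal_sup_le => _ [h /= hf <-].
by exists h => //= t; exact: le_trans (fg t).
Qed.

(** Induction on the dimension: the inner integral obeys the same kind of bound and vanishes once
    the first coordinate is [r] away from the centre, so each integration costs the side
    [r *+ 2]. *)
Lemma lebesgue_int_box {m : nat} (f : 'rV[R]_m -> \bar R) (y0 : 'rV[R]_m) (r C : R) :
  0 < r -> 0 <= C -> (forall y, 0 <= f y <= C%:E)%E ->
  (forall (y : 'rV[R]_m) i, r <= `|y0 0 i - y 0 i| -> f y = 0%E) ->
  (0 <= lebesgue_int f <= (C * (r *+ 2) ^+ m)%R%:E)%E.
Proof.
move=> r0; elim: m f y0 C => [|m IH] f y0 C C0 fC f0 /=.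
  by rewrite expr0 mulr1.
pose g t := lebesgue_int (fun y : 'rV[R]_m => f (row_mx (t : R)%:M y)).
pose y1 : 'rV[R]_m := rsubmx (y0 : 'rV[R]_(1 + m)).
pose K := C * (r *+ 2) ^+ m.
have K0 : 0 <= K by rewrite mulr_ge0// exprn_ge0// mulrn_wge0// ltW.
(* [D] is free so as to be [C] for the bound and 0 for the vanishing. *)
have g1 (t : R) (D : R) : 0 <= D -> (forall y, 0 <= f (row_mx t%:M y) <= D%:E)%E ->
    (0 <= g t <= (D * (r *+ 2) ^+ m)%R%:E)%E.
  move=> D0 fD; apply: (IH _ y1) => // y i yi; apply: (f0 _ (rshift 1 i)).
  by move: yi; rewrite mxE (row_mxEr t%:M y).
have gK t : (0 <= g t <= K%:E)%E by apply: g1.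
have g0 (t : R) : r <= `|y0 0 0 - t| -> g t = 0%E.
  move=> rt; have fz (y : 'rV[R]_m) : f (row_mx t%:M y) = 0%E.
    apply: (f0 _ 0); have -> : row_mx t%:M y 0 0 = t; last exact: rt.
    have -> : (0 : 'I_(1 + m)) = lshift m 0 by apply/val_inj.
    by rewrite row_mxEl mxE.
  have := g1 t 0 (lexx 0); rewrite mul0r => H.
  by apply/eqP; rewrite eq_le andbC; apply: H => y; rewrite fz lexx.
set a := y0 0 0.
pose I : set R := `]a - r, a + r[%classic.
have gI t : (g t <= (K * \1_I t)%R%:E)%E.
  have [tI|ntI] := pselect (I t).
    by rewrite indicE mem_set// mulr1; have /andP[] := gK t.
  rewrite indicE memNset// mulr0 g0// leNgt -/a distrC ltr_distl; apply/negP.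
  by move=> H; apply: ntI; rewrite /I/= in_itv.
apply/andP; split; first by apply: integral_ge0 => t _; have /andP[] := gK t.
apply: (@le_trans _ _ (\int[@lebesgue_measure R]_t (K * \1_I t)%R%:E)%E).
  by apply: ge0_integral_mono => // t; have /andP[] := gK t.
have mI : measurable I by exact: measurable_itv.
have -> : (\int[@lebesgue_measure R]_t (K * \1_I t)%R%:E =
    K%:E * @lebesgue_measure R I)%E.
  have := @integralZl_indic _ _ R (@lebesgue_measure R) setT measurableT (fun=> I) K.
  move=> ->//; last by move=> K0'; have := lt_le_trans K0' K0; rewrite ltxx.
  by rewrite integral_indic// setIT.
have -> : @lebesgue_measure R I = (r *+ 2)%:E.
  rewrite lebesgue_measure_itv/= lte_fin ltrD2l gtrN// -EFinB.
  by congr (_%:E); rewrite opprB addrC addrA subrK mulr2n.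
by rewrite -EFinM /K exprSr mulrA.
Qed.

End integration.

(** * The energy inequality *)

Section smooth_inverse.
Context {R : realType} {m : nat}.
Implicit Types U : set 'rV[R]_m.

Lemma Ck_det k U n (f : 'rV[R]_m -> 'M[R]_n) : open U ->
  Ck k U f -> Ck k U (fun y => \det (f y)).
Proof.
move=> oU /(Ck_mx _ _ oU) cf; apply: Ck_sum => // s _.
by apply: CkM => //; [exact: Ck_cstr|apply: Ck_prod => // i; exact: cf].
Qed.

(** Cofactor formula: the entries are polynomials in those of [f], divided by a nonvanishing
    determinant. *)
Lemma Ck_invmx k U n (f : 'rV[R]_m -> 'M[R]_n) : open U ->
  (forall y, U y -> f y \in unitmx) -> Ck k U f -> Ck k U (fun y => invmx (f y)).
Proof.
move=> oU uf cf; apply/Ck_mx => // i j.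
have cd := Ck_det oU cf.
pose g y := (\det (f y))^-1 * ((-1) ^+ (j + i) * \det (row' j (col' i (f y)))).
apply: (@Ck_ext _ _ _ _ _ g) => //.
  by move=> y Uy; rewrite /g /invmx (uf y Uy) !mxE.
apply: CkM => //; first by apply: Ck_inv => // y /uf; rewrite unitmxE unitfE.
apply: CkM => //; first exact: Ck_cstr.
apply: Ck_det => //; apply/Ck_mx => // a b.
by apply: Ck_ext ((Ck_mx _ _ oU).1 cf (lift j a) (lift i b)) => // y _; rewrite !mxE.
Qed.

End smooth_inverse.

Lemma invmx_congruence {R : fieldType} {n : nat} (J G : 'M[R]_n) :
  J \in unitmx -> G \in unitmx ->
  invmx (J *m G *m J^T) = (invmx J)^T *m invmx G *m invmx J.
Proof.
move=> uJ uG; have uJT : J^T \in unitmx by rewrite unitmx_tr.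
have uA : J *m G *m J^T \in unitmx by rewrite !unitmx_mul uJ uG uJT.
apply: (can_inj (mulmxK uA)); rewrite mulVmx// trmx_inv.
rewrite -!mulmxA (mulmxA (invmx J)) mulVmx// mul1mx (mulmxA (invmx G)) mulVmx// mul1mx.
by rewrite mulVmx.
Qed.

Section riemannian.
Context {R : realType} {m : nat} {M : manifold R m} (g : riemannian_metric M).

Lemma metric_posdef p : posdef (g p).
Proof. by split; [exact: Defs.metric_sym|exact: Defs.metric_pos]. Qed.

Lemma inner2_ge0 p (a : 'M[R]_m) : 0 <= inner2 g p a a.
Proof.
rewrite /inner2 mulr_ge0 ?invr_ge0//.
exact: (mxtrace_sandwich_ge0 a (posdef_inv (metric_posdef p))).
Qed.

Lemma norm2_sq p (a : 'M[R]_m) : norm2 g p a ^+ 2 = inner2 g p a a.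
Proof. by rewrite /norm2 sqr_sqrtr// inner2_ge0. Qed.

Lemma inner2C p (a b : 'M[R]_m) : inner2 g p a b = inner2 g p b a.
Proof.
rewrite /inner2 -mxtrace_tr !trmx_mul trmxK trmx_inv (Defs.metric_sym g p).
by rewrite !mulmxA mxtrace_mulC !mulmxA.
Qed.

Lemma inner2B p (a b c : 'M[R]_m) : inner2 g p a (b - c) = inner2 g p a b - inner2 g p a c.
Proof. by rewrite /inner2 linearB/= mulmxBr linearB/= mulrBr. Qed.

(** The difference of the two sides is the squared norm of [b - a]. *)
Lemma inner2_sq_ge p (a b : 'M[R]_m) :
  inner2 g p a a + (inner2 g p a (b - a) + inner2 g p a (b - a)) <= inner2 g p b b.
Proof.
have := inner2_ge0 p (b - a); rewrite !inner2B (inner2C p (b - a)) (inner2C p (b - a) a).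
rewrite !inner2B (inner2C p b a) => H; rewrite -subr_ge0.
by move: H; congr (0 <= _); ring.
Qed.

Lemma coord2_chart (a : M -> 'M[R]_m) c p : dom M c p ->
  coord2 a c (chart M c p) =
  coord_change c (chart M c p) *m a p *m (coord_change c (chart M c p))^T.
Proof. by move=> cp; rewrite /coord2 (chartK cp). Qed.

Lemma coord2_metric_unit c p : dom M c p -> coord2 g c (chart M c p) \in unitmx.
Proof.
move=> cp; rewrite (coord2_chart g cp) !unitmx_mul unitmx_tr.
by rewrite (coord_change_unit cp) (posdef_unit (metric_posdef p)).
Qed.

(** The coordinate change cancels against its inverse under the cyclic trace, so smoothness of the
    scalar product can be read in a fixed chart. *)
Lemma inner2_chart (a b : M -> 'M[R]_m) c p : dom M c p ->
  inner2 g p (a p) (b p) =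
  let G := invmx (coord2 g c (chart M c p)) in
  2^-1 * \tr (G *m coord2 a c (chart M c p) *m G *m (coord2 b c (chart M c p))^T).
Proof.
move=> cp; have uJ := coord_change_unit cp.
have uG := posdef_unit (metric_posdef p).
rewrite (coord2_chart g cp) (coord2_chart a cp) (coord2_chart b cp) /= /inner2.
move: (coord_change _ _) uJ => J uJ; rewrite (invmx_congruence uJ uG).
have uJT : J^T \in unitmx by rewrite unitmx_tr.
rewrite trmx_inv !trmx_mul trmxK; congr (_ * _).
rewrite -!mulmxA (mulmxA (invmx J) J) (mulVmx uJ) mul1mx.
rewrite (mulmxA J^T (invmx J^T)) (mulmxV uJT) mul1mx.
rewrite (mulmxA (invmx J) J) (mulVmx uJ) mul1mx.
by rewrite [RHS]mxtrace_mulC -!mulmxA (mulmxV uJT) mulmx1.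
Qed.

Lemma sfun_inner2 (a b : M -> 'M[R]_m) : smooth2 a -> smooth2 b ->
  sfun setT (fun p => inner2 g p (a p) (b p)).
Proof.
move=> sa sb c k; have oU : open (chart M c @` dom M c) by exact: image_open.
pose G y := invmx (coord2 g c y).
have uG y : (chart M c @` dom M c) y -> coord2 g c y \in unitmx.
  by move=> [p cp <-]; exact: coord2_metric_unit.
have cG : Ck k (chart M c @` dom M c) G by apply: Ck_invmx => //; exact: metric_smooth.
have cF : Ck k (chart M c @` dom M c)
    (fun y => 2^-1 * \sum_i (G y *m coord2 a c y *m G y *m (coord2 b c y)^T) i i).
  apply: CkM => //; first exact: Ck_cstr.
  apply: Ck_sum => // i _.
  have : Ck k (chart M c @` dom M c) (fun y => G y *m coord2 a c y *m G y *m (coord2 b c y)^T).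
    apply: Ck_mulmx => //; last by apply: Ck_trmx => //; exact: sb.
    by apply: Ck_mulmx => //; apply: Ck_mulmx => //; exact: sa.
  by move/(Ck_mx _ _ oU); exact.
apply: Ck_sub (_ : Ck k (chart M c @` dom M c) _); first by move=> y [].
apply: Ck_ext cF => // y cy.
have := inner2_chart a b (dom_param cy); rewrite (paramK cy) => E.
exact: esym E.
Qed.

(** * Finiteness of the volume and integrability of smooth functions *)

Variable vol : {measure set (borel M) -> \bar R}.
Hypothesis cM : compact [set: M].
Hypothesis volP : riemannian_volume g vol.

Lemma borel_open (A : set M) : open A -> measurable (A : set (borel M)).
Proof. by move=> oA; apply: sub_sigma_algebra. Qed.

(** [volP] turns the measure of a small coordinate ball into an integral over a cube, on which the
    continuous density [rho] is bounded. *)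
Lemma volume_locally_finite (x0 : M) :
  exists A : set M, [/\ open A, A x0 & (vol A < +oo)%E].
Proof.
set c := chart_at M x0; have cx : dom M c x0 by exact: dom_chart_at.
set y0 := chart M c x0; pose rho y := Num.sqrt (\det (coord2 g c y)).
have oI : open (chart M c @` dom M c) by exact: image_open.
have cy0 : (chart M c @` dom M c) y0 by exact: im_chart.
have crho : {for y0, continuous rho}.
  apply: (@continuous_comp _ _ _ (fun y => \det (coord2 g c y)) Num.sqrt).
    by apply: (Ck_det oI (metric_smooth g c 0)).
  exact: sqrt_continuous.
have nrho : \forall y \near y0, rho y <= rho y0 + 1.
  have : \forall y \near y0, `|rho y0 - rho y| < 1.
    by move/cvgrPdist_lt : crho => /(_ _ ltr01).
  apply: nbhs_sub => y; rewrite distrC => /ltW/(le_trans (ler_norm _)).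
  by rewrite lerBlDl addrC.
have /nbhs_ballP[r /= r0 Br] := nrho.
pose A : set M := [set p | dom M c p /\ ball y0 r (chart M c p)].
have oA : open A by apply: chart_preimage_open; exact: ball_open.
exists A; split=> //; first by split=> //; exact: ballxx.
rewrite (volP (c := c)); [|exact: borel_open|by move=> p []].
have C0 : 0 <= rho y0 + 1 by rewrite addr_ge0// sqrtr_ge0.
have AB y : (chart M c @` A) y -> ball y0 r y by move=> [p [_ Bp] <-].
pose f y : \bar R := (\1_(chart M c @` A) y * Num.sqrt (\det (coord2 g c y)))%:E.
have fC y : (0 <= f y <= (rho y0 + 1)%:E)%E.
  rewrite /f !lee_fin mulr_ge0 ?sqrtr_ge0//=.
  have [Ay|nAy] := pselect ((chart M c @` A) y).
    by rewrite indicE mem_set// mul1r; exact/Br/AB.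
  by rewrite indicE memNset// mul0r.
have f0 (y : 'rV[R]_m) i : r <= `|y0 0 i - y 0 i| -> f y = 0%E.
  move=> yi; have nA : ~ (chart M c @` A) y.
    move=> /AB[_ /(_ 0 i)]; rewrite -ball_normE/= => /lt_le_trans/(_ yi).
    by rewrite ltxx.
  by rewrite /f indicE memNset// mul0r.
have /andP[_ H] := lebesgue_int_box r0 C0 fC f0.
exact: le_lt_trans H (ltry _).
Qed.

Lemma volume_finite : (vol setT < +oo)%E.
Proof.
have /choice[A AP] := volume_locally_finite.
have [s [_ cov]] : exists s : seq M, (forall x, x \in s -> setT x) /\
    forall p, setT p -> exists2 x, x \in s & A x p.
  by apply: compact_seq_cover => // x _; have [] := AP x.
have finS (s' : seq M) : exists B : set (borel M), [/\ measurable B, (vol B < +oo)%E &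
    forall p, (exists2 x, x \in s' & A x p) -> B p].
  elim: s' => [|x s' [B [mB Bfin BP]]].
    by exists set0; split=> //; [rewrite measure0 ltry|move=> p []].
  have [opO Oxx Ofin] := AP x; have mO := borel_open opO.
  exists ((A x : set (borel M)) `|` B); split; first exact: measurableU.
    rewrite measureUfinl//; apply: (@le_lt_trans _ _ (vol (A x) + vol B)%E).
      by rewrite leeBlDr ?leeDl// ge0_fin_numE// (le_lt_trans _ Bfin)// le_measure//
        ?inE//; exact: measurableI.
    exact: lte_add_pinfty.
  move=> p [z]; rewrite inE => /predU1P[->|zs] Op; first by left.
  by right; apply: BP; exists z.
have [B [mB Bfin BP]] := finS s.
have -> : [set: borel M] = B by apply/seteqP; split=> // p _; apply: BP; exact: cov.
exact: Bfin.
Qed.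

(** On the compact [M] a smooth function is continuous, hence Borel and bounded, and the volume is
    finite. *)
Lemma sfun_integrable (f : M -> R) : sfun setT f ->
  vol.-integrable setT (EFin \o (f : borel M -> R)).
Proof.
move=> sf; have cf : continuous f by move=> p; apply: sfun_continuous sf _ => //; exact: openT.
apply: measurable_bounded_integrable => //.
- exact: volume_finite.
- apply: (measurability _ (measurable_realfun.RGenOpens.measurableE R)) => _ [_ [a [b ->]] <-].
  rewrite setTI; apply: borel_open; apply: open_comp; last exact: interval_open.
  by move=> p _; exact: cf.
- have : compact (f @` setT).
    by apply: continuous_compact => //; exact: continuous_subspaceT.
  move=> /compact_bounded[C [Cr CP]]; exists C; split=> // x Cx p _.
  by apply: CP => //; exists p.
Qed.

End riemannian.

(** [u] is to be the cross term of the pointwise inequality, which occurs twice there; its integral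
    being zero, it can be added to [f] for free. *)
Lemma integral_le_add_null {R : realType} d (T : measurableType d)
    (mu : {measure set T -> \bar R}) (f h u : T -> R) :
  mu.-integrable setT (EFin \o f) -> mu.-integrable setT (EFin \o h) ->
  mu.-integrable setT (EFin \o u) -> (\int[mu]_x (u x)%:E = 0)%E ->
  (forall x, f x + (u x + u x) <= h x) ->
  (\int[mu]_x (f x)%:E <= \int[mu]_x (h x)%:E)%E.
Proof.
move=> if_ ih iu u0 fh; have iuu := integrableD measurableT iu iu.
have -> : (\int[mu]_x (f x)%:E = \int[mu]_x ((f x)%:E + ((u x)%:E + (u x)%:E)))%E.
  rewrite integralD// (integralD measurableT iu iu) u0 !adde0.
  by [].
apply: le_integral => //; first exact: integrableD.
by move=> x _; rewrite -!EFinD lee_fin.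
Qed.

Theorem theorem2p3 (R : realType) (m n : nat)
    (M : manifold R m) (g : riemannian_metric M)
    (vol : {measure set (borel M) -> \bar R})
    (N : manifold R n) (omega : symplectic_form N)
    (phi : M -> N) :
  compact [set: M] ->
  riemannian_volume g vol ->
  smooth_map phi ->
  coclosed g vol (pullback phi omega) ->
  forall psi : M -> N, smooth_map psi -> homotopic phi psi ->
    (energy g vol omega phi <= energy g vol omega psi)%E.
Proof.
move=> cM volP sphi [_ coP] psi spsi hom.
have [eta seta deta] := homotopic_cohomologous omega cM sphi spsi hom.
have [_ somega] := sform_form2 omega.
set a := pullback phi omega; set b := pullback psi omega.
have sa : smooth2 a by exact: pullback_smooth2.
have sb : smooth2 b by exact: pullback_smooth2.
(* The cross term [<phi^* omega, d eta>], written through [b - a] so that its smoothness follows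
   from that of the pullbacks. *)
pose u p := inner2 g p (a p) (b p - a p).
have int_u : (\int[vol]_p (u p)%:E = 0)%E.
  transitivity (\int[vol]_p (inner2 g p (a p) (d1 eta p))%:E)%E.
    by apply: eq_integral => p _; rewrite /u (deta p).
  (* Coclosedness tested against [eta] leaves the pairing with the zero 1-form; the support of [eta]
     is compact as a closed subset of [M]. *)
  rewrite coP//.
    rewrite -[RHS](integral0 vol setT); apply: eq_integral => p _.
    by rewrite /inner1 trmx0 !mul0mx mxE.
  by apply: subclosed_compact cM _ => //; exact: closed_closure.
have su : sfun setT u.
  have := sfunB openT (sfun_inner2 g sa sb) (sfun_inner2 g sa sa).
  by apply: sfun_ext openT _ => p _; rewrite /u inner2B.
have iu := sfun_integrable cM volP su.
have iaa := sfun_integrable cM volP (sfun_inner2 g sa sa).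
have ibb := sfun_integrable cM volP (sfun_inner2 g sb sb).
have enE (f : M -> N) : energy g vol omega f =
    ((2^-1)%:E * \int[vol]_p (inner2 g p (pullback f omega p) (pullback f omega p))%:E)%E.
  congr (_ * _)%E; apply: eq_integral => p _.
  by rewrite norm2_sq.
rewrite (enE phi) (enE psi); apply: lee_wpmul2l; first by rewrite lee_fin invr_ge0.
apply: (integral_le_add_null iaa ibb iu int_u) => p; exact: inner2_sq_ge.
Qed.
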